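(* Let $\Omega\subset\mathbb{R}^d$ be a bounded domain with smooth boundary, let $a\in C_0^\infty(\Omega)$ be nonnegative and not identically zero, let $V\subset\Omega$ be open, and let $\varphi\in C^\infty(\mathbb{R}^d;\mathbb{R})$ satisfy the sub-ellipticity condition in $\overline V$. Let $\nu(x)=\sqrt{1+\lambda^2a(x)^2}$ and let $P_\varphi,Q_1,Q_2$ be the operators (depending on $\lambda,\tau$) defined in the context. Then there exist positive constants $C,\tilde K,\lambda_0$ such that for every $v\in C_0^\infty(V)$, every $\lambda\ge\lambda_0$ and every $\tau\ge\max\{\tilde K|\lambda|^{5/4},1\}$, $$\tau^3\|\nu v\|_{L^2(V)}^2+\tau\|\nu Dv\|_{L^2(V)}^2+\|Q_1v\|_{L^2(V)}^2+\|Q_2v\|_{L^2(V)}^2\le C\,\|P_\varphi v\|_{L^2(V)}^2 .$$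
   Context: Notation: $D_j=-i\partial_{x_j}$, $D=(D_1,\dots,D_d)$, $D^2=\sum_jD_j^2$, $Da(x)D=\sum_jD_ja(x)D_j$. The operator is $P(x,D,\lambda)=D^2+i\lambda Da(x)D-\lambda^2$, and its conjugate is $P_\varphi=e^{\tau\varphi}P(x,D,\lambda)e^{-\tau\varphi}$, that is $$P_\varphi=(D+i\tau\nabla\varphi)^2+i\lambda(D+i\tau\nabla\varphi)a(x)(D+i\tau\nabla\varphi)-\lambda^2 .$$ With $P_\varphi^*$ the formal $L^2$-adjoint, $Q_2=\frac12(P_\varphi+P_\varphi^* )$ and $Q_1=\frac1{2i}(P_\varphi-P_\varphi^* )$, so $P_\varphi=Q_2+iQ_1$. Poisson bracket: $\{b,c\}=\sum_{j=1}^d(\partial_{\xi_j}b\,\partial_{x_j}c-\partial_{x_j}b\,\partial_{\xi_j}c)$. Sub-ellipticity: for a bounded open set $V\subset\mathbb{R}^d$, $\varphi\in C^\infty(\mathbb{R}^d;\mathbb{R})$ satisfies the sub-ellipticity condition in $\overline V$ if $|\nabla\varphi|>0$ in $\overline V$ and there is a constant $c>0$ such that for all $(x,\xi)\in\overline V\times\mathbb{R}^d$ and $\tau>0$: if $\mathbb{q}_2(x,\xi,\tau)=\mathbb{q}_1(x,\xi,\tau)=0$ then $\{\mathbb{q}_2,\mathbb{q}_1\}(x,\xi,\tau)\ge c(|\xi|^2+\tau^2)^{3/2}$, where $\mathbb{q}_2=|\xi|^2-\tau^2|\nabla\varphi(x)|^2$ and $\mathbb{q}_1=2\tau\,\xi\cdot\nabla\varphi(x)$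 (the real and imaginary parts of $\sum_j(\xi_j+i\tau\partial_{x_j}\varphi)^2$). *)

(* Defs.v *)
From HB Require Import structures.
From mathcomp Require Import all_boot all_order all_algebra complex.
From mathcomp Require Import all_classical all_reals all_analysis.

Set Implicit Arguments.
Unset Strict Implicit.
Unset Printing Implicit Defensive.
Import Order.TTheory GRing.Theory Num.Theory numFieldNormedType.Exports.
Local Open Scope classical_set_scope.
Local Open Scope ring_scope.
Local Open Scope complex_scope.

(* The product sigma-algebra (generated by the coordinates) on row vectors. *)
Definition measure_rV_display : measure_display.
Proof. exact: default_measure_display. Qed.

Section measurable_rV.
Context (R : realType) (n : nat).

Let coors : 'I_n -> 'rV[R]_n -> measurableTypeR R := fun i x => x ord0 i.

Let rV_set0 : g_sigma_preimage coors set0.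
Proof. exact: sigma_algebra0. Qed.

Let rV_setC A : g_sigma_preimage coors A -> g_sigma_preimage coors (~` A).
Proof. exact: sigma_algebraC. Qed.

Let rV_bigcup (F : (set 'rV[R]_n)^nat) :
  (forall i, g_sigma_preimage coors (F i)) ->
  g_sigma_preimage coors (\bigcup_i (F i)).
Proof. exact: sigma_algebra_bigcup. Qed.

HB.instance Definition _ := @isMeasurable.Build
  measure_rV_display 'rV[R]_n (g_sigma_preimage coors) rV_set0 rV_setC rV_bigcup.

Lemma measurable_coord (i : 'I_n) :
  measurable_fun [set: 'rV[R]_n]
    ((fun x => x ord0 i) : 'rV[R]_n -> measurableTypeR R).
Proof.
move=> _ Y mY; rewrite setTI; apply: sub_sigma_algebra => /=.
rewrite -bigcup_seq/=; exists i => /=; first by rewrite mem_index_enum.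
by exists Y => //; rewrite setTI.
Qed.

Lemma measurable_fun_coordP d (T : measurableType d) (f : T -> 'rV[R]_n) :
  measurable_fun [set: T] f <->
  forall i, measurable_fun [set: T] ((fun t => f t ord0 i) : T -> measurableTypeR R).
Proof.
apply: (@iff_trans _ (g_sigma_preimage
    (fun i => coors i \o f) `<=` measurable)).
  rewrite g_sigma_preimage_comp; split=> [mf A [/= C preC <-]|prefS].
    exact: mf.
  by move=> _ A mA; apply: prefS; exists A.
split=> [fS i|mf].
- move=> _ A mA; apply: fS; apply: sub_sigma_algebra.
  rewrite -bigcup_seq/=; exists i => /=; first by rewrite mem_index_enum.
  by exists A.
- apply: smallest_sub; first exact: sigma_algebra_measurable.
  rewrite -bigcup_seq; apply: bigcup_sub => i Ii.
  by move=> A [B mB <-]; exact: mf.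
Qed.

End measurable_rV.

Section lebesgue_rV.
Context (R : realType).

Section step.
Variables (n : nat) (mu : {sigma_finite_measure set 'rV[R]_n -> \bar R}).

Definition rV_cons (p : measurableTypeR R * 'rV[R]_n) : 'rV[R]_n.+1 :=
  row_mx (p.1%:M : 'rV[R]_1) p.2.

Definition rV_uncons (x : 'rV[R]_n.+1) : measurableTypeR R * 'rV[R]_n :=
  (x ord0 ord0, \row_i x ord0 (lift ord0 i)).

Lemma rV_cons0 p : rV_cons p ord0 ord0 = p.1.
Proof.
rewrite /rV_cons.
have -> : (ord0 : 'I_n.+1) = lshift n (ord0 : 'I_1) by apply/val_inj.
by rewrite (row_mxEl (p.1%:M : 'rV[R]_1) p.2) mxE eqxx mulr1n.
Qed.

Lemma rV_consS p i : rV_cons p ord0 (lift ord0 i) = p.2 ord0 i.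
Proof.
rewrite /rV_cons.
have -> : lift ord0 i = rshift 1 i by apply/val_inj.
by rewrite (row_mxEr (p.1%:M : 'rV[R]_1) p.2).
Qed.

Lemma rV_consK : cancel rV_cons rV_uncons.
Proof.
move=> p; rewrite /rV_uncons rV_cons0 [RHS]surjective_pairing; congr pair.
by apply/rowP => i; rewrite mxE rV_consS.
Qed.

Lemma measurable_rV_cons : measurable_fun setT rV_cons.
Proof.
apply/measurable_fun_coordP => i; case: (unliftP ord0 i) => [j|] ->.
  apply: (eq_measurable_fun
    (((fun x : 'rV[R]_n => x ord0 j) : _ -> measurableTypeR R) \o snd)).
    by move=> p _ /=; rewrite rV_consS.
  by apply: measurableT_comp => //; exact: measurable_coord.
apply: (eq_measurable_fun fst) => // p _; first by rewrite rV_cons0.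
Qed.

Lemma measurable_rV_uncons : measurable_fun setT rV_uncons.
Proof.
apply/measurable_fun_pairP; split; first exact: measurable_coord.
apply/measurable_fun_coordP => i.
apply: (eq_measurable_fun
  ((fun x : 'rV[R]_n.+1 => x ord0 (lift ord0 i)) : _ -> measurableTypeR R)).
  by move=> x _; rewrite /= mxE.
exact: measurable_coord.
Qed.

Definition lebesgue_rV_step : set 'rV[R]_n.+1 -> \bar R :=
  pushforward (@lebesgue_measure R \x mu)%E rV_cons.

Let step0 : lebesgue_rV_step set0 = 0%E.
Proof. by rewrite /lebesgue_rV_step /pushforward preimage_set0 measure0. Qed.

Let step_ge0 A : (0 <= lebesgue_rV_step A)%E.
Proof. by rewrite /lebesgue_rV_step /pushforward; exact: measure_ge0. Qed.

Let step_sigma_additive : semi_sigma_additive lebesgue_rV_step.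
Proof.
move=> F mF tF mUF; rewrite /lebesgue_rV_step /pushforward preimage_bigcup.
apply: measure_semi_sigma_additive.
- by move=> k; rewrite -[X in measurable X]setTI; exact: measurable_rV_cons.
- apply/trivIsetP => /= i j _ _ ij; rewrite -preimage_setI.
  by move/trivIsetP : tF => /(_ _ _ _ _ ij) ->//; rewrite preimage_set0.
- rewrite -preimage_bigcup -[X in measurable X]setTI.
  exact: measurable_rV_cons.
Qed.

HB.instance Definition _ := isMeasure.Build _ _ _ lebesgue_rV_step
  step0 step_ge0 step_sigma_additive.

Let step_sigma_finite : sigma_finite setT lebesgue_rV_step.
Proof.
have /sigma_finiteP[F [TF ndF Foo]] := sigma_finiteT (@lebesgue_measure R).
have /sigma_finiteP[G [TG ndG Goo]] := sigma_finiteT mu.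
exists (fun k => rV_uncons @^-1` (F k `*` G k)).
  rewrite -preimage_bigcup -(preimage_setT rV_uncons); congr (_ @^-1` _).
  rewrite -setXTT TF TG predeqE => -[x y]; split=> [[/= [k _ Fx] [l _ Gy]]|].
    exists (maxn k l) => //; split.
    - by move: x Fx; exact/subsetPset/ndF/leq_maxl.
    - by move: y Gy; exact/subsetPset/ndG/leq_maxr.
  by move=> [k _ []/= ? ?]; split; exists k.
move=> k; have [mF Fk] := Foo k; have [mG Gk] := Goo k.
have mFG : measurable (F k `*` G k) by exact: measurableX.
split; first by rewrite -[X in measurable X]setTI; exact: measurable_rV_uncons.
rewrite /lebesgue_rV_step /pushforward -comp_preimage.
have -> : rV_uncons \o rV_cons = id by apply/funext => p /=; rewrite rV_consK.
by rewrite preimage_id product_measure1E// lte_mul_pinfty// ge0_fin_numE.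
Qed.

HB.instance Definition _ := @Measure_isSigmaFinite.Build _ _ _
  lebesgue_rV_step step_sigma_finite.

End step.

(* Lebesgue measure on R^n: the n-fold product of the one on R. *)
Fixpoint lebesgue_rV (n : nat) : {sigma_finite_measure set 'rV[R]_n -> \bar R} :=
  match n with
  | 0%N => dirac (0 : 'rV[R]_0)
  | k.+1 => lebesgue_rV_step (lebesgue_rV k)
  end.

End lebesgue_rV.
Arguments lebesgue_rV {R} n.

Section calculus.
Context (R : realType) (d : nat).
Local Notation E := 'rV[R]_d.
Local Notation C := R[i].

Definition partial (j : 'I_d) (f : E -> R) : E -> R :=
  fun x => 'D_(delta_mx 0 j) f x.

(* C^oo(R^d; R): partial derivatives of all orders exist and are continuous;
   the sequence s lists the successive directions of differentiation. *)
Definition smooth (f : E -> R) : Prop :=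
  forall s : seq 'I_d,
    continuous (foldr partial f s) /\
    forall (j : 'I_d) (x : E), derivable (foldr partial f s) x (delta_mx 0 j).

Definition csmooth (u : E -> C) : Prop :=
  smooth (fun x => complex.Re (u x)) /\ smooth (fun x => complex.Im (u x)).

Definition grad (f : E -> R) (x : E) : E := \row_j partial j f x.

Definition dotp (x y : E) : R := \sum_j x 0 j * y 0 j.

(* The Euclidean norm; the library norm on row vectors is the sup norm. *)
Definition enorm (x : E) : R := Num.sqrt (dotp x x).

Definition compact_support_in (T : zmodType) (V : set E) (f : E -> T) : Prop :=
  let supp := closure [set x | f x != 0] in compact supp /\ supp `<=` V.

(* Elements of C_0^oo(V), extended by zero to R^d. *)
Definition real_test_function (V : set E) (f : E -> R) : Prop :=
  smooth f /\ compact_support_in V f.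

Definition test_function (V : set E) (u : E -> C) : Prop :=
  csmooth u /\ compact_support_in V u.

(* Bounded domain with smooth boundary, the boundary being described by local
   defining functions. *)
Definition smooth_boundary (Om : set E) : Prop :=
  forall p, (closure Om `\` interior Om) p ->
    exists (U : set E) (rho : E -> R),
      [/\ open U /\ U p,
          smooth rho,
          forall x, U x -> grad rho x != 0,
          Om `&` U = [set x | rho x < 0] `&` U &
          (closure Om `\` interior Om) `&` U = [set x | rho x = 0] `&` U].

Definition smooth_bounded_domain (Om : set E) : Prop :=
  [/\ open Om, connected Om, Om !=set0, bounded_set Om & smooth_boundary Om].

Definition poisson (b c : E -> E -> R) (x xi : E) : R :=
  \sum_j (partial j (b x) xi * partial j (c^~ xi) x
          - partial j (b^~ xi) x * partial j (c x) xi).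

Definition q2 (phi : E -> R) (tau : R) (x xi : E) : R :=
  enorm xi ^+ 2 - tau ^+ 2 * enorm (grad phi x) ^+ 2.

Definition q1 (phi : E -> R) (tau : R) (x xi : E) : R :=
  2 * tau * dotp xi (grad phi x).

Definition subelliptic (V : set E) (phi : E -> R) : Prop :=
  (forall x, closure V x -> 0 < enorm (grad phi x)) /\
  exists2 c : R, 0 < c &
    forall (x xi : E) (tau : R), closure V x -> 0 < tau ->
      q2 phi tau x xi = 0 -> q1 phi tau x xi = 0 ->
      c * (enorm xi ^+ 2 + tau ^+ 2) `^ (3 / 2)
        <= poisson (q2 phi tau) (q1 phi tau) x xi.

Definition L2norm (V : set E) (u : E -> C) : \bar R :=
  'N[lebesgue_rV d]_2%:E[(fun x => (ComplexField.Normc.normc (u x))%:E) \_ V]%E.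

Definition L2dot (u w : E -> C) : C :=
  (\int[lebesgue_rV d]_x complex.Re (u x * ((w x)^*)%C)) +i*
  (\int[lebesgue_rV d]_x complex.Im (u x * ((w x)^*)%C)).

(* The operator on C_0^oo(R^d) dual to A for the L^2 pairing; A^* w is unique
   when it exists, and 0 is the default value otherwise. *)
Definition formal_adjoint (A : (E -> C) -> E -> C) (w : E -> C) : E -> C :=
  xget (fun=> 0)
    [set g | test_function setT g /\
       forall u, test_function setT u -> L2dot (A u) w = L2dot u g].

Definition Dop (j : 'I_d) (u : E -> C) : E -> C := fun x =>
  - 'i%C * (partial j (fun y => complex.Re (u y)) x +i*
          partial j (fun y => complex.Im (u y)) x).

Definition Pop (a : E -> R) (lam : R) (u : E -> C) : E -> C := fun x =>
  \sum_j Dop j (Dop j u) x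
  + 'i%C * lam%:C * (\sum_j Dop j (fun y => (a y)%:C * Dop j u y) x)
  - (lam ^+ 2)%:C * u x.

Definition Pphi (a phi : E -> R) (lam tau : R) (u : E -> C) : E -> C := fun x =>
  (expR (tau * phi x))%:C
  * Pop a lam (fun y => (expR (- (tau * phi y)))%:C * u y) x.

Definition Q2 (a phi : E -> R) (lam tau : R) (u : E -> C) : E -> C := fun x =>
  2^-1 * (Pphi a phi lam tau u x + formal_adjoint (Pphi a phi lam tau) u x).

Definition Q1 (a phi : E -> R) (lam tau : R) (u : E -> C) : E -> C := fun x =>
  (2 * 'i%C)^-1
  * (Pphi a phi lam tau u x - formal_adjoint (Pphi a phi lam tau) u x).

Definition nu (a : E -> R) (lam : R) (x : E) : R :=
  Num.sqrt (1 + lam ^+ 2 * a x ^+ 2).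

End calculus.

(* Main.v *)
(* Put b = 1 + i lam a and w = b v. Since 1/b = (1 - i lam a) / nu^2, up to terms
   of first order in v one has P_phi v = X + i Y with
     X = (- lap - W) w,    W = tau^2 |grad phi|^2 + lam^2 / nu^2,
     i Y = tau (2 grad phi . grad + lap phi) w + i G w,    G = lam^3 a / nu^2,
   all coefficients being real. In |X + i Y|^2 the double product equals, up to
   divergences of compactly supported fields,
     4 tau H(grad w, grad w) + 4 tau^3 H(grad phi, grad phi) |w|^2 + smaller terms,
   H being the Hessian of phi. Sub-ellipticity says that the sum of
   H(xi, xi) + t^2 H(grad phi, grad phi), of M (xi . grad phi)^2 and of
   - rho (|xi|^2 - t^2 |grad phi|^2) is positive definite in (xi, t) for suitable
   M and rho; the second form is paid for by |Y|^2 and the third one by X, through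
   the divergence of rho w grad w. The derivatives of a cost little: a >= 0 gives
   |grad a|^2 <= C a, so that lam |grad a| <= C lam^(1/2) nu^(1/2), and the error
   terms are at most C lam^(5/2) <= C tau^2 / K^2. This is where the exponent 5/4
   comes from.

   The formal adjoint of P_phi for (lam, tau) is P_phi for (- lam, - tau), and
   |Q_1 v|^2 + |Q_2 v|^2 = (|P_phi v|^2 + |P_phi^* v|^2) / 2; the adjoint term is
   estimated like P_phi, with X - i Y in place of X + i Y. *)
Require Import Defs.
From mathcomp Require Import all_boot all_order all_algebra complex.
From mathcomp Require Import ring lra.
From mathcomp Require Import all_classical all_reals all_analysis.
From mathcomp Require Import measurable_realfun.
Set Implicit Arguments.
Unset Strict Implicit.
Unset Printing Implicit Defensive.
Import Order.TTheory GRing.Theory Num.Theory numFieldNormedType.Exports.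
Local Open Scope classical_set_scope.
Local Open Scope ring_scope.
Local Open Scope complex_scope.

(** * Smooth functions *)

(** Why w = b v: the second-order part of P is - div(b grad v), whose coefficient is complex and of
    size lam. In terms of w it is - lap w up to terms of first order in v, so the bracket condition
    can be applied to w with constants independent of lam, and |w| = nu |v| produces the weights nu.
    Why rho: with e = grad phi, sub-ellipticity controls only the sum H(xi, xi) + t^2 H(e, e), and
    only for xi orthogonal to e with |xi| = t |e|; either summand may be negative. The value rho =
    (c/2 - 4 H(e, e)) / |e|^2 moves the excess of one to the other, so that the form becomes
    positive in xi and in t separately; the component of xi along e is left to M. Every inequality
    is proved at a point, as real algebra in the derivatives of v, a, phi and rho there, with the
    divergences kept as an explicit summand. They disappear in a single integration at the end. The
    constant K acts only through kappa = 1 / K: each error term is kappa times a fixed multiple of a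
    term on the left-hand side or of |Y|^2. *)

Section smooth_closure.
Context (R : realType) (d : nat).
Local Notation E := 'rV[R]_d.
Implicit Types (f g : E -> R) (x v : E) (j : 'I_d).

(** Only a directional derivative of [f] is given, not differentiability, so the chain rule is taken
    for the restriction of [f] to the line through [x] with direction [v]: in one variable
    derivability is differentiability. *)
Lemma is_derive_comp (f : E -> R) (h dh : R -> R) x v (df : R) :
  (forall t : R, is_derive t 1 h (dh t)) -> is_derive x v f df ->
  is_derive x v (fun y => h (f y)) (dh (f x) * df).
Proof.
move=> Dh Df; pose F t := f (t *: v + x).
have dF : derivable F 0 1 by apply: (derivable1P f x v).1; case: Df.
have dh0 : derivable h (F 0) 1 by case: (Dh (F 0)).
have dhF : derivable (h \o F) 0 1.
  by apply/derivable1_diffP/differentiable_comp; apply/derivable1_diffP.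
have D0 (g : E -> R) : 'D_v g x = derive1 (fun t : R => g (t *: v + x)) 0.
  rewrite derive1E /derive; apply: (congr1 (fun F => lim (F @ 0^'))).
  by apply/funext => t /=; rewrite scale0r add0r addr0 [_%:A]mulr1.
apply: DeriveDef; first exact: (derivable1P _ x v).2.
rewrite D0 [X in X = _](derive1_comp dF dh0) derive1E /F scale0r add0r.
by rewrite (@derive_val _ _ _ _ _ _ _ (Dh _)) -D0 (@derive_val _ _ _ _ _ _ _ Df).
Qed.

(* The algebra generated by the smooth functions under the listed operations
   is stable under partial derivatives, hence consists of smooth functions. *)
Inductive smooth_gen : (E -> R) -> Prop :=
| gen_base f : smooth f -> smooth_gen f
| gen_cst c : smooth_gen (fun=> c)
| gen_add f g : smooth_gen f -> smooth_gen g -> smooth_gen (fun x => f x + g x)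
| gen_mul f g : smooth_gen f -> smooth_gen g -> smooth_gen (fun x => f x * g x)
| gen_exp f : smooth_gen f -> smooth_gen (fun x => expR (f x))
| gen_inv f : (forall x, f x != 0) -> smooth_gen f ->
    smooth_gen (fun x => (f x)^-1).

Lemma smooth_derivable f j x : smooth f -> derivable f x (delta_mx 0 j).
Proof. by move=> sf; exact: (sf [::]).2. Qed.

Lemma smooth_is_derive f j x : smooth f ->
  is_derive x (delta_mx 0 j) f (partial j f x).
Proof. by move=> sf; apply/derivableP/smooth_derivable. Qed.

Lemma smooth_continuous f : smooth f -> continuous f.
Proof. by move=> sf; exact: (sf [::]).1. Qed.

Lemma smooth_partial f j : smooth f -> smooth (partial j f).
Proof. by move=> sf s; rewrite -foldr_rcons; exact: sf. Qed.

Lemma is_derive_add f g x v (df dg : R) : is_derive x v f df ->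
  is_derive x v g dg -> is_derive x v (fun y => f y + g y) (df + dg).
Proof. exact: is_deriveD. Qed.

Lemma is_derive_mul f g x v (df dg : R) : is_derive x v f df ->
  is_derive x v g dg ->
  is_derive x v (fun y => f y * g y) (df * g x + f x * dg).
Proof.
move=> Df Dg; apply: (is_derive_eq (is_deriveM Df Dg)).
by rewrite addrC mulrC.
Qed.

Lemma is_derive_inv f x v (df : R) : f x != 0 -> is_derive x v f df ->
  is_derive x v (fun y => (f y)^-1) (- df * ((f x)^-1 * (f x)^-1)).
Proof.
move=> f0 Df; apply: DeriveDef; first exact: derivableV.
rewrite deriveV// (@derive_val _ _ _ _ _ _ _ Df) /= mulNr.
by rewrite -invfM -expr2 [LHS]mulNr mulrC.
Qed.

Lemma is_derive_exp f x v (df : R) : is_derive x v f df ->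
  is_derive x v (fun y => expR (f y)) (expR (f x) * df).
Proof. by apply: is_derive_comp => t; exact: is_derive_expR. Qed.

Lemma smooth_gen_partial f : smooth_gen f ->
  continuous f /\ forall j, (forall x, derivable f x (delta_mx 0 j)) /\
    smooth_gen (partial j f).
Proof.
elim=> {f} [f sf|c|f g _ [cf df] _ [cg dg]|f g gf [cf df] gg [cg dg]|
            f gf [cf df]|f f0 gf [cf df]].
- split=> [|j]; first exact: smooth_continuous.
  split=> [x|]; first exact: smooth_derivable.
  by apply: gen_base; exact: smooth_partial.
- split=> [x|j]; first exact: cst_continuous.
  split=> [x|]; first exact: derivable_cst.
  rewrite (_ : partial j _ = fun=> 0); first exact: gen_cst.
  by apply/funext => x; rewrite /partial derive_cst.
- split=> [x|j]; first exact: (continuousD (cf x) (cg x)).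
  have D x : is_derive x (delta_mx 0 j : E) (fun y => f y + g y)
      (partial j f x + partial j g x).
    by apply: is_derive_add; apply/derivableP; [exact: (df j).1|exact: (dg j).1].
  split=> [x|]; first by case: (D x).
  rewrite (_ : partial j _ = fun x => partial j f x + partial j g x).
    by apply: gen_add; [exact: (df j).2|exact: (dg j).2].
  by apply/funext => x; case: (D x).
- split=> [x|j]; first exact: (continuousM (cf x) (cg x)).
  have D x : is_derive x (delta_mx 0 j : E) (fun y => f y * g y)
      (partial j f x * g x + f x * partial j g x).
    by apply: is_derive_mul; apply/derivableP; [exact: (df j).1|exact: (dg j).1].
  split=> [x|]; first by case: (D x).
  rewrite (_ : partial j _ = fun x => partial j f x * g x + f x * partial j g x).
    by apply: gen_add; apply: gen_mul => //; [exact: (df j).2|exact: (dg j).2].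
  by apply/funext => x; case: (D x).
- split=> [x|j].
    by apply: continuous_comp; [exact: cf|exact: continuous_expR].
  have D x : is_derive x (delta_mx 0 j : E) (fun y => expR (f y))
      (expR (f x) * partial j f x).
    by apply: is_derive_exp; apply/derivableP; exact: (df j).1.
  split=> [x|]; first by case: (D x).
  rewrite (_ : partial j _ = fun x => expR (f x) * partial j f x).
    by apply: gen_mul; [exact: gen_exp|exact: (df j).2].
  by apply/funext => x; case: (D x).
- split=> [x|j]; first exact: (cvgV (f0 x) (cf x)).
  have D x : is_derive x (delta_mx 0 j : E) (fun y => (f y)^-1)
      (- partial j f x * ((f x)^-1 * (f x)^-1)).
    by apply: is_derive_inv => //; apply/derivableP; exact: (df j).1.
  split=> [x|]; first by case: (D x).
  rewrite (_ : partial j _ =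
      fun x => (-1 * partial j f x) * ((f x)^-1 * (f x)^-1)).
    apply: gen_mul; last by apply: gen_mul; exact: gen_inv.
    by apply: gen_mul; [exact: gen_cst|exact: (df j).2].
  by apply/funext => x; rewrite mulN1r; case: (D x).
Qed.

Lemma smooth_genP f : smooth_gen f -> smooth f.
Proof.
move=> gf s; suff : smooth_gen (foldr (@partial R d) f s).
  by move=> /smooth_gen_partial[cf df]; split => // j; exact: (df j).1.
by elim: s => //= j s /smooth_gen_partial[_ /(_ j)[]].
Qed.

Lemma smoothC (c : R) : smooth (fun _ : E => c).
Proof. exact/smooth_genP/gen_cst. Qed.

Lemma smoothD f g : smooth f -> smooth g -> smooth (fun x => f x + g x).
Proof. by move=> *; apply/smooth_genP/gen_add; exact: gen_base. Qed.

Lemma smoothM f g : smooth f -> smooth g -> smooth (fun x => f x * g x).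
Proof. by move=> *; apply/smooth_genP/gen_mul; exact: gen_base. Qed.

Lemma smooth_exp f : smooth f -> smooth (fun x => expR (f x)).
Proof. by move=> *; apply/smooth_genP/gen_exp; exact: gen_base. Qed.

Lemma smoothV f : (forall x, f x != 0) -> smooth f ->
  smooth (fun x => (f x)^-1).
Proof. by move=> *; apply/smooth_genP/gen_inv => //; exact: gen_base. Qed.

Lemma smoothN f : smooth f -> smooth (fun x => - f x).
Proof.
move=> sf; rewrite (_ : (fun x => _) = fun x => -1 * f x).
  by apply: smoothM => //; exact: smoothC.
by apply/funext => x; rewrite mulN1r.
Qed.

Lemma smoothX f n : smooth f -> smooth (fun x => f x ^+ n).
Proof.
move=> sf; elim: n => [|n IHn].
  by rewrite (_ : (fun x => _) = fun=> 1)//; exact: smoothC.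
rewrite (_ : (fun x => _) = fun x => f x * f x ^+ n); first exact: smoothM.
by apply/funext => x; rewrite exprS.
Qed.

Lemma smooth_sum (I : Type) (r : seq I) (F : I -> E -> R) :
  (forall i, smooth (F i)) -> smooth (fun x => \sum_(i <- r) F i x).
Proof.
move=> sF; elim: r => [|i r IHr].
  rewrite (_ : (fun x => _) = fun=> 0); first exact: smoothC.
  by apply/funext => x; rewrite big_nil.
rewrite (_ : (fun x => _) = fun x => F i x + \sum_(i <- r) F i x).
  exact: smoothD.
by apply/funext => x; rewrite big_cons.
Qed.

Lemma partialC j (c : R) x : partial j (fun=> c) x = 0.
Proof. by rewrite /partial derive_cst. Qed.

Lemma partialD j f g x : smooth f -> smooth g ->
  partial j (fun y => f y + g y) x = partial j f x + partial j g x.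
Proof. by move=> sf sg; rewrite [LHS]deriveD//; exact: smooth_derivable. Qed.

Lemma partialN j f x : smooth f -> partial j (fun y => - f y) x = - partial j f x.
Proof. by move=> sf; rewrite [LHS]deriveN//; exact: smooth_derivable. Qed.

Lemma partialM j f g x : smooth f -> smooth g ->
  partial j (fun y => f y * g y) x = partial j f x * g x + f x * partial j g x.
Proof.
move=> sf sg; have [] := is_derive_mul (smooth_is_derive j x sf)
  (smooth_is_derive j x sg).
by [].
Qed.

Lemma partial_exp j f x : smooth f ->
  partial j (fun y => expR (f y)) x = expR (f x) * partial j f x.
Proof. by move=> sf; have [] := is_derive_exp (smooth_is_derive j x sf). Qed.

Lemma partialV j f x : f x != 0 -> smooth f ->
  partial j (fun y => (f y)^-1) x = - partial j f x * ((f x)^-1 * (f x)^-1).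
Proof. by move=> f0 sf; have [] := is_derive_inv f0 (smooth_is_derive j x sf). Qed.

Lemma partial_sum j (I : Type) (r : seq I) (F : I -> E -> R) x :
  (forall i, smooth (F i)) ->
  partial j (fun y => \sum_(i <- r) F i y) x = \sum_(i <- r) partial j (F i) x.
Proof.
move=> sF; elim: r => [|i r IHr].
  rewrite big_nil (_ : (fun x => _) = fun=> 0) ?partialC//.
  by apply/funext => y; rewrite big_nil.
rewrite big_cons -IHr -partialD//; last exact: smooth_sum.
by congr partial; apply/funext => y; rewrite big_cons.
Qed.

End smooth_closure.

Lemma continuous_dist (R : realFieldType) (U : normedModType R) (f : U -> R)
  (x : U) (e : R) : continuous f -> 0 < e ->
  exists2 r : R, 0 < r & forall y, `|y - x| < r -> `|f x - f y| < e.
Proof.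
move=> cf e0; have /cvgrPdist_lt/(_ _ e0)/nbhs_ballP[r /= r0 H] := cf x.
exists r => // y yx; apply: H; by rewrite -ball_normE /= distrC.
Qed.

Lemma dist_half2 (R : realFieldType) (a a' b b' e : R) :
  `|a - a'| < e / 2 -> `|b - b'| < e / 2 -> a' = b' -> `|a - b| <= e.
Proof.
move=> D1 D2 ab; rewrite (_ : a - b = (a - a') - (b - b')); last by rewrite ab; ring.
by rewrite (le_trans (ler_normB _ _))// (splitr e) lerD// ltW.
Qed.

(** Two mean value theorems replace Taylor's formula, hence M t^2 and not M t^2 / 2: [ps] is the
    slope at the intermediate point [s], and [q] the second derivative at a point between 0 and
    [s]. *)
Lemma taylor_fwd (R : realFieldType) (f0 ft p0 ps q s t M : R) : s < t -> 0 < s ->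
  ft - f0 = t * ps -> ps - p0 = s * q -> `|q| <= M ->
  ft <= f0 + t * p0 + M * t ^+ 2.
Proof.
move=> st s0 /eqP; rewrite subr_eq => /eqP -> /eqP.
rewrite subr_eq => /eqP -> /ler_normlP[q1 q2].
have : s * q <= M * t by have := ler_norm q; nra.
by rewrite expr2; nra.
Qed.

(** Expansion at the far endpoint, [pt] being the slope there. *)
Lemma taylor_bwd (R : realFieldType) (f0 ft pt ps q s t M : R) : s < t -> 0 < s ->
  ft - f0 = t * ps -> pt - ps = (t - s) * q -> `|q| <= M ->
  f0 <= ft - t * pt + M * t ^+ 2.
Proof.
move=> st s0 /eqP; rewrite subr_eq => /eqP -> /eqP.
rewrite subr_eq => /eqP -> /ler_normlP[q1 q2].
have : (t - s) * q <= M * t by nra.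
by rewrite expr2; nra.
Qed.

(** * Mean value theorem along the coordinate axes, symmetry of second derivatives, |grad a|^2 <= C
    a *)

Section lines.
Context (R : realType) (d : nat).
Local Notation E := 'rV[R]_d.
Local Notation e_ j := (delta_mx 0 j : E).
Implicit Types (f g : E -> R) (x v : E) (j k : 'I_d).

Lemma is_derive_line f j x (t : R) : smooth f ->
  is_derive t 1 (fun s : R => f (x + s *: e_ j)) (partial j f (x + t *: e_ j)).
Proof.
move=> sf; have [df dE] := smooth_is_derive j (x + t *: e_ j) sf.
have E0 : (fun h => h^-1 *: (((fun s : R => f (x + s *: e_ j)) \o shift t) (h *: 1)
     - f (x + t *: e_ j))) =
   (fun h => h^-1 *: ((f \o shift (x + t *: e_ j)) (h *: e_ j) - f (x + t *: e_ j))).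
  apply/funext => h /=; congr (_ *: (f _ - _)).
  by rewrite [_%:A]mulr1 scalerDl addrCA.
by apply: DeriveDef; rewrite /derivable /derive E0.
Qed.

Lemma mvt_line f j x (h : R) : smooth f -> 0 < h ->
  exists2 s : R, 0 < s < h &
    f (x + h *: e_ j) - f x = h * partial j f (x + s *: e_ j).
Proof.
move=> sf h0.
have D t := is_derive_line j x t sf.
have cF : {within `[0, h], continuous (fun s : R => f (x + s *: e_ j))}.
  apply: continuous_subspaceT => t.
  by apply/differentiable_continuous/derivable1_diffP; case: (D t).
have [s s0h sE] := MVT h0 (fun t _ => D t) cF.
exists s; first by move: s0h; rewrite in_itv.
by move: sE; rewrite scale0r addr0 subr0 mulrC.
Qed.

Lemma norm_delta_le j (s : R) : `|s *: e_ j| <= `|s|.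
Proof.
rewrite normrZ ler_piMr// /Num.norm /= mx_normrE.
by apply: bigmax_le => // i _; rewrite mxE; case: (_ && _); rewrite ?normr1 ?normr0.
Qed.

Lemma partial_translate f j v :
  partial j (fun y => f (y + v)) = fun y => partial j f (y + v).
Proof.
apply/funext => y; rewrite /partial /derive.
by apply: (congr1 (fun F => lim (F @ 0^'))); apply/funext => t /=; rewrite addrA.
Qed.

Lemma smooth_translate f v : smooth f -> smooth (fun y => f (y + v)).
Proof.
move=> sf s; have -> : foldr (@partial R d) (fun y => f (y + v)) s
    = (fun y => foldr (@partial R d) f s (y + v)).
  by elim: s => //= i s ->; rewrite partial_translate.
have [cf df] := sf s; split=> [y|i y].
  have c : (fun z => z + v) @ y --> y + v.
    by have := @cvgD _ _ _ (nbhs y) _ id (cst v) y v cvg_id (cvg_cst v); apply.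
  exact: (cvg_comp _ _ c (cf (y + v))).
rewrite (_ : derivable _ _ _ = derivable (foldr (@partial R d) f s) (y + v) (e_ i)).
  exact: df.
apply: (congr1 (fun F => cvg (F @ 0^'))); apply/funext => t /=.
by rewrite addrA.
Qed.

(** The mean value theorem is applied to the increment of f in direction k, as a function along j,
    and then to [partial j f] along k. *)
Lemma mvt_mixed f j k x (h : R) : smooth f -> 0 < h ->
  exists2 y : E, `|y - x| <= 2 * h &
    f (x + h *: e_ j + h *: e_ k) - f (x + h *: e_ j) - f (x + h *: e_ k) + f x
    = h ^+ 2 * partial k (partial j f) y.
Proof.
move=> sf h0.
pose u (y : E) : R := f (y + h *: e_ k) + - f y.
have sfk := smooth_translate (h *: e_ k) sf.
have su : smooth u := smoothD sfk (smoothN sf).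
have [s /andP[s0 sh] sE] := mvt_line j x su h0.
have [t /andP[t0 th] tE] := mvt_line k (x + s *: e_ j) (smooth_partial j sf) h0.
exists (x + s *: e_ j + t *: e_ k).
  rewrite addrAC (addrC x) addrK.
  rewrite (le_trans (ler_normD _ _))// (le_trans (lerD (norm_delta_le _ _) (norm_delta_le _ _)))//.
  by rewrite !gtr0_norm// mulr_natl mulr2n lerD// ltW.
have uE y : partial j u y = partial j f (y + h *: e_ k) - partial j f y.
  rewrite /u (partialD _ _ sfk (smoothN sf)) (partialN _ _ sf).
  by rewrite partial_translate.
by rewrite expr2 -mulrA -tE -uE -sE /u opprD opprK !addrA.
Qed.

(** The second difference of f over a small square does not depend on the order of j and k, and by
    [mvt_mixed] it is h^2 times either mixed derivative at a point within 2 h of x. Both derivatives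
    are continuous. *)
Lemma partial_comm f j k x : smooth f ->
  partial j (partial k f) x = partial k (partial j f) x.
Proof.
move=> sf; suff key (e : R) : 0 < e ->
    `|partial j (partial k f) x - partial k (partial j f) x| <= e.
  apply/eqP; rewrite -subr_eq0 -normr_le0; apply/ler_addgt0Pl => e e0.
  by rewrite addr0; exact: key.
move=> e0.
have c1 := smooth_continuous (smooth_partial j (smooth_partial k sf)).
have c2 := smooth_continuous (smooth_partial k (smooth_partial j sf)).
have e20 : 0 < e / 2 by rewrite divr_gt0.
have [r1 r10 H1] := continuous_dist x c1 e20.
have [r2 r20 H2] := continuous_dist x c2 e20.
pose h : R := Num.min r1 r2 / 4.
have h0 : 0 < h by rewrite divr_gt0// lt_min r10 r20.
have [y1 y1x y1E] := mvt_mixed k j x sf h0.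
have [y2 y2x y2E] := mvt_mixed j k x sf h0.
have hr : 2 * h < Num.min r1 r2.
  have m0 : 0 < Num.min r1 r2 by rewrite lt_min r10 r20.
  by rewrite /h mulrCA gtr_pMr// ltr_pdivrMr// mul1r ltr_nat.
have yE : partial j (partial k f) y1 = partial k (partial j f) y2.
  apply: (@mulfI _ (h ^+ 2)); first by rewrite expf_neq0// gt_eqF.
  have E0 : x + h *: e_ k + h *: e_ j = x + h *: e_ j + h *: e_ k by exact: addrAC.
  apply: etrans (esym y1E) _; apply: etrans y2E; rewrite E0.
  by congr (_ + _); exact: addrAC.
have D1 : `|partial j (partial k f) x - partial j (partial k f) y1| < e / 2.
  have hr1 : 2 * h < r1 by apply: (lt_le_trans hr); rewrite ge_min lexx.
  exact/H1/(le_lt_trans y1x hr1).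
have D2 : `|partial k (partial j f) x - partial k (partial j f) y2| < e / 2.
  have hr2 : 2 * h < r2 by apply: (lt_le_trans hr); rewrite ge_min lexx orbT.
  exact/H2/(le_lt_trans y2x hr2).
exact: dist_half2 D1 D2 yE.
Qed.

(* Nonnegativity of f at the point minimizing its second-order Taylor bound,
   at distance |d_j f| / (2 M) along the j-th axis. *)
Lemma sqr_partial_le f j (M : R) x : smooth f -> (forall y, 0 <= f y) ->
  0 < M -> (forall y, `|partial j (partial j f) y| <= M) ->
  partial j f x ^+ 2 <= 4 * M * f x.
Proof.
move=> sf f0 M0 bM.
pose p := partial j f x.
have key (y : E) (t : R) : 0 < t -> f (y + t *: e_ j) <= f y + t * partial j f y + M * t ^+ 2
   /\ f y <= f (y + t *: e_ j) - t * partial j f (y + t *: e_ j) + M * t ^+ 2.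
  move=> t0; have [s /andP[s0 st] sE] := mvt_line j y sf t0.
  have [r _ rE] := mvt_line j y (smooth_partial j sf) s0.
  have ts0 : 0 < t - s by rewrite subr_gt0.
  have [q _] := mvt_line j (y + s *: e_ j) (smooth_partial j sf) ts0.
  have -> : y + s *: e_ j + (t - s) *: e_ j = y + t *: e_ j.
    by rewrite -addrA -scalerDl subrKC.
  by move=> qE; split; [exact: taylor_fwd st s0 sE rE (bM _)|
    exact: taylor_bwd st s0 sE qE (bM _)].
have [p0|p0|p0] := ltgtP p 0; last 1 first.
- by rewrite -/p p0 expr0n /= mulr_ge0// mulr_ge0// ltW.
- have t0 : 0 < - p / (2 * M) by rewrite divr_gt0 ?oppr_gt0// mulr_gt0.
  have [H _] := key x _ t0.
  have := le_trans (f0 _) H; rewrite -/p.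
  rewrite (_ : f x + _ + _ = f x - p ^+ 2 / (4 * M)); last by field; rewrite gt_eqF.
  by rewrite subr_ge0 ler_pdivrMr ?mulr_gt0// mulrC.
- have t0 : 0 < p / (2 * M) by rewrite divr_gt0 ?oppr_gt0// mulr_gt0.
  (* The minimizing point lies behind x, whereas [mvt_line] only steps forward: x is taken as the
     endpoint of the step, with the backward expansion. *)
  have [_] := key (x - (p / (2 * M)) *: e_ j) _ t0.
  rewrite subrK => H.
  have := le_trans (f0 _) H; rewrite -/p.
  rewrite (_ : f x - _ + _ = f x - p ^+ 2 / (4 * M)); last by field; rewrite gt_eqF.
  by rewrite subr_ge0 ler_pdivrMr ?mulr_gt0// mulrC.
Qed.

End lines.

(** * Integration by parts *)

Section measurable_continuous.
Context (R : realType) (n : nat).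
Local Notation E := 'rV[R]_n.

Let box (q : 'rV[rat]_n * nat) : set E :=
  [set x | forall i, `|x ord0 i - ratr (q.1 ord0 i)| < q.2.+1%:R^-1].

Let measurable_box q : measurable (box q).
Proof.
pose c i : R := ratr (q.1 ord0 i); pose r : R := q.2.+1%:R^-1.
have -> : box q = \bigcap_(i in [set: 'I_n])
    ((fun x : E => (x ord0 i : measurableTypeR R)) @^-1`
      ([set` `]c i - r, c i + r[] : set R)).
  apply/seteqP; split=> x /= H i.
    by move=> _; rewrite /= in_itv /= -ltr_distlC distrC; exact: H.
  by have := H i Logic.I; rewrite /= in_itv /= -ltr_distlC distrC.
apply: fin_bigcap_measurable; first exact: finite_finset.
move=> i _; rewrite -[X in measurable X]setTI.
by apply: measurable_coord => //; exact: measurable_itv.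
Qed.

(** The sigma-algebra is generated by the coordinates, so an open set is written as the union of the
    countably many rational boxes that it contains. *)
Lemma open_measurable_rV (U : set E) : open U -> measurable U.
Proof.
move=> oU.
pose F q := if `[< box q `<=` U >] then box q else set0.
have -> : U = \bigcup_q F q.
  apply/seteqP; split=> [x Ux|x [q _]]; last first.
    by rewrite /F; case: asboolP => // + xq; exact.
  have /nbhs_ballP[r /= r0 H] : nbhs x U by move: oU; rewrite openE; exact.
  have [k k0] : exists k : nat, k.+1%:R^-1 < r / 2.
    exists (Num.truncn (r / 2)^-1).
    by rewrite invf_plt ?posrE ?divr_gt0// Num.Theory.truncnS_gt.
  have ex i : exists q : rat, `|x ord0 i - ratr q| < k.+1%:R^-1.
    have lt0 : x ord0 i - k.+1%:R^-1 < x ord0 i + k.+1%:R^-1.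
      by rewrite ltrBlDr -addrA ltrDl addr_gt0.
    have [q] := rat_in_itvoo lt0; rewrite in_itv /= => /andP[q1 q2].
    by exists q; rewrite ltr_distlC q1 q2.
  pose q := (\row_i sval (cid (ex i)), k); exists q => //.
  rewrite /F; case: asboolP => [_|[]].
    by move=> i; rewrite /q /= mxE; case: (cid (ex i)).
  move=> y yq; apply: H; split => // i j.
  rewrite (ord1 i) /ball /=.
  have := yq j; have : `|x ord0 j - ratr (q.1 ord0 j)| < k.+1%:R^-1.
    by rewrite /q /= mxE; case: (cid (ex j)).
  set z := ratr _ => xz yz.
  rewrite (le_lt_trans (ler_distD z _ _))// (splitr r) ltrD//.
    exact: lt_trans xz _.
  by rewrite distrC; exact: lt_trans yz _.
apply: countable_bigcupT_measurable => // q.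
by rewrite /F; case: asboolP => // _; exact: measurable0.
Qed.

Lemma continuous_measurable_rV (f : E -> R) : continuous f ->
  measurable_fun [set: E] (f : E -> measurableTypeR R).
Proof.
move=> /continuousP cf.
apply: (measurability _ (measurable_realfun.RGenOpens.measurableE R)) => _ [_ [a [b ->] <-]].
rewrite setTI; apply: open_measurable_rV; apply: cf; exact: interval_open.
Qed.

End measurable_continuous.

Section cube.
Context (R : realType).

Definition cube n (M : R) : set 'rV[R]_n := [set x | forall i, `|x ord0 i| <= M].

Lemma cube_compact n M : compact (@cube n M).
Proof.
have -> : @cube n M = [set v : 'rV[R]_n | forall i, [set` `[- M, M]%R] (v ord0 i)].
  by apply/seteqP; split=> x /= H i; have := H i; rewrite in_itv /= ler_norml.
by apply: (@rV_compact _ _ (fun=> `[- M, M]%classic)) => i; exact: segment_compact.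
Qed.

Lemma measurable_cube n M : measurable (@cube n M).
Proof.
have -> : @cube n M = \bigcap_(i in [set: 'I_n])
    ((fun x : 'rV[R]_n => (x ord0 i : measurableTypeR R)) @^-1` [set` `[- M, M]%R]).
  apply/seteqP; split=> x /= H i; first by move=> _; rewrite /= in_itv /= -ler_norml.
  by have := H i Logic.I; rewrite /= in_itv /= -ler_norml.
apply: fin_bigcap_measurable; first exact: finite_finset.
move=> i _; rewrite -[X in measurable X]setTI.
by apply: measurable_coord => //; exact: measurable_itv.
Qed.

Lemma cube_cons n M x (y : 'rV[R]_n) :
  cube M (rV_cons (x, y)) <-> `|x| <= M /\ cube M y.
Proof.
split=> [H|[H1 H2] i].
  split=> [|i]; first by have := H ord0; rewrite rV_cons0.
  by have := H (lift ord0 i); rewrite rV_consS.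
by case: (unliftP ord0 i) => [j|] ->; rewrite ?rV_consS ?rV_cons0//; exact: H2.
Qed.

Lemma lebesgue_cube_lty n M : (lebesgue_rV n (@cube n M) < +oo)%E.
Proof.
elim: n => [|n IHn].
  by rewrite /= diracE; case: (_ \in _); rewrite ?ltry.
rewrite /= /lebesgue_rV_step /pushforward.
have -> : (@rV_cons R n) @^-1` (cube M) = [set` `[- M, M]%R] `*` cube M.
  apply/seteqP; split=> -[x y] /=.
    by move/cube_cons => [xM yM]; split => //=; rewrite in_itv /= -ler_norml.
  by rewrite in_itv /= -ler_norml => xy; exact/cube_cons.
rewrite product_measure1E; [|exact: measurable_itv|exact: measurable_cube].
apply: lte_mul_pinfty => //.
have -> : forall A, lebesgue_measure_lebesgue_measure__canonical__measure_function_Measure R A = lebesgue_measure A by [].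
by rewrite lebesgue_measure_itv /=; case: ifP.
Qed.

Lemma cube_bounded n M (f : 'rV[R]_n -> R) : continuous f ->
  exists2 B : R, 0 < B & forall x, cube M x -> `|f x| <= B.
Proof.
move=> cf; have /compact_bounded[B [_ HB]] : compact (f @` (@cube n M)).
  apply: continuous_compact; last exact: cube_compact.
  exact: continuous_subspaceT.
exists (`|B| + 1); first by rewrite ltr_wpDl.
move=> x Kx; apply: HB; last by exists x.
by rewrite (le_lt_trans (ler_norm _))// ltrDl.
Qed.

Lemma cube_integrable n M (f : 'rV[R]_n -> R) : continuous f ->
  (forall x, ~ cube M x -> f x = 0) ->
  (lebesgue_rV n).-integrable setT (EFin \o f).
Proof.
move=> cf f0; have [B B0 fB] := cube_bounded M cf.
have mf := continuous_measurable_rV cf.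
have -> : EFin \o f = (EFin \o f) \_ (cube M).
  apply/funext => x; rewrite patchE; case: ifPn => //= /negP.
  by rewrite inE => /f0 ->.
apply/(integrable_mkcond _ (@measurable_cube n M)).
apply: measurable_bounded_integrable; first exact: measurable_cube.
- exact: lebesgue_cube_lty.
- exact: measurable_funTS.
- exists B; split; first exact: num_real.
  by move=> C BC x Kx /=; exact: le_trans (fB x Kx) (ltW BC).
Qed.

(** Change of variables through [rV_cons], of which the measure is a push-forward. Integrability on
    the product, required by Fubini, is obtained from the change of variables for |f|. *)
Lemma integral_lebesgue_rVS n M (f : 'rV[R]_n.+1 -> R) : continuous f ->
  (forall x, ~ cube M x -> f x = 0) ->
  (@lebesgue_measure R \x lebesgue_rV n)%E.-integrable setT
    (EFin \o (f \o @rV_cons R n)) /\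
  (\int[lebesgue_rV n.+1]_x (f x)%:E =
   \int[@lebesgue_measure R \x lebesgue_rV n]_p (f (rV_cons p))%:E)%E.
Proof.
move=> cf f0.
have fint := cube_integrable cf f0.
have mf := continuous_measurable_rV cf.
have mc := @measurable_rV_cons R n.
have mE := measurable_int _ fint.
have pint : (@lebesgue_measure R \x lebesgue_rV n)%E.-integrable
    setT (EFin \o (f \o @rV_cons R n)).
  apply/integrableP; split.
    exact: (measurableT_comp mE mc).
  move/integrableP : fint => [_]; apply: le_lt_trans.
  have := @ge0_integral_pushforward _ _ _ _ _ _ mc
    (@lebesgue_measure R \x lebesgue_rV n)%E setT (abse \o (EFin \o f)).
  have mA : measurable_fun [set: 'rV[R]_n.+1] (abse \o (EFin \o f)).
    exact: measurableT_comp.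
  move=> /(_ measurableT mA (fun _ _ => abse_ge0 _)).
  rewrite preimage_setT => <-.
  by rewrite le_eqVlt; apply/orP; left; apply/eqP; exact: eq_measure_integral.
split => //.
have := @integral_pushforward _ _ _ _ _ _ mc
  (@lebesgue_measure R \x lebesgue_rV n)%E setT (EFin \o f) mE.
rewrite preimage_setT => /(_ pint measurableT) <-.
exact: eq_measure_integral.
Qed.

End cube.

(** * The integral of a derivative of a compactly supported function is zero *)

Section integral_partial.
Context (R : realType).

Lemma partial_off_closed n (K : set 'rV[R]_n) (f : 'rV[R]_n -> R) j : closed K ->
  (forall x, ~ K x -> f x = 0) -> forall x, ~ K x -> partial j f x = 0.
Proof.
move=> cK f0 x Kx; rewrite /partial (@near_eq_derive _ _ _ f (cst 0)).
  by rewrite derive_cst.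
have oK : open (~` K) by exact: closed_openC.
have : nbhs x (~` K) by exact: open_nbhs_nbhs.
by apply: filterS => y Ky /=; rewrite f0.
Qed.

Lemma closed_cube n M : closed (@cube R n M).
Proof. by apply: compact_closed; [exact: norm_hausdorff|exact: cube_compact]. Qed.

Lemma rV_cons_addr n (x : R) (y : 'rV[R]_n) (t : R) j :
  rV_cons (x, y + t *: delta_mx 0 j) =
  rV_cons (x, y) + t *: delta_mx 0 (lift ord0 j).
Proof.
apply/rowP => i; rewrite [RHS]mxE [X in _ = _ + X]mxE [X in _ = _ + _ * X]mxE.
case: (unliftP ord0 i) => [k|] ->.
  by rewrite !(rV_consS _ k : rV_cons _ 0 _ = _) !mxE (inj_eq lift_inj).
by rewrite !(rV_cons0 _ : rV_cons _ 0 _ = _) mulr0 addr0.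
Qed.

Lemma rV_cons_addl n (x t : R) (y : 'rV[R]_n) :
  rV_cons (x + t, y) = rV_cons (x, y) + t *: delta_mx 0 ord0.
Proof.
apply/rowP => i; rewrite [RHS]mxE [X in _ = _ + X]mxE [X in _ = _ + _ * X]mxE.
case: (unliftP ord0 i) => [k|] ->.
  by rewrite !(rV_consS _ k : rV_cons _ 0 _ = _) mulr0 addr0.
by rewrite !(rV_cons0 _ : rV_cons _ 0 _ = _) mulr1.
Qed.

Lemma rV_cons_continuous n (x : R) :
  continuous (fun y : 'rV[R]_n => rV_cons (x, y)).
Proof.
move=> y A /nbhs_ballP[e /= e0 eA]; apply/nbhs_ballP; exists e => //= z [_ yz].
apply: eA; split => // i j; rewrite (ord1 i).
case: (unliftP ord0 j) => [k|] ->.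
  by rewrite !(rV_consS _ k : rV_cons _ 0 _ = _); exact: yz.
by rewrite !(rV_cons0 _ : rV_cons _ 0 _ = _); exact: ballxx.
Qed.

Lemma smooth_rV_cons n (f : 'rV[R]_n.+1 -> R) (x : R) : smooth f ->
  smooth (fun y => f (rV_cons (x, y))) /\
  forall j y, partial j (fun y => f (rV_cons (x, y))) y
    = partial (lift ord0 j) f (rV_cons (x, y)).
Proof.
have pE (g : 'rV[R]_n.+1 -> R) (j : 'I_n) (y : 'rV[R]_n) : (fun h : R => h^-1 *:
     (((fun y => g (rV_cons (x, y))) \o shift y) (h *: delta_mx 0 j) - g (rV_cons (x, y)))) =
   (fun h => h^-1 *: ((g \o shift (rV_cons (x, y))) (h *: delta_mx 0 (lift ord0 j))
     - g (rV_cons (x, y)))).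
  apply/funext => h /=; congr (_ *: (g _ - _)).
  rewrite (_ : h *: delta_mx 0 j + y = y + h *: delta_mx 0 j); last exact: addrC.
  exact: etrans (rV_cons_addr x y h j) (addrC _ _).
have dE (g : 'rV[R]_n.+1 -> R) (j : 'I_n) (y : 'rV[R]_n) :
    partial j (fun y => g (rV_cons (x, y))) y
    = partial (lift ord0 j) g (rV_cons (x, y)).
  exact: (congr1 (fun F => lim (F @ 0^')) (pE g j y)).
move=> sf; split=> // s.
have -> : foldr (@partial R n) (fun y => f (rV_cons (x, y))) s =
    fun y => foldr (@partial R n.+1) f (map (lift ord0) s) (rV_cons (x, y)).
  by elim: s => //= j s ->; apply/funext => y; rewrite dE.
have [cf df] := sf (map (lift ord0) s); split=> [y|j y].
  exact: (cvg_comp _ _ (@rV_cons_continuous n x y) (cf (rV_cons (x, y)))).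
rewrite /derivable pE; exact: df.
Qed.

Lemma integral_derive_eq0 (g dg : R -> R) (M : R) :
  (forall t : R, is_derive t 1 g (dg t)) -> continuous dg ->
  (forall t, M < `|t| -> g t = 0) ->
  (\int[@lebesgue_measure R]_t (dg t)%:E = 0)%E.
Proof.
(* [N] exceeds [M], so that g vanishes at both endpoints, and it is positive even if [M] is not, so
   that the interval is not degenerate. *)
move=> Dg cdg g0; pose N : R := `|M| + 1.
have N0 : 0 < N by rewrite ltr_wpDl.
have MN : M < N by rewrite (le_lt_trans (ler_norm _))// ltrDl.
have NN : - N < N by rewrite gtrN.
have cg : continuous g.
  by move=> t; apply/differentiable_continuous/derivable1_diffP; case: (Dg t).
have dg0 t : N < `|t| -> dg t = 0.
  move=> Nt; have [_ <-] := Dg t.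
  rewrite (@near_eq_derive _ _ _ g (cst 0)); first by rewrite derive_cst.
  have : \forall y \near t, N < `|y| .
    exact: (cvgr_gt _ (@norm_continuous _ R^o t)).
  by apply: filterS => y Ny /=; rewrite g0//; exact: lt_trans MN Ny.
transitivity (\int[lebesgue_measure]_(t in `[(- N)%R, N]) (dg t)%:E)%E.
  rewrite [RHS]integral_mkcond; apply: eq_integral => t _.
  rewrite patchE; case: ifPn => //; rewrite notin_setE /= in_itv /= -ler_norml.
  by move=> /negP; rewrite -ltNge => /dg0 ->.
rewrite (continuous_FTC2 NN (F := g)).
- by rewrite !g0 ?subee// ?normrN gtr0_norm.
- exact: continuous_subspaceT.
- split; first by move=> t _; case: (Dg t).
  + exact/cvg_at_right_filter/cg.
  + exact/cvg_at_left_filter/cg.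
- by move=> t _; rewrite derive1E; case: (Dg t).
Qed.

(** Induction on the dimension, with the order of integration in Fubini chosen so that the inner
    integral contains the variable j: the fundamental theorem of calculus for the first coordinate,
    the induction hypothesis on slices for the others. *)
Lemma integral_partial_eq0 n (f : 'rV[R]_n -> R) (M : R) j : smooth f ->
  (forall x, ~ cube M x -> f x = 0) ->
  (\int[lebesgue_rV n]_x (partial j f x)%:E = 0)%E.
Proof.
elim: n => [|n IHn] in f j *; first by case: j.
move=> sf f0; have sjf := smooth_partial j sf.
have p0 := partial_off_closed j (@closed_cube n.+1 M) f0.
have [pint ->] := integral_lebesgue_rVS (smooth_continuous sjf) p0.
case: (unliftP ord0 j) => [k|] jE.
  rewrite -integral12_prod_meas1//= /fubini_F.
  rewrite (eq_integral (cst 0%E)) ?integral0// => x _ /=.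
  have [sfx pfx] := smooth_rV_cons x sf.
  have -> : (fun y => (partial j f (rV_cons (x, y)))%:E) =
      fun y => (partial k (fun y => f (rV_cons (x, y))) y)%:E.
    by apply/funext => y; rewrite jE pfx.
  by apply: IHn => // y My; apply: f0 => /cube_cons[].
rewrite -integral21_prod_meas1//= /fubini_G.
rewrite (eq_integral (cst 0%E)) ?integral0// => y _ /=.
have E0 t : rV_cons (t, y) = rV_cons (0, y) + t *: delta_mx 0 ord0.
  by rewrite -rV_cons_addl add0r.
have fE (g : 'rV[R]_n.+1 -> R) : (fun s : R => g (rV_cons (0, y) + s *: delta_mx 0 ord0))
    = (fun s : R => g (rV_cons (s, y))).
  by apply/funext => s; congr g; exact: esym (E0 s).
apply: (@integral_derive_eq0 (fun t : R => f (rV_cons (t, y))) _ M).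
- move=> t; have := is_derive_line ord0 (rV_cons (0, y)) t sf.
  by rewrite fE -(E0 t) -jE.
- have dl s := is_derive_line ord0 (rV_cons (0, y)) s sjf.
  rewrite fE in dl.
  have cl : continuous (fun s : R => partial j f (rV_cons (s, y))).
    by move=> t; apply/differentiable_continuous/derivable1_diffP; case: (dl t).
  exact: cl.
- move=> t Mt; apply: f0 => /cube_cons[tM _].
  by move: Mt; rewrite ltNge tM.
Qed.

End integral_partial.

Local Opaque partial.

(** * Laplacians, products of gradients and Hessians *)

Section calculus_identities.
Context (R : realType) (d : nat).
Local Notation E := 'rV[R]_d.
Implicit Types (f g h u w : E -> R) (x : E) (j k : 'I_d).

Definition lap f x : R := \sum_j partial j (partial j f) x.

Definition gdot f g x : R := \sum_j partial j f x * partial j g x.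

Definition hess f (p q : 'I_d -> R) x : R :=
  \sum_j \sum_k p j * q k * partial j (partial k f) x.

Local Notation "'grad_ f x" := (fun j => partial j f x)
  (at level 10, f at level 8, x at level 8).

Lemma smooth_lap f : smooth f -> smooth (lap f).
Proof.
by move=> sf; apply: smooth_sum => j; exact/smooth_partial/smooth_partial.
Qed.

Lemma smooth_gdot f g : smooth f -> smooth g -> smooth (gdot f g).
Proof.
by move=> sf sg; apply: smooth_sum => j; apply: smoothM; exact: smooth_partial.
Qed.

Lemma gdotC f g x : gdot f g x = gdot g f x.
Proof. by apply: eq_bigr => j _; rewrite mulrC. Qed.

Lemma gdot_ge0 f x : 0 <= gdot f f x.
Proof. by apply: sumr_ge0 => j _; rewrite -expr2 sqr_ge0. Qed.

Lemma hessC f p q x : smooth f -> hess f p q x = hess f q p x.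
Proof.
move=> sf; rewrite /hess exchange_big; apply: eq_bigr => j _.
by apply: eq_bigr => k _; rewrite partial_comm// [p _ * _]mulrC.
Qed.

Lemma gdotDl f g h x : smooth f -> smooth g ->
  gdot (fun y => f y + g y) h x = gdot f h x + gdot g h x.
Proof.
by move=> sf sg; rewrite -big_split; apply: eq_bigr => j _; rewrite partialD// mulrDl.
Qed.

Lemma gdotMl f g h x : smooth f -> smooth g ->
  gdot (fun y => f y * g y) h x = f x * gdot g h x + g x * gdot f h x.
Proof.
move=> sf sg; rewrite !mulr_sumr -big_split; apply: eq_bigr => j _.
by rewrite partialM// mulrDl addrC mulrA (mulrC (partial j f x)) mulrA.
Qed.

Lemma gdotZl (c : R) f h x : smooth f ->
  gdot (fun y => c * f y) h x = c * gdot f h x.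
Proof.
move=> sf; have sc := smoothC (d := d) c; rewrite gdotMl//.
rewrite [X in _ + _ * X](_ : _ = 0) ?mulr0 ?addr0//.
by apply: big1 => j _; rewrite partialC mul0r.
Qed.

Lemma gdotDr f g h x : smooth f -> smooth g ->
  gdot h (fun y => f y + g y) x = gdot h f x + gdot h g x.
Proof. by move=> sf sg; rewrite gdotC gdotDl// !(gdotC h). Qed.

Lemma gdotMr f g h x : smooth f -> smooth g ->
  gdot h (fun y => f y * g y) x = f x * gdot h g x + g x * gdot h f x.
Proof. by move=> sf sg; rewrite gdotC gdotMl// !(gdotC h). Qed.

Lemma gdotZr (c : R) f h x : smooth f ->
  gdot h (fun y => c * f y) x = c * gdot h f x.
Proof. by move=> sf; rewrite gdotC gdotZl// (gdotC h). Qed.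

Lemma gdotVl f h x : (forall y, f y != 0) -> smooth f ->
  gdot (fun y => (f y)^-1) h x = - ((f x)^-1 * (f x)^-1) * gdot f h x.
Proof.
move=> f0 sf; rewrite /gdot mulr_sumr; apply: eq_bigr => j _.
rewrite partialV//; move: (partial j f x) (partial j h x) (f x)^-1 => a b c; ring.
Qed.

Lemma gdot_expl f h x : smooth f ->
  gdot (fun y => expR (f y)) h x = expR (f x) * gdot f h x.
Proof.
move=> sf; rewrite /gdot mulr_sumr; apply: eq_bigr => j _.
by rewrite partial_exp// mulrA.
Qed.

Lemma lapD f g x : smooth f -> smooth g ->
  lap (fun y => f y + g y) x = lap f x + lap g x.
Proof.
move=> sf sg; rewrite -big_split; apply: eq_bigr => j _ /=.
have -> : partial j (fun y => f y + g y) = fun y => partial j f y + partial j g y.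
  by apply/funext => y; rewrite partialD.
have [sjf sjg] := (smooth_partial j sf, smooth_partial j sg).
by rewrite partialD.
Qed.

Lemma lapM f g x : smooth f -> smooth g ->
  lap (fun y => f y * g y) x = f x * lap g x + 2 * gdot f g x + g x * lap f x.
Proof.
move=> sf sg; rewrite !mulr_sumr -!big_split; apply: eq_bigr => j _ /=.
have [sjf sjg] := (smooth_partial j sf, smooth_partial j sg).
have -> : partial j (fun y => f y * g y) =
    fun y => partial j f y * g y + f y * partial j g y.
  by apply/funext => y; rewrite partialM.
rewrite partialD; [|exact: smoothM|exact: smoothM].
rewrite !partialM//.
move: (partial j (partial j f) x) (partial j (partial j g) x) (partial j f x).
by move: (partial j g x) (f x) (g x) => *; ring.
Qed.

Lemma lapZ (c : R) f x : smooth f -> lap (fun y => c * f y) x = c * lap f x.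
Proof.
move=> sf; have sc := smoothC (d := d) c; rewrite lapM//.
have -> : lap (fun=> c) x = 0.
  apply: big1 => j _; have -> : partial j (fun _ : E => c) = fun=> 0.
    by apply/funext => y; rewrite partialC.
  by rewrite partialC.
have -> : gdot (fun=> c) f x = 0 by apply: big1 => j _; rewrite partialC mul0r.
by rewrite !mulr0 !addr0.
Qed.

Lemma lap_exp f x : smooth f ->
  lap (fun y => expR (f y)) x = expR (f x) * (lap f x + gdot f f x).
Proof.
move=> sf; rewrite -big_split mulr_sumr; apply: eq_bigr => j _ /=.
have -> : partial j (fun y => expR (f y)) = fun y => expR (f y) * partial j f y.
  by apply/funext => y; rewrite partial_exp.
rewrite partialM; [|exact: smooth_exp|exact: smooth_partial].
by rewrite partial_exp// mulrDr addrC mulrA.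
Qed.

(** This is how Hessians enter: by differentiating grad phi . grad w, |grad w|^2 and |grad
    phi|^2. *)
Lemma gdot_gdotl f g h x : smooth f -> smooth g ->
  gdot (gdot f g) h x = hess f ('grad_ h x) ('grad_ g x) x
    + hess g ('grad_ h x) ('grad_ f x) x.
Proof.
move=> sf sg; rewrite -big_split; apply: eq_bigr => j _ /=.
rewrite partial_sum; last by move=> k; apply: smoothM; exact: smooth_partial.
rewrite mulr_suml -big_split; apply: eq_bigr => k _ /=.
have [skf skg] := (smooth_partial k sf, smooth_partial k sg).
rewrite partialM//; move: (partial j (partial k f) x) (partial j (partial k g) x).
by move: (partial k f x) (partial k g x) (partial j h x) => *; ring.
Qed.

Lemma divergence_scaled_grad u f x : smooth u -> smooth f ->
  \sum_j partial j (fun y => u y * partial j f y) x = u x * lap f x + gdot u f x.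
Proof.
move=> su sf; rewrite mulr_sumr -big_split; apply: eq_bigr => j _.
have sjf := smooth_partial j sf.
by rewrite partialM// addrC.
Qed.

End calculus_identities.

Section cauchy_schwarz.
Context (R : realFieldType) (I : finType).

(** Lagrange's identity: the double sum of (u_i v_j - u_j v_i)^2 is twice the difference of the two
    sides. *)
Lemma sqr_sum_mul_le (u v : I -> R) :
  (\sum_i u i * v i) ^+ 2 <= (\sum_i u i ^+ 2) * (\sum_i v i ^+ 2).
Proof.
have key : 0 <= \sum_i \sum_j (u i * v j - u j * v i) ^+ 2.
  by apply: sumr_ge0 => i _; apply: sumr_ge0 => j _; rewrite sqr_ge0.
have E : \sum_i \sum_j (u i * v j - u j * v i) ^+ 2 =
    2 * ((\sum_i u i ^+ 2) * (\sum_i v i ^+ 2)) - 2 * (\sum_i u i * v i) ^+ 2.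
  have E1 : (\sum_i u i ^+ 2) * (\sum_i v i ^+ 2) = \sum_i \sum_j u i ^+ 2 * v j ^+ 2.
    by rewrite mulr_suml; apply: eq_bigr => i _; rewrite mulr_sumr.
  have E2 : (\sum_i u i * v i) ^+ 2 = \sum_i \sum_j (u i * v i) * (u j * v j).
    by rewrite expr2 mulr_suml; apply: eq_bigr => i _; rewrite mulr_sumr.
  have E3 : (\sum_i u i ^+ 2) * (\sum_i v i ^+ 2) = \sum_i \sum_j u j ^+ 2 * v i ^+ 2.
    by rewrite E1 exchange_big.
  rewrite mulr_natl mulr2n {1}E1 E3 E2 mulr_sumr -sumrN -!big_split.
  apply: eq_bigr => i _ /=; rewrite mulr_sumr -sumrN -!big_split.
  by apply: eq_bigr => j _ /=; ring.
by move: key; rewrite E subr_ge0 ler_pM2l.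
Qed.

End cauchy_schwarz.

Section hessian_bounds.
Context (R : realType) (d : nat).
Local Notation E := 'rV[R]_d.
Implicit Types (f g : E -> R) (x : E).

Lemma gdot_sqr_le f g x : gdot f g x ^+ 2 <= gdot f f x * gdot g g x.
Proof.
by rewrite (le_trans (sqr_sum_mul_le _ _)).
Qed.

(** The squared Hilbert-Schmidt norm: it dominates the operator norm and is visibly smooth, hence
    bounded on compact sets. *)
Definition hess_norm2 f x : R :=
  \sum_j \sum_k partial j (partial k f) x * partial j (partial k f) x.

Lemma hess_sqr_le f p q x : hess f p q x ^+ 2 <=
  hess_norm2 f x * ((\sum_j p j ^+ 2) * (\sum_j q j ^+ 2)).
Proof.
have -> : hess f p q x = \sum_j p j * (\sum_k q k * partial j (partial k f) x).
  apply: eq_bigr => j _; rewrite mulr_sumr; apply: eq_bigr => k _.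
  by rewrite mulrA.
rewrite (le_trans (sqr_sum_mul_le _ _))// mulrCA ler_wpM2l//.
  by apply: sumr_ge0 => j _; rewrite sqr_ge0.
rewrite /hess_norm2 mulr_suml; apply: ler_sum => j _.
rewrite (le_trans (sqr_sum_mul_le _ _))// mulrC.
by under eq_bigr do rewrite expr2.
Qed.

Lemma hessDl f p p' q x : hess f (fun j => p j + p' j) q x = hess f p q x + hess f p' q x.
Proof.
rewrite -big_split; apply: eq_bigr => j _; rewrite -big_split.
by apply: eq_bigr => k _ /=; rewrite !mulrDl.
Qed.

Lemma hessDr f p q q' x : hess f p (fun j => q j + q' j) x = hess f p q x + hess f p q' x.
Proof.
rewrite -big_split; apply: eq_bigr => j _; rewrite -big_split.
by apply: eq_bigr => k _ /=; rewrite mulrDr mulrDl.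
Qed.

Lemma hessZl f (c : R) p q x : hess f (fun j => c * p j) q x = c * hess f p q x.
Proof.
rewrite mulr_sumr; apply: eq_bigr => j _; rewrite mulr_sumr.
by apply: eq_bigr => k _ /=; rewrite -!mulrA.
Qed.

Lemma hessZr f (c : R) p q x : hess f p (fun j => c * q j) x = c * hess f p q x.
Proof.
rewrite mulr_sumr; apply: eq_bigr => j _; rewrite mulr_sumr.
by apply: eq_bigr => k _ /=; rewrite mulrCA -!mulrA mulrCA.
Qed.

End hessian_bounds.

(** * Pointwise algebra of the estimate *)

Section quadratic_form_algebra.
Context (R : realFieldType).

Local Ltac nneg := solve [repeat first
  [ assumption | by [] | exact: sqr_ge0 | by apply: ltW | apply: mulr_ge0
  | apply: addr_ge0 | rewrite invr_ge0 | apply: exprn_ge0 ]].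

(* With eta the component of xi orthogonal to e and xi = eta + th e, the values
   Hn, h1, he stand for H(eta,eta), H(eta,e) + H(e,eta), H(e,e), and N, y for
   the squared lengths of eta and e. *)
Lemma quadratic_form_lower_bound (B Y c k0 eps y N th t Hn h1 he rho M : R) :
  0 < c -> 0 < k0 -> k0 <= y -> y <= Y -> 1 <= Y -> 1 <= B -> 0 <= N ->
  `|he| <= B * Y -> h1 ^+ 2 <= 4 * B ^+ 2 * (N * y) ->
  (c - 4 * he) * N <= 4 * Hn * y ->
  0 < eps -> rho * (y + eps) = c / 2 - 4 * he ->
  (c / 2 + 4 * (B * Y)) * eps <= c / 4 * k0 ->
  8 * (B * Y) + c + 128 * B ^+ 2 * Y ^+ 2 / c <= M * k0 ^+ 2 ->
  c / (8 * Y) * ((N + th ^+ 2 * y) + t ^+ 2) <=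
    4 * (Hn + th * h1 + th ^+ 2 * he) + 4 * t ^+ 2 * he + M * (th * y) ^+ 2
    - rho * ((N + th ^+ 2 * y) - t ^+ 2 * y).
Proof.
move=> c0 k00 ky yY Y1 B1 N0 heB h1B Hnb eps0 rhoE epsb Mb.
have y0 : 0 < y by exact: lt_le_trans ky.
have Y0 : 0 < Y by exact: lt_le_trans Y1.
have [he1 he2] : - (B * Y) <= he /\ he <= B * Y.
  by apply/andP; rewrite -ler_norml.
have BY0 : 0 < B * Y by rewrite mulr_gt0// (lt_le_trans _ B1).
pose m : R := c / 2 + 4 * (B * Y).
have rm : `|rho| * k0 <= m.
  have ye : 0 < y + eps by rewrite addr_gt0.
  have : `|rho| * (y + eps) <= m.
    rewrite -(gtr0_norm ye) -normrM rhoE /m ler_norml; apply/andP; split; lra.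
  apply: le_trans; rewrite ler_wpM2l//; lra.
have re : `|rho * eps| <= c / 4.
  rewrite normrM (gtr0_norm eps0) -(ler_pM2r k00) mulrAC.
  apply: le_trans (ler_wpM2r (ltW eps0) rm) _; exact: epsb.
have [re1 re2] : - (c / 4) <= rho * eps /\ rho * eps <= c / 4.
  by apply/andP; rewrite -ler_norml.
(* The choice of [rho]: the coefficient of t^2 becomes about c / 2, and what remains of c for N is
   about c / 2 as well. The regularization [eps] takes at most c / 4 from either. *)
have hr : 4 * he + rho * y = c / 2 - rho * eps by lra.
have a1 : c / 4 * N <= y * (4 * Hn - rho * N).
  have : (c - (4 * he + rho * y)) * N <= y * (4 * Hn - rho * N) by lra.
  apply: le_trans; rewrite ler_wpM2r//; lra.
have a2 : c / (4 * Y) * N <= 4 * Hn - rho * N.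
  have q0 : 0 <= 4 * Hn - rho * N.
    by rewrite -(pmulr_rge0 _ y0) (le_trans _ a1)// mulr_ge0// divr_ge0// ltW.
  rewrite (_ : c / (4 * Y) * N = (c / 4 * N) / Y); last by field; rewrite gt_eqF.
  rewrite ler_pdivrMr// (le_trans a1)// mulrC ler_wpM2l//.
pose al : R := c / (8 * Y).
have al0 : 0 < al by rewrite divr_gt0// mulr_gt0.
(* Half of the gain c / (4 Y) N absorbs the cross term by Young's inequality; the square of [th]
   produced in this way is left to [M]. *)
have a3 : - (al * N + 128 * B ^+ 2 * Y ^+ 2 / c * th ^+ 2) <= 4 * (th * h1).
  have sq : (4 * (th * h1)) ^+ 2 <= (2 * (al * N)) * (2 * (128 * B ^+ 2 * Y ^+ 2 / c * th ^+ 2)).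
    have -> : (2 * (al * N)) * (2 * (128 * B ^+ 2 * Y ^+ 2 / c * th ^+ 2))
       = 64 * (B ^+ 2 * th ^+ 2 * (N * Y)).
      by rewrite /al; field; rewrite !gt_eqF.
    rewrite (_ : (4 * (th * h1)) ^+ 2 = 16 * th ^+ 2 * h1 ^+ 2); last by ring.
    apply: le_trans (ler_wpM2l _ h1B) _; first by rewrite mulr_ge0// sqr_ge0.
    have := ler_wpM2l N0 yY; rewrite -subr_ge0 => NyY.
    rewrite -subr_ge0 (_ : _ - _ = 64 * (B ^+ 2 * th ^+ 2 * (N * Y - N * y))); last by ring.
    by rewrite mulr_ge0// mulr_ge0// mulr_ge0 ?sqr_ge0.
  set u := al * N in sq *; set w := 128 * B ^+ 2 * Y ^+ 2 / c * th ^+ 2 in sq *.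
  have u0 : 0 <= u by rewrite mulr_ge0// ltW.
  have w0 : 0 <= w by rewrite /w; nneg.
  have : `|4 * (th * h1)| <= u + w.
    rewrite -[leRHS]ger0_norm ?addr_ge0// -ler_sqr ?nnegrE// !real_normK ?num_real//.
    by have := sqr_ge0 (u - w); lra.
  by rewrite ler_norml => /andP[].
(* In the direction of [e] no positivity is available: [M] is large enough to cover [he], [rho] and
   the cross term at once. *)
have a4 : (8 * (B * Y) + c + 128 * B ^+ 2 * Y ^+ 2 / c) * th ^+ 2 <= M * (th * y) ^+ 2.
  rewrite exprMn [leRHS]mulrCA [leLHS]mulrC ler_wpM2l ?sqr_ge0//.
  apply: (le_trans Mb).
  have M0 : 0 <= M.
    have k20 : 0 < k0 ^+ 2 by rewrite exprn_gt0.
    rewrite -(pmulr_lge0 _ k20) (le_trans _ Mb)//; nneg.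
  by rewrite ler_wpM2l// !expr2 ler_pM// ltW.
have a5 : al * (th ^+ 2 * y) <= c / 8 * th ^+ 2.
  rewrite mulrCA mulrC ler_wpM2r ?sqr_ge0// /al.
  rewrite (_ : c / (8 * Y) * y = c / 8 * (y / Y)); last by field; rewrite gt_eqF.
  by rewrite ler_piMr ?divr_ge0 ?(ltW c0)// ler_pdivrMr// mul1r.
have a6 : al * t ^+ 2 <= c / 8 * t ^+ 2.
  rewrite ler_wpM2r ?sqr_ge0// /al ler_pdivrMr ?mulr_gt0//.
  by have := ler_wpM2l (ltW c0) Y1; lra.
have a7 : c / 4 * t ^+ 2 <= (4 * he + rho * y) * t ^+ 2.
  by rewrite ler_wpM2r ?sqr_ge0//; lra.
have a8 : (- (8 * (B * Y)) - 3 / 4 * c) * th ^+ 2 <= (4 * he - rho * y) * th ^+ 2.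
  by rewrite ler_wpM2r ?sqr_ge0//; lra.
have a9 : c / (4 * Y) * N = 2 * (al * N).
  by rewrite /al; field; rewrite gt_eqF.
have t0 := sqr_ge0 t; have th0 := sqr_ge0 th.
rewrite -/al.
have t1 : 0 <= c * t ^+ 2 by rewrite mulr_ge0// ltW.
have th1 : 0 <= c * th ^+ 2 by rewrite mulr_ge0// ltW.
have := mulr_ge0 (ltW al0) N0.
by lra.
Qed.

(** Here P is |grad w|^2 and z the product of grad w with a bounded field. Young's inequality gives
    B (P + tau^2 w^2), one power of tau below the main terms, and 1 <= kappa tau turns this gap into
    the small factor kappa. *)
Lemma cross_term_bound (B kappa tau P w z : R) : 0 < B -> 0 < tau -> 1 <= kappa * tau ->
  0 <= P -> z ^+ 2 <= B ^+ 2 * P ->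
  - (B * kappa * (tau * P + tau ^+ 3 * w ^+ 2)) <= 2 * tau * (w * z).
Proof.
move=> B0 tau0 kt P0 zP.
have : - (B * (P + tau ^+ 2 * w ^+ 2)) <= 2 * tau * (w * z).
  rewrite -(ler_pM2l B0).
  have : 0 <= (z + B * tau * w) ^+ 2 by exact: sqr_ge0.
  lra.
apply: le_trans; rewrite lerN2.
have Q0 : 0 <= B * (P + tau ^+ 2 * w ^+ 2).
  by rewrite mulr_ge0 ?(ltW B0)// addr_ge0// mulr_ge0 ?sqr_ge0.
have := ler_wpM2r Q0 kt; lra.
Qed.

(** Now the field may be of size kappa tau^2, as grad G is; Young's inequality is balanced with the
    weight B kappa tau^3. *)
Lemma lower_order_bound (B kappa tau P w z : R) : 0 < B -> 0 < tau -> 0 < kappa ->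
  z ^+ 2 <= B ^+ 2 * kappa ^+ 2 * tau ^+ 4 * P ->
  2 * (z * w) <= B * kappa * (tau * P + tau ^+ 3 * w ^+ 2).
Proof.
move=> B0 tau0 k0 zP.
have p0 : 0 < B * kappa * tau ^+ 3 by rewrite mulr_gt0 ?exprn_gt0// mulr_gt0.
rewrite -(ler_pM2l p0).
have : 0 <= (z - B * kappa * tau ^+ 3 * w) ^+ 2 by exact: sqr_ge0.
lra.
Qed.

(* One scalar component: Yi is the corresponding component of the first-order
   part, to which the zeroth-order coupling g w' contributes. *)
Lemma commutator_lower_bound (B kappa tau c1 M P H s w w' L X Yi g Phi dPhi drho
    rho y he eh l2h : R) :
  1 <= B -> 0 < kappa -> kappa <= 1 -> 0 < tau -> 1 <= kappa * tau ->
  0 <= P -> 0 <= M <= B -> Phi ^+ 2 <= B ^+ 2 -> `|rho| <= B ->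
  dPhi ^+ 2 <= B ^+ 2 * P -> drho ^+ 2 <= B ^+ 2 * P ->
  `|eh| <= B * kappa * tau ^+ 2 -> 0 <= l2h <= kappa * tau ^+ 2 ->
  g ^+ 2 <= (kappa * tau ^+ 2) ^+ 2 ->
  c1 * (P + tau ^+ 2 * w ^+ 2) <=
    4 * H + 4 * (tau ^+ 2 * w ^+ 2) * he + M * s ^+ 2
    - rho * (P - tau ^+ 2 * w ^+ 2 * y) ->
  X = - L - (tau ^+ 2 * y + l2h) * w ->
  Yi = tau * (2 * s + Phi * w) + g * w' ->
  tau * (w * drho + rho * P + rho * w * L) + c1 * (tau * P + tau ^+ 3 * w ^+ 2)
  - X ^+ 2 / 4 - B * kappa * Yi ^+ 2
  - 7 * B ^+ 3 * kappa * (tau * P + tau ^+ 3 * (w ^+ 2 + w' ^+ 2))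
  <= 4 * tau * H + 4 * tau ^+ 3 * he * w ^+ 2 + 2 * tau * (w * dPhi)
     + 2 * tau * eh * w ^+ 2.
Proof.
move=> B1 k0 k1 tau0 kt P0 /andP[M0 MB] PhiB rhoB dPhiB drhoB ehB /andP[l0 lB] gB QF XE YE.
have B0 : 0 < B by lra.
have w20 := sqr_ge0 w; have w'20 := sqr_ge0 w'.
have tau1 : 1 <= tau by rewrite (le_trans kt)// ler_piMl// ltW.
have t2 : tau ^+ 2 <= kappa * tau ^+ 3.
  by rewrite [tau ^+ 3]exprS mulrA ler_peMl// sqr_ge0.
(* The term in [M] is paid for by [Yi], because 2 tau s is [Yi] minus terms of order zero; 1 <=
   kappa tau again provides the factor kappa. *)
have m1 : tau * (M * s ^+ 2) <=
    B * kappa * Yi ^+ 2 + B ^+ 3 * kappa * (tau ^+ 3 * (w ^+ 2 + w' ^+ 2)).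
  have e1 : 4 * tau ^+ 2 * s ^+ 2 <=
      3 * (Yi ^+ 2 + B ^+ 2 * (tau ^+ 2 * w ^+ 2) + (kappa * tau ^+ 2) ^+ 2 * w' ^+ 2).
    have -> : 4 * tau ^+ 2 * s ^+ 2 = (Yi - tau * (Phi * w) - g * w') ^+ 2.
      by rewrite YE; ring.
    set p := tau * (Phi * w); set q := g * w'.
    have pB : p ^+ 2 <= B ^+ 2 * (tau ^+ 2 * w ^+ 2).
      rewrite /p (_ : _ ^+ 2 = Phi ^+ 2 * (tau ^+ 2 * w ^+ 2)); last by ring.
      by rewrite ler_wpM2r// mulr_ge0 ?sqr_ge0.
    have qB : q ^+ 2 <= (kappa * tau ^+ 2) ^+ 2 * w' ^+ 2.
      by rewrite /q exprMn ler_wpM2r.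
    have := sqr_ge0 (Yi + p); have := sqr_ge0 (Yi + q); have := sqr_ge0 (p - q).
    lra.
  have t40 : 0 < 4 * tau by rewrite mulr_gt0.
  rewrite -(ler_pM2l t40).
  have e2 : 4 * tau * (tau * (M * s ^+ 2)) <= B * (3 * (Yi ^+ 2 + B ^+ 2 * (tau ^+ 2 * w ^+ 2) + (kappa * tau ^+ 2) ^+ 2 * w' ^+ 2)).
    rewrite (_ : 4 * tau * (tau * (M * s ^+ 2)) = M * (4 * tau ^+ 2 * s ^+ 2)); last by ring.
    by apply: ler_pM => //; nneg.
  apply: le_trans e2 _.
  have f1 : 3 * Yi ^+ 2 <= 4 * (kappa * tau) * Yi ^+ 2.
    by rewrite ler_wpM2r ?sqr_ge0//; lra.
  have f2 : 3 * (tau ^+ 2 * w ^+ 2) <= 4 * tau * (kappa * (tau ^+ 3 * w ^+ 2)).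
    have : tau ^+ 2 * w ^+ 2 <= kappa * tau ^+ 3 * w ^+ 2 by rewrite ler_wpM2r.
    have z0 : 0 <= kappa * tau ^+ 3 * w ^+ 2.
      by rewrite mulr_ge0// mulr_ge0 ?(ltW k0)// exprn_ge0 ?ltW.
    by have := ler_peMl z0 tau1; lra.
  have f3 : 3 * ((kappa * tau ^+ 2) ^+ 2 * w' ^+ 2) <= 4 * tau * (kappa * (tau ^+ 3 * w' ^+ 2)).
    have z0 : 0 <= kappa * tau ^+ 4 * w' ^+ 2.
      by rewrite mulr_ge0// mulr_ge0 ?(ltW k0)// exprn_ge0 ?ltW.
    by have := ler_piMl z0 k1; lra.
  have B20 : 1 <= B ^+ 2 by rewrite exprn_ege1.
  have f3' := ler_wpM2l (ltW B0) f3.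
  have f4 : B * (4 * tau * (kappa * (tau ^+ 3 * w' ^+ 2))) <= B ^+ 3 * (4 * tau * (kappa * (tau ^+ 3 * w' ^+ 2))).
    rewrite ler_wpM2r//; last by rewrite exprS ler_peMr// ltW.
    by nneg.
  have B30 : 0 <= B ^+ 3 by rewrite exprn_ge0 ?ltW.
  have := ler_wpM2l B30 f2; have := ler_wpM2l (ltW B0) f1.
  lra.
have m2 := cross_term_bound w B0 tau0 kt P0 dPhiB.
have m3 := cross_term_bound (- w) B0 tau0 kt P0 drhoB.
have [r1 r2] : - B <= rho /\ rho <= B by apply/andP; rewrite -ler_norml.
(* Completing the square in X / 2 + tau rho w: this is the cost of replacing [L] by [X] in the
   multiplier rho w L. *)
have m4 : - (X ^+ 2 / 4) - B ^+ 2 * (kappa * tau ^+ 3 * w ^+ 2) <= tau * (rho * w * X).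
  have : 0 <= (X / 2 + tau * rho * w) ^+ 2 by exact: sqr_ge0.
  have : tau ^+ 2 * rho ^+ 2 * w ^+ 2 <= B ^+ 2 * (kappa * tau ^+ 3 * w ^+ 2).
    have rB : rho ^+ 2 <= B ^+ 2.
      by rewrite -[rho ^+ 2]real_normK ?num_real// ler_sqr ?nnegrE// ltW.
    have tw : tau ^+ 2 * w ^+ 2 <= kappa * tau ^+ 3 * w ^+ 2 by rewrite ler_wpM2r.
    rewrite (_ : tau ^+ 2 * _ * _ = rho ^+ 2 * (tau ^+ 2 * w ^+ 2)); last by ring.
    by apply: ler_pM => //; nneg.
  lra.
have m5 : - (B * (kappa * tau ^+ 3 * w ^+ 2)) <= tau * (rho * l2h * w ^+ 2).
  have z0 : 0 <= tau * w ^+ 2 by rewrite mulr_ge0// ltW.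
  have : - (B * (kappa * tau ^+ 2)) <= rho * l2h by nra.
  by move/(ler_wpM2r z0); lra.
have m6 : - (2 * (B * (kappa * tau ^+ 3 * w ^+ 2))) <= 2 * tau * eh * w ^+ 2.
  have z0 : 0 <= 2 * tau * w ^+ 2 by rewrite mulr_ge0// mulr_ge0// ltW.
  move: ehB; rewrite ler_norml => /andP[e1 _].
  by move/(ler_wpM2r z0): e1; lra.
have QFt := ler_wpM2l (ltW tau0) QF.
have p1 : 0 <= kappa * (tau * P) by nneg.
have p2 : 0 <= kappa * (tau ^+ 3 * w ^+ 2) by nneg.
have p3 : 0 <= kappa * (tau ^+ 3 * w' ^+ 2) by nneg.
have B30 : 0 <= B ^+ 3 by nneg.
have q1 := mulr_ge0 B30 p1; have q2 := mulr_ge0 B30 p2.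
have q3 := mulr_ge0 B30 p3.
have b1 : B <= B ^+ 3 by rewrite -[leLHS]expr1 ler_weXn2l.
have b2 : B ^+ 2 <= B ^+ 3 by rewrite ler_weXn2l.
have c1' := ler_wpM2r p1 b1; have c2' := ler_wpM2r p2 b1.
have c3' := ler_wpM2r p2 b2.
(* Eliminating [L] turns the divergence of rho w grad w into rho (P - tau^2 y w^2), the last part of
   the quadratic form, up to the errors bounded above. *)
have LE : L = - X - (tau ^+ 2 * y + l2h) * w by rewrite XE; ring.
rewrite LE; lra.
Qed.


(* Integrand of the divergences entering the commutator of - lap - W with
   2 grad phi . grad + lap phi; here s = grad phi . grad w, L = lap w, ... *)
Definition div_commutator (Phi W dW s H P L w dPhi : R) : R :=
  (- 4 * (s * L) - 4 * H + 2 * (P * Phi))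
  - 2 * (Phi * w * L + (Phi * P + w * dPhi))
  - 2 * (W * w ^+ 2 * Phi + (w ^+ 2 * dW + 2 * W * w * s)).

(** The divergence of rho w grad w. *)
Definition div_multiplier (rho P L w drho : R) : R :=
  rho * w * L + (rho * P + w * drho).

(* Two components X1 + i X2 and Y1 + i Y2; sum of squares of X + Y, the double
   product being a divergence plus terms controlled from below. *)
Lemma sum_square_lower_bound (B kappa tau c1 M G Phi rho y he eh l2h
    P1 H1 s1 w1 L1 dPhi1 drho1 dG1 P2 H2 s2 w2 L2 dPhi2 drho2 dG2
    X1 X2 Y1 Y2 : R) :
  1 <= B -> 0 < kappa -> kappa <= 1 -> 0 < tau -> 1 <= kappa * tau ->
  30 * B ^+ 3 * kappa <= c1 -> 2 * B * kappa <= 1 ->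
  0 <= M <= B -> Phi ^+ 2 <= B ^+ 2 -> `|rho| <= B ->
  `|eh| <= B * kappa * tau ^+ 2 -> 0 <= l2h <= kappa * tau ^+ 2 ->
  G ^+ 2 <= (kappa * tau ^+ 2) ^+ 2 ->
  0 <= P1 -> dPhi1 ^+ 2 <= B ^+ 2 * P1 -> drho1 ^+ 2 <= B ^+ 2 * P1 ->
  dG1 ^+ 2 <= B ^+ 2 * kappa ^+ 2 * tau ^+ 4 * P1 ->
  c1 * (P1 + tau ^+ 2 * w1 ^+ 2) <=
    4 * H1 + 4 * (tau ^+ 2 * w1 ^+ 2) * he + M * s1 ^+ 2
    - rho * (P1 - tau ^+ 2 * w1 ^+ 2 * y) ->
  0 <= P2 -> dPhi2 ^+ 2 <= B ^+ 2 * P2 -> drho2 ^+ 2 <= B ^+ 2 * P2 ->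
  dG2 ^+ 2 <= B ^+ 2 * kappa ^+ 2 * tau ^+ 4 * P2 ->
  c1 * (P2 + tau ^+ 2 * w2 ^+ 2) <=
    4 * H2 + 4 * (tau ^+ 2 * w2 ^+ 2) * he + M * s2 ^+ 2
    - rho * (P2 - tau ^+ 2 * w2 ^+ 2 * y) ->
  X1 = - L1 - (tau ^+ 2 * y + l2h) * w1 ->
  X2 = - L2 - (tau ^+ 2 * y + l2h) * w2 ->
  Y1 = tau * (2 * s1 + Phi * w1) + - G * w2 ->
  Y2 = tau * (2 * s2 + Phi * w2) + G * w1 ->
  let W := tau ^+ 2 * y + l2h in
  let dW := 2 * tau ^+ 2 * he + eh in
  is_true (
  tau * (div_commutator Phi W dW s1 H1 P1 L1 w1 dPhi1 + div_commutator Phi W dW s2 H2 P2 L2 w2 dPhi2)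
  + 2 * ((G * w2 * L1 + w2 * dG1) - (G * w1 * L2 + w1 * dG2))
  + tau * (div_multiplier rho P1 L1 w1 drho1 + div_multiplier rho P2 L2 w2 drho2)
  + (X1 ^+ 2 + X2 ^+ 2 + Y1 ^+ 2 + Y2 ^+ 2) / 2
  + c1 / 2 * (tau * (P1 + P2) + tau ^+ 3 * (w1 ^+ 2 + w2 ^+ 2))
  <= (X1 + Y1) ^+ 2 + (X2 + Y2) ^+ 2).
Proof.
move=> B1 k0 k1 tau0 kt kc kB MB PhiB rhoB ehB lB GB P10 dPhi1B drho1B dG1B QF1.
move=> P20 dPhi2B drho2B dG2B QF2 X1E X2E Y1E Y2E W dW.
have GB' : (- G) ^+ 2 <= (kappa * tau ^+ 2) ^+ 2 by rewrite sqrrN.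
have B0 : 0 < B by lra.
have K1 := commutator_lower_bound B1 k0 k1 tau0 kt P10 MB PhiB rhoB dPhi1B
  drho1B ehB lB GB' QF1 X1E Y1E.
have K2 := commutator_lower_bound B1 k0 k1 tau0 kt P20 MB PhiB rhoB dPhi2B
  drho2B ehB lB GB QF2 X2E Y2E.
have D1 := lower_order_bound w2 B0 tau0 k0 dG1B.
have dG2B' : (- dG2) ^+ 2 <= B ^+ 2 * kappa ^+ 2 * tau ^+ 4 * P2 by rewrite sqrrN.
have D2 := lower_order_bound w1 B0 tau0 k0 dG2B'.
have y10 := sqr_ge0 Y1; have y20 := sqr_ge0 Y2.
have x10 := sqr_ge0 X1; have x20 := sqr_ge0 X2.
(* In the products with G the terms in W cancel between the two components, and G (w2 L1 - w1 L2) is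
   a divergence up to grad G. Thus G, possibly of size kappa tau^2, costs only its gradient in the
   double product. *)
have XY : 2 * (X1 * Y1 + X2 * Y2) =
  tau * (div_commutator Phi W dW s1 H1 P1 L1 w1 dPhi1 + div_commutator Phi W dW s2 H2 P2 L2 w2 dPhi2)
  + 2 * ((G * w2 * L1 + w2 * dG1) - (G * w1 * L2 + w1 * dG2))
  + (4 * tau * H1 + 4 * tau ^+ 3 * he * w1 ^+ 2 + 2 * tau * (w1 * dPhi1)
     + 2 * tau * eh * w1 ^+ 2)
  + (4 * tau * H2 + 4 * tau ^+ 3 * he * w2 ^+ 2 + 2 * tau * (w2 * dPhi2)
     + 2 * tau * eh * w2 ^+ 2)
  - 2 * (dG1 * w2) - 2 * (- dG2 * w1).
  by rewrite /div_commutator /W /dW X1E X2E Y1E Y2E; ring.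
set T := tau * (P1 + P2) + tau ^+ 3 * (w1 ^+ 2 + w2 ^+ 2).
have T1 : 0 <= tau * (P1 + P2) by nneg.
have T2 : 0 <= tau ^+ 3 * (w1 ^+ 2 + w2 ^+ 2) by nneg.
have T0 : 0 <= T by rewrite addr_ge0.
have e1 : 2 * B * kappa * (Y1 ^+ 2 + Y2 ^+ 2) <= Y1 ^+ 2 + Y2 ^+ 2.
  by rewrite ler_piMl// addr_ge0.
have BB : B <= B ^+ 3 by rewrite -[leLHS]expr1 ler_weXn2l.
have e2 : 30 * B ^+ 3 * kappa * T <= c1 * T by rewrite ler_wpM2r.
have e3 : B * (kappa * T) <= B ^+ 3 * (kappa * T).
  by rewrite ler_wpM2r// mulr_ge0// ltW.
have e4 : 0 <= B ^+ 3 * (kappa * (tau * (P1 + P2))) by nneg.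
rewrite (_ : (X1 + Y1) ^+ 2 + _ = X1 ^+ 2 + Y1 ^+ 2 + X2 ^+ 2 + Y2 ^+ 2 +
  2 * (X1 * Y1 + X2 * Y2)); last by ring.
rewrite XY /div_multiplier.
set d1 := div_commutator _ _ _ s1 _ _ _ _ _.
set d2 := div_commutator _ _ _ s2 _ _ _ _ _.
move: x10 x20 y10 y20 e1 e2 e3 e4 K1 K2 D1 D2; rewrite /T; clearbody d1 d2; clear.
move: (B ^+ 3) => B3 *; lra.
Qed.

(** Here A = |grad a|^2, P = |grad w|^2, Q = |grad v|^2, [Da] = grad a . grad v, [da] = grad phi .
    grad a and [La] = lap a. The bounds concern the first-order terms that separate P_phi v from X +
    i Y, and the passage from grad w back to nu grad v. *)
Lemma perturbation_bounds (B kappa tau lam beta a A P1 P2 La da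
    v1 v2 Da1 Da2 Q1 Q2 : R) :
  let w2v := (1 + beta ^+ 2) * (v1 ^+ 2 + v2 ^+ 2) in
  let T := tau * (P1 + P2) + tau ^+ 3 * w2v in
  1 <= B -> 0 < kappa -> kappa <= 1 -> 1 <= tau ->
  beta = lam * a -> 0 <= lam -> lam <= kappa * tau -> 0 <= a ->
  0 <= A -> A <= B * a -> 0 <= P1 -> 0 <= P2 -> 0 <= Q1 -> 0 <= Q2 ->
  (1 + beta ^+ 2) * (Q1 + Q2) <=
    2 * (P1 + P2) + 2 * (lam ^+ 2 * A) * (v1 ^+ 2 + v2 ^+ 2) ->
  Da1 ^+ 2 <= A * Q1 -> Da2 ^+ 2 <= A * Q2 -> da ^+ 2 <= A * B -> La ^+ 2 <= B ^+ 2 ->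
  [/\ lam ^+ 2 * La ^+ 2 * (v1 ^+ 2 + v2 ^+ 2) <= 2 * B ^+ 2 * kappa * T,
      lam ^+ 2 * (Da1 ^+ 2 + Da2 ^+ 2) <= 2 * B ^+ 2 * kappa * T,
      tau ^+ 2 * lam ^+ 2 * da ^+ 2 * (v1 ^+ 2 + v2 ^+ 2) <= 2 * B ^+ 2 * kappa * T &
      tau * ((1 + beta ^+ 2) * (Q1 + Q2)) <=
        2 * (tau * (P1 + P2)) + 2 * B * kappa * (tau ^+ 3 * w2v)].
Proof.
move=> w2v T B1 k0 k1 t1 bE l0 lk a0 A0 Aa P10 P20 Q10 Q20 QP Da1A Da2A daA LaB.
have B0 : 0 < B by lra.
have t0 : 0 < tau by lra.
have n1 : 1 <= 1 + beta ^+ 2 by rewrite lerDl sqr_ge0.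
have vv : 0 <= v1 ^+ 2 + v2 ^+ 2 by nneg.
have vw : v1 ^+ 2 + v2 ^+ 2 <= w2v by rewrite /w2v ler_peMl.
have w0 : 0 <= w2v by exact: le_trans vw.
(* The gain from a >= 0: lam^2 |grad a|^2 <= B lam (lam a) <= B lam nu^2, with one power of lam
   instead of two. After this, lam <= kappa tau is enough for all four bounds. *)
have lA : lam ^+ 2 * A <= B * lam * (1 + beta ^+ 2).
  have : lam ^+ 2 * A <= lam ^+ 2 * (B * a) by rewrite ler_wpM2l ?sqr_ge0.
  move/le_trans; apply.
  rewrite (_ : lam ^+ 2 * (B * a) = B * lam * beta); last by rewrite bE; ring.
  rewrite ler_wpM2l//; first by nneg.
  have := sqr_ge0 (beta - 1 / 2); lra.
have lt : lam ^+ 2 <= kappa * tau ^+ 2.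
  have := ler_pM l0 l0 lk lk; rewrite -!expr2 exprMn => /le_trans; apply.
  by rewrite ler_wpM2r ?sqr_ge0// expr2 ler_piMl// ltW.
have t23 : tau ^+ 2 <= tau ^+ 3 by rewrite ler_weXn2l.
have t13 : kappa * tau ^+ 2 <= kappa * tau ^+ 3 by rewrite ler_wpM2l// ltW.
have lAv : lam ^+ 2 * A * (v1 ^+ 2 + v2 ^+ 2) <= B * lam * w2v.
  by rewrite /w2v [leRHS]mulrA ler_wpM2r.
have QPw : (1 + beta ^+ 2) * (Q1 + Q2) <= 2 * (P1 + P2) + 2 * (B * lam * w2v).
  by apply: le_trans QP _; rewrite lerD2l -mulrA ler_pM2l.
have S0 : 0 <= tau * (P1 + P2) by nneg.
have W0 : 0 <= tau ^+ 3 * w2v by nneg.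
have B2 : B <= B ^+ 2 by rewrite -[leLHS]expr1 ler_weXn2l.
have B20 : 0 <= B ^+ 2 by nneg.
have kS : 0 <= kappa * (tau * (P1 + P2)) by nneg.
have kW : 0 <= kappa * (tau ^+ 3 * w2v) by nneg.
have f1 := mulr_ge0 B20 kS; have f2 := mulr_ge0 B20 kW.
have llW : lam ^+ 2 * w2v <= kappa * (tau ^+ 3 * w2v).
  by rewrite mulrA ler_wpM2r//; apply: le_trans lt t13.
split.
- have : lam ^+ 2 * La ^+ 2 * (v1 ^+ 2 + v2 ^+ 2) <= B ^+ 2 * (lam ^+ 2 * w2v).
    rewrite [lam ^+ 2 * _]mulrC -mulrA; apply: ler_pM => //; try nneg.
    by rewrite ler_wpM2l ?sqr_ge0.
  have := ler_wpM2l B20 llW.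
  rewrite /T; lra.
- have : lam ^+ 2 * (Da1 ^+ 2 + Da2 ^+ 2) <= lam ^+ 2 * A * (Q1 + Q2).
    by rewrite -mulrA ler_wpM2l ?sqr_ge0//; lra.
  have : lam ^+ 2 * A * (Q1 + Q2) <= B * lam * ((1 + beta ^+ 2) * (Q1 + Q2)).
    by rewrite [leRHS]mulrA ler_wpM2r// addr_ge0.
  have Bl : 0 <= B * lam by nneg.
  have := ler_wpM2l Bl QPw.
  have : B * lam * (P1 + P2) <= B * kappa * tau * (P1 + P2).
    by rewrite ler_wpM2r ?addr_ge0// -mulrA ler_wpM2l// ltW.
  have := ler_wpM2r kS B2.
  have := ler_wpM2l B20 llW.
  rewrite /T; lra.
- have : tau ^+ 2 * lam ^+ 2 * da ^+ 2 * (v1 ^+ 2 + v2 ^+ 2) <=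
      tau ^+ 2 * B * (lam ^+ 2 * A * (v1 ^+ 2 + v2 ^+ 2)).
    rewrite (_ : tau ^+ 2 * B * _ = tau ^+ 2 * lam ^+ 2 * (A * B) * (v1 ^+ 2 + v2 ^+ 2)); last by ring.
    by rewrite ler_wpM2r// ler_wpM2l//; nneg.
  have tB : 0 <= tau ^+ 2 * B by nneg.
  have := ler_wpM2l tB lAv.
  have z0 : 0 <= tau ^+ 2 * w2v by nneg.
  have := ler_wpM2r z0 lk.
  have := ler_wpM2l B20 (ler_wpM2r z0 lk).
  rewrite /T; lra.
- have := ler_wpM2l (ltW t0) QPw.
  have z0 : 0 <= tau * w2v by nneg.
  have z1 : lam * (tau * w2v) <= kappa * tau * (tau * w2v) by rewrite ler_wpM2r.
  have z2 : kappa * tau ^+ 2 * w2v <= kappa * tau ^+ 3 * w2v by rewrite ler_wpM2r.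
  have z3 : lam * (tau * w2v) <= kappa * (tau ^+ 3 * w2v) by lra.
  have := ler_wpM2l (ltW B0) z3; lra.
Qed.


Lemma sqr_perturb_le (l x p q r : R) : (x - l * (p + q - r)) ^+ 2 <=
  2 * x ^+ 2 + 6 * (l ^+ 2 * (p ^+ 2 + q ^+ 2 + r ^+ 2)).
Proof.
have := sqr_ge0 (x + l * (p + q - r)).
have := sqr_ge0 (l * (p - q)); have := sqr_ge0 (l * (p + r)).
have := sqr_ge0 (l * (q + r)); lra.
Qed.

Lemma sqr_sum3_le (p q r : R) :
  (p - q + r) ^+ 2 <= 3 * (p ^+ 2 + q ^+ 2 + r ^+ 2).
Proof.
have := sqr_ge0 (p + q); have := sqr_ge0 (p - r); have := sqr_ge0 (q + r); lra.
Qed.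

Lemma sqr_scaled3_le (l p q r : R) :
  (l * (2 * p + q + r)) ^+ 2 <= 3 * l ^+ 2 * (4 * p ^+ 2 + q ^+ 2 + r ^+ 2).
Proof.
have := sqr_ge0 (l * (2 * p - q)); have := sqr_ge0 (l * (2 * p - r)).
have := sqr_ge0 (l * (q - r)); lra.
Qed.

Lemma sqr_scaled2_le (l p r : R) :
  (l * (p + r)) ^+ 2 <= 2 * l ^+ 2 * (p ^+ 2 + r ^+ 2).
Proof. have := sqr_ge0 (l * (p - r)); lra. Qed.

Lemma sqr_le_shift (q r : R) : q ^+ 2 <= 2 * (q + r) ^+ 2 + 2 * r ^+ 2.
Proof. have := sqr_ge0 (q + 2 * r); lra. Qed.

(** This is exp(t phi) lap (exp(- t phi) v), where Phi = lap phi, y = |grad phi|^2, L = lap v and s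
    = grad phi . grad v. *)
Definition conj_lap (Phi y t L s v : R) : R :=
  L - 2 * t * s - t * Phi * v + t ^+ 2 * y * v.

(** Real part of P_phi v for v = v1 + i v2: the factor of l is exp(t phi) div(a grad(exp(- t phi)
    v2)), with da = grad phi . grad a and D2 = grad a . grad v2. Negating both [l] and [t] gives the
    adjoint. *)
Definition pphi_re (Phi y a da v1 L1 s1 v2 L2 s2 D2 l t : R) : R :=
  - conj_lap Phi y t L1 s1 v1 + l * (a * conj_lap Phi y t L2 s2 v2 + D2 - t * da * v2)
  - l ^+ 2 * v1.

Definition pphi_im (Phi y a da v1 L1 s1 v2 L2 s2 D1 l t : R) : R :=
  - conj_lap Phi y t L2 s2 v2 - l * (a * conj_lap Phi y t L1 s1 v1 + D1 - t * da * v1)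
  - l ^+ 2 * v2.

(* For P and its adjoint Q, written in terms of the jet of v at a point, where
   w = b v with b = 1 + i beta. *)
Lemma carleman_pointwise (B kappa tau c1 M lam beta a A La da h Phi rho y he eh
    v1 v2 Lv1 Lv2 sv1 sv2 Da1 Da2 Q1 Q2
    w1 w2 L1 L2 s1 s2 P1 P2 H1 H2 dPhi1 dPhi2 drho1 drho2 dG1 dG2 : R) :
  let re := pphi_re Phi y a da v1 Lv1 sv1 v2 Lv2 sv2 Da2 in
  let im := pphi_im Phi y a da v1 Lv1 sv1 v2 Lv2 sv2 Da1 in
  let W := tau ^+ 2 * y + lam ^+ 2 * h in
  let dW := 2 * tau ^+ 2 * he + eh in
  let G := lam ^+ 2 * (beta * h) in
  let m := 16 / c1 + 6 in
  1 <= B -> 0 < kappa -> kappa <= 1 -> 0 < c1 ->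
  150 * B ^+ 3 * kappa <= c1 -> 170 * B ^+ 3 * kappa <= 1 ->
  1 <= kappa * tau -> 0 <= lam -> lam <= kappa * tau -> beta = lam * a -> 0 <= a ->
  h * (1 + beta ^+ 2) = 1 ->
  w1 = v1 - beta * v2 -> w2 = v2 + beta * v1 ->
  L1 = Lv1 - lam * (a * Lv2 + 2 * Da2 + La * v2) ->
  L2 = Lv2 + lam * (a * Lv1 + 2 * Da1 + La * v1) ->
  s1 = sv1 - lam * (a * sv2 + v2 * da) ->
  s2 = sv2 + lam * (a * sv1 + v1 * da) ->
  0 <= M <= B -> Phi ^+ 2 <= B ^+ 2 -> `|rho| <= B ->
  `|eh| <= B * kappa * tau ^+ 2 ->
  0 <= P1 -> dPhi1 ^+ 2 <= B ^+ 2 * P1 -> drho1 ^+ 2 <= B ^+ 2 * P1 ->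
  dG1 ^+ 2 <= B ^+ 2 * kappa ^+ 2 * tau ^+ 4 * P1 ->
  c1 * (P1 + tau ^+ 2 * w1 ^+ 2) <=
    4 * H1 + 4 * (tau ^+ 2 * w1 ^+ 2) * he + M * s1 ^+ 2
    - rho * (P1 - tau ^+ 2 * w1 ^+ 2 * y) ->
  0 <= P2 -> dPhi2 ^+ 2 <= B ^+ 2 * P2 -> drho2 ^+ 2 <= B ^+ 2 * P2 ->
  dG2 ^+ 2 <= B ^+ 2 * kappa ^+ 2 * tau ^+ 4 * P2 ->
  c1 * (P2 + tau ^+ 2 * w2 ^+ 2) <=
    4 * H2 + 4 * (tau ^+ 2 * w2 ^+ 2) * he + M * s2 ^+ 2
    - rho * (P2 - tau ^+ 2 * w2 ^+ 2 * y) ->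
  0 <= A -> A <= B * a -> 0 <= Q1 -> 0 <= Q2 ->
  (1 + beta ^+ 2) * (Q1 + Q2) <=
    2 * (P1 + P2) + 2 * (lam ^+ 2 * A) * (v1 ^+ 2 + v2 ^+ 2) ->
  Da1 ^+ 2 <= A * Q1 -> Da2 ^+ 2 <= A * Q2 -> da ^+ 2 <= A * B -> La ^+ 2 <= B ^+ 2 ->
  is_true (
  tau ^+ 3 * ((1 + beta ^+ 2) * (v1 ^+ 2 + v2 ^+ 2)) + tau * ((1 + beta ^+ 2) * (Q1 + Q2))
  + (re lam tau ^+ 2 + im lam tau ^+ 2) / 2
  + (re (- lam) (- tau) ^+ 2 + im (- lam) (- tau) ^+ 2) / 2
  + m * (tau * (div_commutator Phi W dW s1 H1 P1 L1 w1 dPhi1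
                + div_commutator Phi W dW s2 H2 P2 L2 w2 dPhi2)
         + 2 * ((G * w2 * L1 + w2 * dG1) - (G * w1 * L2 + w1 * dG2))
         + tau * (div_multiplier rho P1 L1 w1 drho1 + div_multiplier rho P2 L2 w2 drho2))
  <= (2 * m + 1) * (re lam tau ^+ 2 + im lam tau ^+ 2)).
Proof.
move=> re im W dW G m B1 k0 k1 c10 kc kB kt l0 lk bE a0 hE w1E w2E L1E L2E s1E s2E.
move=> MB PhiB rhoB ehB P10 dPhi1B drho1B dG1B QF1 P20 dPhi2B drho2B dG2B QF2.
move=> A0 Aa Q10 Q20 QP Da1A Da2A daA LaB.
have tau0 : 0 < tau by rewrite -(pmulr_rgt0 _ k0) (lt_le_trans _ kt).
have tau1 : 1 <= tau by rewrite (le_trans kt)// ler_piMl// ltW.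
have n1 : 1 <= 1 + beta ^+ 2 by rewrite lerDl sqr_ge0.
have n0 : 0 < 1 + beta ^+ 2 by exact: lt_le_trans n1.
have h0 : 0 <= h by rewrite -(pmulr_lge0 _ n0) hE.
have h1 : h <= 1 by rewrite -hE ler_peMr.
have b0 : 0 <= beta by rewrite bE mulr_ge0.
have bh0 : 0 <= beta * h by rewrite mulr_ge0.
have bh1 : beta * h <= 1.
  by rewrite mulrC -hE ler_wpM2l//; have := sqr_ge0 (beta - 1 / 2); clear; lra.
have l2 : lam ^+ 2 <= kappa * tau ^+ 2.
  have := ler_pM l0 l0 lk lk; rewrite -!expr2 exprMn => /le_trans; apply.
  by rewrite ler_wpM2r ?sqr_ge0// expr2 ler_piMl// ltW.
have lB : 0 <= lam ^+ 2 * h <= kappa * tau ^+ 2.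
  rewrite mulr_ge0 ?sqr_ge0//=; apply: le_trans l2.
  by rewrite ler_piMr ?sqr_ge0.
have G0 : 0 <= G by rewrite mulr_ge0 ?sqr_ge0.
have GB : G ^+ 2 <= (kappa * tau ^+ 2) ^+ 2.
  have kt0 : 0 <= kappa * tau ^+ 2 by nneg.
  rewrite ler_sqr ?nnegrE//; apply: le_trans l2.
  by rewrite ler_piMr ?sqr_ge0.
have B0 : 0 < B by exact: lt_le_trans B1.
have B13 : 1 <= B ^+ 3 by rewrite exprn_ege1.
have BB3 : B <= B ^+ 3 by rewrite -[leLHS]expr1 ler_weXn2l.
have B2B3 : B ^+ 2 <= B ^+ 3 by rewrite ler_weXn2l.
have Bk3 : 0 <= B ^+ 3 * kappa by nneg.
have Bk := ler_wpM2r (ltW k0) BB3; have B2k := ler_wpM2r (ltW k0) B2B3.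
have kc' : 30 * B ^+ 3 * kappa <= c1 by move: kc Bk3; clear; lra.
have kB' : 2 * B * kappa <= 1 by move: kB Bk Bk3; clear; lra.
pose X1 := - L1 - W * w1; pose X2 := - L2 - W * w2.
pose Y1 := tau * (2 * s1 + Phi * w1) + - G * w2.
pose Y2 := tau * (2 * s2 + Phi * w2) + G * w1.
set N := tau * (_ + _) + _ + _.
have key : N + (X1 ^+ 2 + X2 ^+ 2 + Y1 ^+ 2 + Y2 ^+ 2) / 2
    + c1 / 2 * (tau * (P1 + P2) + tau ^+ 3 * (w1 ^+ 2 + w2 ^+ 2))
    <= (X1 + Y1) ^+ 2 + (X2 + Y2) ^+ 2.
  exact: (sum_square_lower_bound B1 k0 k1 tau0 kt kc' kB' MB PhiB rhoB ehB lB GB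
    P10 dPhi1B drho1B dG1B QF1 P20 dPhi2B drho2B dG2B QF2
    (erefl X1) (erefl X2) (erefl Y1) (erefl Y2)).
have [D1 D2 D3 D4] := perturbation_bounds B1 k0 k1 tau1 bE l0 lk a0 A0 Aa P10 P20 Q10 Q20
  QP Da1A Da2A daA LaB.
clear QF1 QF2 dG1B dG2B drho1B drho2B dPhi1B dPhi2B MB PhiB rhoB ehB.
have wv : w1 ^+ 2 + w2 ^+ 2 = (1 + beta ^+ 2) * (v1 ^+ 2 + v2 ^+ 2).
  by rewrite w1E w2E; ring.
pose w2v := (1 + beta ^+ 2) * (v1 ^+ 2 + v2 ^+ 2).
pose T := tau * (P1 + P2) + tau ^+ 3 * w2v.
rewrite -/w2v -/T in D1 D2 D3 D4; rewrite wv -/w2v -/T in key.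
pose u := 2 * B ^+ 2 * kappa * T.
rewrite -/u in D1 D2 D3.
have S0 : 0 <= tau * (P1 + P2) by nneg.
have W0 : 0 <= tau ^+ 3 * w2v by rewrite /w2v; nneg.
have T0 : 0 <= T by rewrite addr_ge0.
pose D1v := lam ^+ 2 * La ^+ 2 * (v1 ^+ 2 + v2 ^+ 2).
pose D2v := lam ^+ 2 * (Da1 ^+ 2 + Da2 ^+ 2).
pose D3v := tau ^+ 2 * lam ^+ 2 * da ^+ 2 * (v1 ^+ 2 + v2 ^+ 2).
(* P v = (X + Y) + R, with R of first order in v *)
have hv1 : lam ^+ 2 * h * w1 + G * w2 = lam ^+ 2 * v1.
  rewrite (_ : _ + _ = lam ^+ 2 * v1 * (h * (1 + beta ^+ 2))); first by rewrite hE mulr1.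
  by rewrite /G w1E w2E; ring.
have hv2 : lam ^+ 2 * h * w2 - G * w1 = lam ^+ 2 * v2.
  rewrite (_ : _ - _ = lam ^+ 2 * v2 * (h * (1 + beta ^+ 2))); first by rewrite hE mulr1.
  by rewrite /G w1E w2E; ring.
have F1 : X1 + Y1 = re lam tau - - lam * (La * v2 + Da2 - tau * da * v2).
  rewrite (_ : X1 + Y1 = - L1 - tau ^+ 2 * y * w1 + tau * (2 * s1 + Phi * w1)
    - (lam ^+ 2 * h * w1 + G * w2)); last by rewrite /X1 /Y1 /W; ring.
  by rewrite hv1 /re /pphi_re /conj_lap L1E s1E w1E bE; ring.
have F2 : X2 + Y2 = im lam tau - lam * (La * v1 + Da1 - tau * da * v1).
  rewrite (_ : X2 + Y2 = - L2 - tau ^+ 2 * y * w2 + tau * (2 * s2 + Phi * w2)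
    - (lam ^+ 2 * h * w2 - G * w1)); last by rewrite /X2 /Y2 /W; ring.
  by rewrite hv2 /im /pphi_im /conj_lap L2E s2E w2E bE; ring.
have Fle : (X1 + Y1) ^+ 2 + (X2 + Y2) ^+ 2 <=
    2 * (re lam tau ^+ 2 + im lam tau ^+ 2) + 6 * (D1v + D2v + D3v).
  rewrite F1 F2; set p1 := re _ _; set p2 := im _ _.
  have := lerD (sqr_perturb_le (- lam) p1 (La * v2) Da2 (tau * da * v2))
    (sqr_perturb_le lam p2 (La * v1) Da1 (tau * da * v1)).
  by rewrite /D1v /D2v /D3v; clear; lra.
(* b (Q v + A2) = bbar Z *)
pose A11 := - (lam * (2 * Da2 + La * v2 + 2 * tau * da * v2)).
pose A12 := lam * (2 * Da1 + La * v1 + 2 * tau * da * v1).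
pose A21 := lam * (Da2 + tau * da * v2).
pose A22 := - (lam * (Da1 + tau * da * v1)).
pose Z1 := X1 - Y1 + A11; pose Z2 := X2 - Y2 + A12.
pose q1 := re (- lam) (- tau); pose q2 := im (- lam) (- tau).
have hw1 : lam ^+ 2 * h * (w1 + beta * w2) - G * (w2 - beta * w1) =
    lam ^+ 2 * w1.
  rewrite (_ : _ - _ = lam ^+ 2 * w1 * (h * (1 + beta ^+ 2))); first by rewrite hE mulr1.
  by rewrite /G; ring.
have hw2 : lam ^+ 2 * h * (w2 - beta * w1) + G * (w1 + beta * w2) =
    lam ^+ 2 * w2.
  rewrite (_ : _ + _ = lam ^+ 2 * w2 * (h * (1 + beta ^+ 2))); first by rewrite hE mulr1.
  by rewrite /G; ring.
have E1 : (q1 + A21) - beta * (q2 + A22) = Z1 + beta * Z2.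
  rewrite (_ : Z1 + beta * Z2 = (- L1 - tau ^+ 2 * y * w1 - tau * (2 * s1 + Phi * w1) + A11)
    + beta * (- L2 - tau ^+ 2 * y * w2 - tau * (2 * s2 + Phi * w2) + A12)
    - (lam ^+ 2 * h * (w1 + beta * w2) - G * (w2 - beta * w1))); last first.
    by rewrite /Z1 /Z2 /X1 /X2 /Y1 /Y2 /W; ring.
  by rewrite hw1 /q1 /q2 /re /im /pphi_re /pphi_im /conj_lap /A11 /A12 /A21 /A22 L1E L2E s1E s2E w1E w2E bE; ring.
have E2 : (q2 + A22) + beta * (q1 + A21) = Z2 - beta * Z1.
  rewrite (_ : Z2 - beta * Z1 = (- L2 - tau ^+ 2 * y * w2 - tau * (2 * s2 + Phi * w2) + A12)
    - beta * (- L1 - tau ^+ 2 * y * w1 - tau * (2 * s1 + Phi * w1) + A11)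
    - (lam ^+ 2 * h * (w2 - beta * w1) + G * (w1 + beta * w2))); last first.
    by rewrite /Z1 /Z2 /X1 /X2 /Y1 /Y2 /W; ring.
  by rewrite hw2 /q1 /q2 /re /im /pphi_re /pphi_im /conj_lap /A11 /A12 /A21 /A22 L1E L2E s1E s2E w1E w2E bE; ring.
(* Since b and its conjugate have the same modulus, the adjoint is compared with X - i Y without
   losing a factor nu. *)
have QZ : (q1 + A21) ^+ 2 + (q2 + A22) ^+ 2 = Z1 ^+ 2 + Z2 ^+ 2.
  apply: (mulfI (lt0r_neq0 n0)).
  have := congr2 (fun s t => s ^+ 2 + t ^+ 2) E1 E2.
  set s := q1 + A21; set t := q2 + A22; move=> /= st.
  rewrite (_ : (1 + beta ^+ 2) * (s ^+ 2 + t ^+ 2) =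
    (s - beta * t) ^+ 2 + (t + beta * s) ^+ 2); last by ring.
  by rewrite st; ring.
pose Xi := X1 ^+ 2 + X2 ^+ 2 + Y1 ^+ 2 + Y2 ^+ 2.
have Qle : q1 ^+ 2 + q2 ^+ 2 <= 6 * Xi + 18 * D1v + 76 * D2v + 76 * D3v.
  have q1le := sqr_le_shift q1 A21; have q2le := sqr_le_shift q2 A22.
  have Z1le := sqr_sum3_le X1 Y1 A11; have Z2le := sqr_sum3_le X2 Y2 A12.
  have A1le : A11 ^+ 2 + A12 ^+ 2 <= 3 * (4 * D2v + D1v + 4 * D3v).
    have := lerD (sqr_scaled3_le lam Da2 (La * v2) (2 * tau * da * v2))
      (sqr_scaled3_le lam Da1 (La * v1) (2 * tau * da * v1)).
    by rewrite /A11 /A12 /D1v /D2v /D3v sqrrN; clear; lra.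
  have A2le : A21 ^+ 2 + A22 ^+ 2 <= 2 * (D2v + D3v).
    have := lerD (sqr_scaled2_le lam Da2 (tau * da * v2))
      (sqr_scaled2_le lam Da1 (tau * da * v1)).
    by rewrite /A21 /A22 /D2v /D3v sqrrN; clear; lra.
  rewrite -/Z1 in Z1le; rewrite -/Z2 in Z2le.
  rewrite /Xi; move: QZ q1le q2le Z1le Z2le A1le A2le; clear.
  move: ((q1 + A21) ^+ 2) ((q2 + A22) ^+ 2) (q1 ^+ 2) (q2 ^+ 2) => *; lra.
rewrite -/q1 -/q2.
rewrite -/D1v in D1; rewrite -/D2v in D2; rewrite -/D3v in D3.
rewrite -/Xi in key.
set Psq := re lam tau ^+ 2 + im lam tau ^+ 2 in Fle *.
have Psq0 : 0 <= Psq by nneg.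
have Xi0 : 0 <= Xi by rewrite /Xi; nneg.
(* Here 150 and 170 are spent. The errors 6 (D1v + D2v + D3v) are at most 36 B^2 kappa T, which must
   not exceed c1 T / 4; half of the errors in [Qle] is at most (9 + 38 + 38) u = 170 B^2 kappa T. *)
have uT : 150 * B ^+ 2 * kappa * T <= c1 * T.
  by rewrite ler_wpM2r//; move: kc B2k; clear; lra.
have uT1 : 170 * B ^+ 2 * kappa * T <= T.
  by rewrite -[leRHS]mul1r ler_wpM2r//; move: kB B2k; clear; lra.
have BW : 2 * B * kappa * (tau ^+ 3 * w2v) <= tau ^+ 3 * w2v.
  by rewrite ler_piMl.
have main : N + Xi / 2 + c1 / 4 * T <= 2 * Psq.
  have uE : u = 2 * (B ^+ 2 * kappa * T) by rewrite /u; ring.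
  have cT0 : 0 <= c1 * T by rewrite mulr_ge0// ltW.
  move: key Fle D1 D2 D3 uT cT0; rewrite uE.
  clearbody N Xi T D1v D2v D3v Psq X1 X2 Y1 Y2; clear; move: (B ^+ 2) => B2.
  by move=> *; lra.
(* The two summands of [m]: 6 buys the 3 Xi needed for half of the adjoint term, and 16 / c1 buys 4
   T, which covers the weighted norms of v and Dv and the remaining errors. *)
have m6 : 3 * Xi <= m * (Xi / 2).
  rewrite /m mulrDl.
  have : 0 <= 16 / c1 * (Xi / 2) by rewrite mulr_ge0 ?divr_ge0 ?(ltW c10).
  lra.
have m16 : 4 * T <= m * (c1 / 4 * T).
  have -> : m * (c1 / 4 * T) = 4 * T + 6 * (c1 / 4 * T).
    by rewrite /m; clear -c10; field; rewrite gt_eqF.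
  by rewrite lerDl mulr_ge0// mulr_ge0// divr_ge0 ?(ltW c10).
have m0 : 0 <= m by rewrite addr_ge0// divr_ge0 ?(ltW c10).
have mmain := ler_wpM2l m0 main.
have uE : u = 2 * (B ^+ 2 * kappa * T) by rewrite /u; ring.
move: Qle D1 D2 D3 D4 uT1 BW m6 m16 mmain S0 W0 Psq0; rewrite -/w2v uE /T.
clearbody Xi D1v D2v D3v q1 q2 Psq N m w2v; clear.
move: (B ^+ 2) => B2 *; lra.
Qed.

End quadratic_form_algebra.

(** * The conjugated operator and its adjoint *)

Ltac smooth_auto := repeat
    match goal with
    | H : smooth ?f |- smooth ?f => exact H
    | H : smooth ?f |- smooth (fun x => ?f x) => exact H
    | |- smooth (fun _ => ?c) => exact (smoothC c)
    | |- smooth (fun x => @?f x + @?g x) => refine (@smoothD _ _ f g _ _)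
    | |- smooth (fun x => @?f x * @?g x) => refine (@smoothM _ _ f g _ _)
    | |- smooth (fun x => - @?f x) => refine (@smoothN _ _ f _)
    | |- smooth (fun x => @?f x ^+ ?n) => refine (@smoothX _ _ f n _)
    | |- smooth (fun x => expR (@?f x)) => refine (@smooth_exp _ _ f _)
    | |- smooth (fun x => lap ?f x) => refine (@smooth_lap _ _ f _)
    | |- smooth (lap ?f) => refine (@smooth_lap _ _ f _)
    | |- smooth (fun x => gdot ?f ?g x) => refine (@smooth_gdot _ _ f g _ _)
    | |- smooth (gdot ?f ?g) => refine (@smooth_gdot _ _ f g _ _)
    | |- smooth (fun x => partial ?j ?f x) => refine (@smooth_partial _ _ f j _)
    | |- smooth (partial ?j ?f) => refine (@smooth_partial _ _ f j _)
    end.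

(** [X] and [Y] stand for exp(t phi x) and exp(- t phi x). *)
Lemma pphi_re_factor (R : realFieldType) (X Y Phi y a da v1 L1 s1 v2 L2 s2 D2 l t : R) :
  X * Y = 1 ->
  X * (- (Y * conj_lap Phi y t L1 s1 v1)
    + l * (a * (Y * conj_lap Phi y t L2 s2 v2) + Y * (D2 - t * da * v2))
    - l ^+ 2 * (Y * v1)) = pphi_re Phi y a da v1 L1 s1 v2 L2 s2 D2 l t.
Proof.
move=> XY; rewrite /pphi_re; set c1 := conj_lap _ _ _ _ _ _.
set c2 := conj_lap _ _ _ _ _ _; rewrite -[RHS]mul1r -XY; ring.
Qed.

Lemma pphi_im_factor (R : realFieldType) (X Y Phi y a da v1 L1 s1 v2 L2 s2 D1 l t : R) :
  X * Y = 1 ->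
  X * (- (Y * conj_lap Phi y t L2 s2 v2)
    - l * (a * (Y * conj_lap Phi y t L1 s1 v1) + Y * (D1 - t * da * v1))
    - l ^+ 2 * (Y * v2)) = pphi_im Phi y a da v1 L1 s1 v2 L2 s2 D1 l t.
Proof.
move=> XY; rewrite /pphi_im; set c1 := conj_lap _ _ _ _ _ _.
set c2 := conj_lap _ _ _ _ _ _; rewrite -[RHS]mul1r -XY; ring.
Qed.

Section conjugated_operator.
Context (R : realType) (d : nat).
Local Notation E := 'rV[R]_d.
Local Notation C := R[i].
Implicit Types (a phi f g : E -> R) (u v : E -> C) (x : E) (j : 'I_d).
Local Notation re u := (fun x => complex.Re (u x)).
Local Notation im u := (fun x => complex.Im (u x)).

Lemma sumN_complex (I : Type) (r : seq I) (F G : I -> R) :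
  \sum_(i <- r) (- F i +i* - G i) = - (\sum_(i <- r) F i) +i* - (\sum_(i <- r) G i).
Proof.
elim: r => [|i r IHr]; first by rewrite !big_nil oppr0.
by rewrite !big_cons IHr !opprD.
Qed.

Lemma Dop_complex j u x :
  Dop j u x = partial j (im u) x +i* - partial j (re u) x.
Proof. by rewrite /Dop; simpc. Qed.

Lemma Dop_Dop j (b : E -> R) u x : smooth b -> csmooth u ->
  Dop j (fun y => (b y)%:C * Dop j u y) x =
  - partial j (fun y => b y * partial j (re u) y) x
  +i* - partial j (fun y => b y * partial j (im u) y) x.
Proof.
move=> sb [s1 s2]; rewrite Dop_complex.
have sr := smoothM sb (smooth_partial j s1).
have imE : im (fun y => (b y)%:C * Dop j u y) = fun y => - (b y * partial j (re u) y).
  by apply/funext => y; rewrite Dop_complex; simpc.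
have reE : re (fun y => (b y)%:C * Dop j u y) = fun y => b y * partial j (im u) y.
  by apply/funext => y; rewrite Dop_complex; simpc.
by rewrite imE reE partialN.
Qed.

Lemma Pop_complex a (lam : R) u x : smooth a -> csmooth u ->
  Pop a lam u x =
  (- lap (re u) x + lam * (a x * lap (im u) x + gdot a (im u) x)
     - lam ^+ 2 * complex.Re (u x))
  +i* (- lap (im u) x - lam * (a x * lap (re u) x + gdot a (re u) x)
     - lam ^+ 2 * complex.Im (u x)).
Proof.
move=> sa su; have [s1 s2] := su; rewrite /Pop.
have E1 : \sum_j Dop j (Dop j u) x = - lap (re u) x +i* - lap (im u) x.
  have F j : Dop j (Dop j u) x =
      - partial j (partial j (re u)) x +i* - partial j (partial j (im u)) x.
    have imE : im (Dop j u) = fun y => - partial j (re u) y.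
      by apply/funext => y; rewrite Dop_complex.
    have reE : re (Dop j u) = partial j (im u).
      by apply/funext => y; rewrite Dop_complex.
    have sr := smooth_partial j s1.
    by rewrite Dop_complex imE reE partialN.
  exact: etrans (eq_bigr _ (fun j _ => F j)) (sumN_complex _ _ _).
have E2 : \sum_j Dop j (fun y => (a y)%:C * Dop j u y) x =
    - (a x * lap (re u) x + gdot a (re u) x) +i*
    - (a x * lap (im u) x + gdot a (im u) x).
  apply: etrans (eq_bigr _ (fun j _ => Dop_Dop j x sa su)) _.
  apply: etrans (sumN_complex _ _ _) _.
  exact: (congr2 (fun s t => - s +i* - t) (divergence_scaled_grad x sa s1)
    (divergence_scaled_grad x sa s2)).
rewrite E1 E2; case: (u x) => u1 u2 /=; apply/eqP; rewrite eq_complex.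
by simpc.
Qed.

Lemma lap_conj phi f (t : R) x : smooth phi -> smooth f ->
  lap (fun y => expR (- (t * phi y)) * f y) x = expR (- (t * phi x)) *
    conj_lap (lap phi x) (gdot phi phi x) t (lap f x) (gdot phi f x) (f x) /\
  forall g, smooth g -> gdot g (fun y => expR (- (t * phi y)) * f y) x =
    expR (- (t * phi x)) * (gdot g f x - t * gdot phi g x * f x).
Proof.
move=> sp sf.
have -> : (fun y => expR (- (t * phi y)) * f y) = fun y => expR (- t * phi y) * f y.
  by apply/funext => y; rewrite mulNr.
have sq : smooth (fun y => - t * phi y) by smooth_auto.
have se := smooth_exp sq.
rewrite -mulNr; split=> [|g sg].
  rewrite lapM// lap_exp// gdot_expl// lapZ// !gdotZl// gdotZr// /conj_lap.
  move: (expR _) (lap phi x) (lap f x) (gdot phi f x) (gdot phi phi x) (f x).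
  by move=> *; ring.
rewrite gdotMr// [gdot g (fun y => expR _) x]gdotC gdot_expl// gdotZl//.
move: (expR _) (gdot g f x) (gdot phi g x) (f x).
by move=> *; ring.
Qed.

Lemma Pphi_complex a phi (lam tau : R) v x :
  smooth a -> smooth phi -> csmooth v ->
  Pphi a phi lam tau v x =
  pphi_re (lap phi x) (gdot phi phi x) (a x) (gdot phi a x)
    (complex.Re (v x)) (lap (re v) x) (gdot phi (re v) x)
    (complex.Im (v x)) (lap (im v) x) (gdot phi (im v) x)
    (gdot a (im v) x) lam tau
  +i* pphi_im (lap phi x) (gdot phi phi x) (a x) (gdot phi a x)
    (complex.Re (v x)) (lap (re v) x) (gdot phi (re v) x)
    (complex.Im (v x)) (lap (im v) x) (gdot phi (im v) x)
    (gdot a (re v) x) lam tau.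
Proof.
move=> sa sp [s1 s2]; rewrite /Pphi.
pose e y := expR (- (tau * phi y)).
have se : smooth e by rewrite /e; smooth_auto.
have reE : re (fun y => (e y)%:C * v y) = fun y => e y * complex.Re (v y).
  by apply/funext => y; case: (v y) => ? ?; simpc.
have imE : im (fun y => (e y)%:C * v y) = fun y => e y * complex.Im (v y).
  by apply/funext => y; case: (v y) => ? ?; simpc.
have su : csmooth (fun y => (e y)%:C * v y).
  by split; rewrite ?reE ?imE; exact: smoothM.
have [L1 G1] := lap_conj tau x sp s1; have [L2 G2] := lap_conj tau x sp s2.
rewrite (Pop_complex lam x sa su) reE imE /e L1 L2 G1// G2// -/(e x).
have ee : expR (tau * phi x) * e x = 1 by rewrite /e -expRD subrr expR0.
have -> : complex.Re ((e x)%:C * v x) = e x * complex.Re (v x).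
  exact: (congr1 (fun F => F x) reE).
have -> : complex.Im ((e x)%:C * v x) = e x * complex.Im (v x).
  exact: (congr1 (fun F => F x) imE).
apply/eqP; rewrite eq_complex; simpc => /=.
apply/andP; split; apply/eqP.
  exact: pphi_re_factor.
exact: pphi_im_factor.
Qed.

End conjugated_operator.

(** * Green's identities, as integrands with zero integral *)

Section null_functions.
Context (R : realType) (d : nat).
Local Notation E := 'rV[R]_d.
Implicit Types (f g u w : E -> R) (K : set E).

Lemma compact_closed_rV K : compact K -> closed K.
Proof. by move=> cK; apply: compact_closed cK; exact: norm_hausdorff. Qed.

Lemma bounded_sub_cube K : bounded_set K -> exists M : R, K `<=` cube M.
Proof.
move=> [M [_ KM]]; exists (M + 1) => x Kx i.
have : `|x| <= M + 1 by apply: (KM (M + 1) _ x Kx); rewrite ltrDl.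
apply: le_trans; rewrite /Num.norm /= mx_normrE.
exact: (le_bigmax _ (fun ij : 'I_1 * 'I_d => `|x ij.1 ij.2|) (ord0, i)).
Qed.

Lemma compact_sub_cube K : compact K -> exists M : R, K `<=` cube M.
Proof. by move=> /compact_bounded/bounded_sub_cube. Qed.

Lemma compact_supp_integrable K f : compact K -> continuous f ->
  (forall x, ~ K x -> f x = 0) -> (lebesgue_rV d).-integrable setT (EFin \o f).
Proof.
move=> /compact_sub_cube[M KM] cf f0; apply: (@cube_integrable _ _ M) => // x Mx.
by apply: f0 => /KM.
Qed.

(** Meant for divergences of fields supported in K. Smoothness and support are part of the notion so
    that linear combinations stay integrable. *)
Definition null_on K f := [/\ smooth f, forall x, ~ K x -> f x = 0 &
  (\int[lebesgue_rV d]_x (f x)%:E = 0)%E].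

Lemma null_onD K f g : compact K -> null_on K f -> null_on K g ->
  null_on K (fun x => f x + g x).
Proof.
move=> cK [sf f0 If] [sg g0 Ig]; split; first exact: smoothD.
  by move=> x Kx; rewrite f0// g0// addr0.
have fi := compact_supp_integrable cK (smooth_continuous sf) f0.
have gi := compact_supp_integrable cK (smooth_continuous sg) g0.
under eq_integral do rewrite EFinD.
by rewrite (integralD measurableT fi gi) If Ig adde0.
Qed.

Lemma null_onZ K (c : R) f : compact K -> null_on K f -> null_on K (fun x => c * f x).
Proof.
move=> cK [sf f0 If]; split; first exact: smoothM (smoothC c) sf.
  by move=> x Kx; rewrite f0// mulr0.
have fi := compact_supp_integrable cK (smooth_continuous sf) f0.
under eq_integral do rewrite EFinM.
by rewrite (integralZl measurableT fi) If mule0.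
Qed.

Lemma null_on_partial K f j : compact K -> smooth f ->
  (forall x, ~ K x -> f x = 0) -> null_on K (partial j f).
Proof.
move=> cK sf f0; split; first exact: smooth_partial.
  exact: partial_off_closed (compact_closed_rV cK) f0.
have [M KM] := compact_sub_cube cK.
by apply: (integral_partial_eq0 (M := M)) => // x Mx; apply: f0 => /KM.
Qed.

Lemma null_on_sum K (I : Type) (r : seq I) (F : I -> E -> R) : compact K ->
  (forall i, null_on K (F i)) -> null_on K (fun x => \sum_(i <- r) F i x).
Proof.
move=> cK nF; elim: r => [|i r IHr].
  rewrite (_ : (fun x => _) = fun=> 0); last by apply/funext => x; rewrite big_nil.
  by split=> //; [exact: smoothC|rewrite integral0].
rewrite (_ : (fun x => _) = fun x => F i x + \sum_(i <- r) F i x).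
  exact: null_onD.
by apply/funext => x; rewrite big_cons.
Qed.

Lemma null_on_green K u w : compact K -> smooth u -> smooth w ->
  (forall x, ~ K x -> u x = 0) -> null_on K (fun x => u x * lap w x + gdot u w x).
Proof.
move=> cK su sw u0.
have -> : (fun x => u x * lap w x + gdot u w x) =
    fun x => \sum_j partial j (fun y => u y * partial j w y) x.
  by apply/funext => x; rewrite divergence_scaled_grad.
apply: (null_on_sum _ cK) => j.
apply: (null_on_partial j cK (smoothM su (smooth_partial j sw))).
by move=> x Kx; rewrite u0// mul0r.
Qed.

(** The same divergence of u grad w, when [w] is the factor that vanishes off K: in the adjoint
    identity only one of the two functions is supported there. *)
Lemma null_on_green_r K u w : compact K -> smooth u -> smooth w ->
  (forall x, ~ K x -> w x = 0) -> null_on K (fun x => u x * lap w x + gdot u w x).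
Proof.
move=> cK su sw w0.
have cK' := compact_closed_rV cK.
have -> : (fun x => u x * lap w x + gdot u w x) =
    fun x => \sum_j partial j (fun y => u y * partial j w y) x.
  by apply/funext => x; rewrite divergence_scaled_grad.
apply: (null_on_sum _ cK) => j.
apply: (null_on_partial j cK (smoothM su (smooth_partial j sw))).
by move=> x Kx; rewrite (partial_off_closed j cK' w0 Kx) mulr0.
Qed.

Lemma integral_eq_null K f g n : compact K -> smooth g ->
  (forall x, ~ K x -> g x = 0) -> null_on K n -> (forall x, f x = g x + n x) ->
  (\int[lebesgue_rV d]_x (f x)%:E = \int[lebesgue_rV d]_x (g x)%:E)%E.
Proof.
move=> cK sg g0 [sn n0 In] fE.
have gi := compact_supp_integrable cK (smooth_continuous sg) g0.
have ni := compact_supp_integrable cK (smooth_continuous sn) n0.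
under eq_integral do rewrite fE EFinD.
by rewrite (integralD measurableT gi ni) In adde0.
Qed.

End null_functions.

Section pphi_adjoint.
Context (R : realFieldType).

(** Real part of (P u) conj(v) - u conj(Q v), Q having both parameters negated. The remainder is
    grouped into the integrands of [null_on_conj_lap] and [null_on_damping]. *)
Lemma pphi_adjoint_re (Phi y a da u1 Lu1 su1 u2 Lu2 su2 Du1 Du2
    v1 Lv1 sv1 v2 Lv2 sv2 Dv1 Dv2 l t : R) :
  let U1 := conj_lap Phi y t Lu1 su1 u1 in
  let U2 := conj_lap Phi y t Lu2 su2 u2 in
  let V1 := conj_lap Phi y (- t) Lv1 sv1 v1 in
  let V2 := conj_lap Phi y (- t) Lv2 sv2 v2 in
  pphi_re Phi y a da u1 Lu1 su1 u2 Lu2 su2 Du2 l t * v1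
  - pphi_im Phi y a da u1 Lu1 su1 u2 Lu2 su2 Du1 l t * - v2 =
  u1 * pphi_re Phi y a da v1 Lv1 sv1 v2 Lv2 sv2 Dv2 (- l) (- t)
  - u2 * - pphi_im Phi y a da v1 Lv1 sv1 v2 Lv2 sv2 Dv1 (- l) (- t)
  + (-1 * (v1 * U1 - u1 * V1) + -1 * (v2 * U2 - u2 * V2)
     + (l * (v1 * (a * U2 + Du2 - t * da * u2) - u2 * (a * V1 + Dv1 - - t * da * v1))
        + - l * (v2 * (a * U1 + Du1 - t * da * u1) - u1 * (a * V2 + Dv2 - - t * da * v2)))).
Proof. by rewrite /= /pphi_re /pphi_im; ring. Qed.

Lemma pphi_adjoint_im (Phi y a da u1 Lu1 su1 u2 Lu2 su2 Du1 Du2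
    v1 Lv1 sv1 v2 Lv2 sv2 Dv1 Dv2 l t : R) :
  let U1 := conj_lap Phi y t Lu1 su1 u1 in
  let U2 := conj_lap Phi y t Lu2 su2 u2 in
  let V1 := conj_lap Phi y (- t) Lv1 sv1 v1 in
  let V2 := conj_lap Phi y (- t) Lv2 sv2 v2 in
  pphi_re Phi y a da u1 Lu1 su1 u2 Lu2 su2 Du2 l t * - v2
  + pphi_im Phi y a da u1 Lu1 su1 u2 Lu2 su2 Du1 l t * v1 =
  u1 * - pphi_im Phi y a da v1 Lv1 sv1 v2 Lv2 sv2 Dv1 (- l) (- t)
  + u2 * pphi_re Phi y a da v1 Lv1 sv1 v2 Lv2 sv2 Dv2 (- l) (- t)
  + (-1 * (v1 * U2 - u2 * V1) + 1 * (v2 * U1 - u1 * V2)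
     + (- l * (v1 * (a * U1 + Du1 - t * da * u1) - u1 * (a * V1 + Dv1 - - t * da * v1))
        + - l * (v2 * (a * U2 + Du2 - t * da * u2) - u2 * (a * V2 + Dv2 - - t * da * v2)))).
Proof. by rewrite /= /pphi_re /pphi_im; ring. Qed.

End pphi_adjoint.

Section adjoint.
Context (R : realType) (d : nat).
Local Notation E := 'rV[R]_d.
Local Notation C := R[i].
Implicit Types (a phi f g : E -> R) (u v : E -> C) (K : set E).
Local Notation re u := (fun x => complex.Re (u x)).
Local Notation im u := (fun x => complex.Im (u x)).

Lemma csmooth_Pphi a phi (lam tau : R) v : smooth a -> smooth phi -> csmooth v ->
  csmooth (Pphi a phi lam tau v).
Proof.
move=> sa sp sv; have [s1 s2] := sv; split.
  have -> : re (Pphi a phi lam tau v) = fun x => pphi_re (lap phi x) (gdot phi phi x)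
      (a x) (gdot phi a x) (complex.Re (v x)) (lap (re v) x) (gdot phi (re v) x)
      (complex.Im (v x)) (lap (im v) x) (gdot phi (im v) x) (gdot a (im v) x) lam tau.
    by apply/funext => x; rewrite Pphi_complex.
  by rewrite /pphi_re /conj_lap; smooth_auto.
have -> : im (Pphi a phi lam tau v) = fun x => pphi_im (lap phi x) (gdot phi phi x)
    (a x) (gdot phi a x) (complex.Re (v x)) (lap (re v) x) (gdot phi (re v) x)
    (complex.Im (v x)) (lap (im v) x) (gdot phi (im v) x) (gdot a (re v) x) lam tau.
  by apply/funext => x; rewrite Pphi_complex.
by rewrite /pphi_im /conj_lap; smooth_auto.
Qed.

Lemma lap_off K f : closed K -> (forall x, ~ K x -> f x = 0) ->
  forall x, ~ K x -> lap f x = 0.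
Proof.
move=> cK f0 x Kx; apply: big1 => j _.
exact: partial_off_closed cK (partial_off_closed j cK f0) _ Kx.
Qed.

Lemma gdot_off K f g : closed K -> (forall x, ~ K x -> g x = 0) ->
  forall x, ~ K x -> gdot f g x = 0.
Proof.
move=> cK g0 x Kx; apply: big1 => j _.
by rewrite (partial_off_closed j cK g0 Kx) mulr0.
Qed.

Lemma Pphi_off K a phi (lam tau : R) v : closed K -> smooth a -> smooth phi ->
  csmooth v -> (forall x, ~ K x -> v x = 0) ->
  forall x, ~ K x -> Pphi a phi lam tau v x = 0.
Proof.
move=> cK sa sp sv v0 x Kx; rewrite Pphi_complex//.
have r0 y : ~ K y -> complex.Re (v y) = 0 by move=> /v0 ->.
have i0 y : ~ K y -> complex.Im (v y) = 0 by move=> /v0 ->.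
rewrite !(lap_off cK r0 Kx) !(lap_off cK i0 Kx) !(gdot_off _ cK r0 Kx).
rewrite !(gdot_off _ cK i0 Kx) (r0 _ Kx) (i0 _ Kx) /pphi_re /pphi_im /conj_lap.
by rewrite !(mulr0, addr0, subr0, oppr0).
Qed.

(* Green's identities give: the formal transpose of conj_lap at t is conj_lap
   at - t, and likewise for the damping term. *)
Lemma null_on_conj_lap K phi (t : R) f g : compact K -> smooth phi -> smooth f ->
  smooth g -> (forall x, ~ K x -> g x = 0) ->
  null_on K (fun x =>
    g x * conj_lap (lap phi x) (gdot phi phi x) t (lap f x) (gdot phi f x) (f x)
    - f x * conj_lap (lap phi x) (gdot phi phi x) (- t) (lap g x) (gdot phi g x) (g x)).
Proof.
move=> cK sp sf sg g0.
have sfg := smoothM sf sg.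
have fg0 x : ~ K x -> f x * g x = 0 by move=> /g0 ->; rewrite mulr0.
have n1 := null_on_green cK sg sf g0.
have n2 := null_on_green_r cK sf sg g0.
have n3 := null_on_green cK sfg sp fg0.
have := null_onD cK n1 (null_onD cK (null_onZ (-1) cK n2) (null_onZ (- 2 * t) cK n3)).
congr null_on; apply/funext => x; rewrite gdotMl// (gdotC g) (gdotC f phi) (gdotC g phi).
rewrite /conj_lap.
move: (lap f x) (lap g x) (lap phi x) (gdot phi f x) (gdot phi g x) (gdot phi phi x).
move: (gdot f g x) (f x) (g x) => *; ring.
Qed.

Lemma null_on_damping K phi a (t : R) f g : compact K -> smooth phi -> smooth a ->
  smooth f -> smooth g -> (forall x, ~ K x -> g x = 0) ->
  null_on K (fun x =>
    g x * (a x * conj_lap (lap phi x) (gdot phi phi x) t (lap f x) (gdot phi f x) (f x)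
           + gdot a f x - t * gdot phi a x * f x)
    - f x * (a x * conj_lap (lap phi x) (gdot phi phi x) (- t) (lap g x) (gdot phi g x) (g x)
           + gdot a g x - (- t) * gdot phi a x * g x)).
Proof.
move=> cK sp sa sf sg g0.
have sag := smoothM sa sg; have saf := smoothM sa sf; have sfg := smoothM sf sg.
have safg := smoothM sa sfg.
have ag0 x : ~ K x -> a x * g x = 0 by move=> /g0 ->; rewrite mulr0.
have afg0 x : ~ K x -> a x * (f x * g x) = 0 by move=> /g0 ->; rewrite !mulr0.
have n1 := null_on_green cK sag sf ag0.
have n2 := null_on_green_r cK saf sg g0.
have n3 := null_on_green cK safg sp afg0.
have := null_onD cK n1 (null_onD cK (null_onZ (-1) cK n2) (null_onZ (- 2 * t) cK n3)).
congr null_on; apply/funext => x; rewrite !gdotMl//.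
rewrite (gdotC g f) (gdotC f phi) (gdotC g phi) (gdotC a phi) /conj_lap.
move: (lap f x) (lap g x) (lap phi x) (gdot phi f x) (gdot phi g x) (gdot phi phi x).
move: (gdot f g x) (gdot a f x) (gdot a g x) (gdot phi a x) (f x) (g x) (a x) => *; ring.
Qed.

(** Transposition exchanges the weights exp(tau phi) and exp(- tau phi), whence - tau, and
    conjugation changes the sign of i lam, whence - lam; the term in lam^2 is not affected. *)
Lemma L2dot_Pphi K a phi (lam tau : R) u v : compact K -> smooth a -> smooth phi ->
  csmooth u -> csmooth v -> (forall x, ~ K x -> v x = 0) ->
  L2dot (Pphi a phi lam tau u) v = L2dot u (Pphi a phi (- lam) (- tau) v).
Proof.
move=> cK sa sp su sv v0; have [su1 su2] := su; have [sv1 sv2] := sv.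
have cK' := compact_closed_rV cK.
have r0 y : ~ K y -> complex.Re (v y) = 0 by move=> /v0 ->.
have i0 y : ~ K y -> complex.Im (v y) = 0 by move=> /v0 ->.
have [sq1 sq2] := csmooth_Pphi (- lam) (- tau) sa sp sv.
have q0 := Pphi_off (- lam) (- tau) cK' sa sp sv v0.
have A11 := null_on_conj_lap tau cK sp su1 sv1 r0.
have A22 := null_on_conj_lap tau cK sp su2 sv2 i0.
have A12 := null_on_conj_lap tau cK sp su1 sv2 i0.
have A21 := null_on_conj_lap tau cK sp su2 sv1 r0.
have T11 := null_on_damping tau cK sp sa su1 sv1 r0.
have T22 := null_on_damping tau cK sp sa su2 sv2 i0.
have T12 := null_on_damping tau cK sp sa su1 sv2 i0.
have T21 := null_on_damping tau cK sp sa su2 sv1 r0.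
rewrite /L2dot; congr (_ +i* _); rewrite /Rintegral; congr fine.
- have N := null_onD cK (null_onD cK (null_onZ (-1) cK A11) (null_onZ (-1) cK A22))
    (null_onD cK (null_onZ lam cK T21) (null_onZ (- lam) cK T12)).
  apply: (integral_eq_null cK _ _ N).
  + rewrite (_ : (fun x => _) = fun x =>
      complex.Re (u x) * complex.Re (Pphi a phi (- lam) (- tau) v x)
      + complex.Im (u x) * complex.Im (Pphi a phi (- lam) (- tau) v x)).
      by smooth_auto.
    by apply/funext => x; case: (u x) => ? ?; case: (Pphi _ _ _ _ _ x) => ? ?; simpc.
  + by move=> x Kx; rewrite q0// conjc0 mulr0.
  + move=> x; rewrite !Pphi_complex//.
    case: (u x) => u1 u2; case: (v x) => w1 w2 /=.
    exact: pphi_adjoint_re.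
- have N := null_onD cK (null_onD cK (null_onZ (-1) cK A21) (null_onZ 1 cK A12))
    (null_onD cK (null_onZ (- lam) cK T11) (null_onZ (- lam) cK T22)).
  apply: (integral_eq_null cK _ _ N).
  + rewrite (_ : (fun x => _) = fun x =>
      complex.Im (u x) * complex.Re (Pphi a phi (- lam) (- tau) v x)
      + - (complex.Re (u x) * complex.Im (Pphi a phi (- lam) (- tau) v x))).
      by smooth_auto.
    apply/funext => x; case: (u x) => ? ?; case: (Pphi _ _ _ _ _ x) => ? ? /=.
    by ring.
  + by move=> x Kx; rewrite q0// conjc0 mulr0.
  + move=> x; rewrite !Pphi_complex//.
    case: (u x) => u1 u2; case: (v x) => w1 w2 /=.
    exact: pphi_adjoint_im.
Qed.

End adjoint.

(** * L^2 norms as integrals, and a bound on the formal adjoint *)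

Section L2_norm.
Context (R : realType) (d : nat).
Local Notation E := 'rV[R]_d.
Local Notation C := R[i].
Implicit Types (a phi f g : E -> R) (u v : E -> C) (K V : set E).
Local Notation re u := (fun x => complex.Re (u x)).
Local Notation im u := (fun x => complex.Im (u x)).

Definition sqr_norm (z : C) : R := complex.Re z ^+ 2 + complex.Im z ^+ 2.

Lemma sqr_norm_ge0 z : 0 <= sqr_norm z.
Proof. by rewrite addr_ge0// sqr_ge0. Qed.

Lemma sqr_normc z : ComplexField.Normc.normc z ^+ 2 = sqr_norm z.
Proof. by case: z => x y /=; rewrite sqr_sqrtr// addr_ge0// sqr_ge0. Qed.

Lemma L2norm_sqr V u : (L2norm V u ^+ 2 =
  \int[lebesgue_rV d]_x ((fun x => (sqr_norm (u x))%:E) \_ V) x)%E.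
Proof.
have N0 : (0 <= L2norm V u)%E by exact: Lnorm_ge0.
have -> : (L2norm V u ^+ 2 = L2norm V u `^ 2)%E.
  move: N0; case: (L2norm V u) => [r r0| |]//=.
  - by rewrite -EFinM powR_mulrn.
  - by rewrite mulyy pnatr_eq0.
rewrite /L2norm poweR_Lnorm//; apply: eq_integral => x _.
rewrite !patchE; case: ifP => _ /=; last by rewrite normr0 powR0.
have n0 : 0 <= ComplexField.Normc.normc (u x).
  by case: (u x) => ? ?; exact: sqrtr_ge0.
by rewrite ger0_norm// powR_mulrn// sqr_normc.
Qed.

Local Notation I f := (\int[lebesgue_rV d]_x (f x))%R.

Lemma integral_EFin_Rintegral K f : compact K -> continuous f ->
  (forall x, ~ K x -> f x = 0) ->
  (\int[lebesgue_rV d]_x (f x)%:E = (\int[lebesgue_rV d]_x f x)%R%:E)%E.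
Proof.
move=> cK cf f0; rewrite /Rintegral fineK//.
exact: integrable_fin_num (compact_supp_integrable cK cf f0).
Qed.

Lemma L2norm_sqr_supp K V u f : compact K -> K `<=` V -> smooth f ->
  (forall x, sqr_norm (u x) = f x) -> (forall x, ~ K x -> f x = 0) ->
  (L2norm V u ^+ 2 = (\int[lebesgue_rV d]_x f x)%R%:E)%E.
Proof.
move=> cK KV sf uf f0; rewrite L2norm_sqr.
rewrite -(integral_EFin_Rintegral cK (smooth_continuous sf) f0).
apply: eq_integral => x _; rewrite patchE uf; case: ifPn => // /negP xV.
by rewrite f0// => /KV Vx; apply: xV; rewrite inE.
Qed.

(** An inequality only, as K need not lie in V: it serves [Q1] and [Q2], in which the formal adjoint
    is merely known to have compact support. *)
Lemma L2norm_sqr_le K V u f : compact K -> open V -> smooth f ->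
  (forall x, sqr_norm (u x) = f x) -> (forall x, ~ K x -> f x = 0) ->
  (L2norm V u ^+ 2 <= (\int[lebesgue_rV d]_x f x)%R%:E)%E.
Proof.
move=> cK oV sf uf f0; rewrite L2norm_sqr.
rewrite -(integral_EFin_Rintegral cK (smooth_continuous sf) f0).
have -> : (fun x => (sqr_norm (u x))%:E) = EFin \o f.
  by apply/funext => x /=; rewrite uf.
have mV := open_measurable_rV oV.
rewrite -integral_mkcond; apply: ge0_subset_integral => //.
  exact: measurable_int _ (compact_supp_integrable cK (smooth_continuous sf) f0).
by move=> x _; rewrite lee_fin -uf sqr_norm_ge0.
Qed.

Lemma test_function_supp V u : test_function V u ->
  csmooth u /\ exists K, [/\ compact K, K `<=` V & forall x, ~ K x -> u x = 0].
Proof.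
move=> [su [cK KV]]; split => //; exists (closure [set x | u x != 0]); split => // x Kx.
by apply/eqP; apply: contra_notT Kx => ux; exact: subset_closure.
Qed.

Lemma test_functionT K u : compact K -> csmooth u -> (forall x, ~ K x -> u x = 0) ->
  test_function setT u.
Proof.
move=> cK su u0; split => //; split => //.
apply: (subclosed_compact _ cK); first exact: closed_closure.
have cK' := compact_closed_rV cK; move/closure_id : cK' => ->.
by apply: closure_subset => x /= ux; apply: contrapT => /u0 /eqP; exact/negP.
Qed.

(* The adjoint identity tested against g itself gives |g|^2 = (g, q), with q the
   explicit adjoint; this bounds g without identifying it with q. *)
Lemma Rintegral_sqr_adjoint_le K a phi (lam tau : R) v : compact K -> smooth a ->
  smooth phi -> csmooth v -> (forall x, ~ K x -> v x = 0) ->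
  let g := formal_adjoint (Pphi a phi lam tau) v in
  csmooth g /\
  (exists K', compact K' /\ forall x, ~ K' x -> g x = 0) /\
  \int[lebesgue_rV d]_x sqr_norm (g x) <=
    \int[lebesgue_rV d]_x sqr_norm (Pphi a phi (- lam) (- tau) v x).
Proof.
move=> cK sa sp sv v0 g; have cK' := compact_closed_rV cK.
pose q := Pphi a phi (- lam) (- tau) v.
have sq : csmooth q by exact: csmooth_Pphi.
have q0 : forall x, ~ K x -> q x = 0 by exact: Pphi_off.
have adj w : test_function setT w -> L2dot (Pphi a phi lam tau w) v = L2dot w q.
  by move=> [sw _]; exact: (L2dot_Pphi lam tau cK sa sp sw sv v0).
have [tg adjg] : test_function setT g /\ forall w, test_function setT w ->
    L2dot (Pphi a phi lam tau w) v = L2dot w g.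
  (* The default value of [xget] is excluded, since the explicit adjoint [q] satisfies the defining
     property. *)
  rewrite /g /formal_adjoint; case: xgetP => [h -> //|/(_ q) []].
  by split => //; exact: test_functionT cK sq q0.
have [sg [Kg [cKg _ g0]]] := test_function_supp tg.
split => //; split; first by exists Kg.
have [sg1 sg2] := sg; have [sq1 sq2] := sq.
have gq : \int[lebesgue_rV d]_x sqr_norm (g x) =
    \int[lebesgue_rV d]_x (complex.Re (g x) * complex.Re (q x)
      + complex.Im (g x) * complex.Im (q x)).
  have := etrans (esym (adjg g tg)) (adj g tg); rewrite /L2dot => -[+ _].
  have -> : (fun x => complex.Re (g x * ((g x)^*)%C)) = fun x => sqr_norm (g x).
    apply/funext => x; rewrite /sqr_norm; case: (g x) => ? ? /=; ring.
  have -> : (fun x => complex.Re (g x * ((q x)^*)%C)) =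
      fun x => complex.Re (g x) * complex.Re (q x) + complex.Im (g x) * complex.Im (q x).
    apply/funext => x; case: (g x) => ? ?; case: (q x) => ? ? /=; ring.
  by [].
have sgg : smooth (fun x => sqr_norm (g x)) by rewrite /sqr_norm; smooth_auto.
have sqq : smooth (fun x => sqr_norm (q x)) by rewrite /sqr_norm; smooth_auto.
have gg0 x : ~ Kg x -> sqr_norm (g x) = 0.
  by move=> /g0 ->; rewrite /sqr_norm /= expr0n addr0.
have qq0 x : ~ K x -> sqr_norm (q x) = 0.
  by move=> /q0 ->; rewrite /sqr_norm /= expr0n addr0.
have ig := compact_supp_integrable cKg (smooth_continuous sgg) gg0.
have iq := compact_supp_integrable cK (smooth_continuous sqq) qq0.
have sgq : smooth (fun x => complex.Re (g x) * complex.Re (q x)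
    + complex.Im (g x) * complex.Im (q x)) by smooth_auto.
have gq0 x : ~ Kg x -> complex.Re (g x) * complex.Re (q x)
    + complex.Im (g x) * complex.Im (q x) = 0.
  by move=> /g0 ->; rewrite /= !mul0r addr0.
have igq := compact_supp_integrable cKg (smooth_continuous sgq) gq0.
have ihalf : (lebesgue_rV d).-integrable setT
    (EFin \o (fun x => 2^-1 * (sqr_norm (g x) + sqr_norm (q x)))).
  have i1 := integrableZl measurableT (2^-1) (integrableD measurableT ig iq).
  by apply: eq_integrable i1 => // x _ /=; rewrite -EFinD -EFinM.
have : \int[lebesgue_rV d]_x sqr_norm (g x) <=
    2^-1 * (\int[lebesgue_rV d]_x sqr_norm (g x) + \int[lebesgue_rV d]_x sqr_norm (q x)).
  rewrite {1}gq -RintegralD// -RintegralZl//; last first.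
    by apply: eq_integrable (integrableD measurableT ig iq) => // x _ /=; rewrite -EFinD.
  apply: le_Rintegral => // x _; rewrite /sqr_norm.
  move: (complex.Re (g x)) (complex.Re (q x)) (complex.Im (g x)) (complex.Im (q x)).
  move=> s t s' t'; have := sqr_ge0 (s - t); have := sqr_ge0 (s' - t').
  by clear; lra.
rewrite -/q; move: (Rintegral _ _ (fun x => sqr_norm (g x))).
by move: (Rintegral _ _ (fun x => sqr_norm (q x))); clear => s t; lra.
Qed.

End L2_norm.

(** * Sub-ellipticity *)

Section poisson_bracket.
Context (R : realType) (d : nat).
Local Notation E := 'rV[R]_d.
Implicit Types (phi f : E -> R) (x xi : E) (j k : 'I_d).

Lemma is_derive_coord j k x :
  is_derive x (delta_mx 0 j : E) (fun y : E => y 0 k) ((k == j)%:R).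
Proof.
have cv : (fun h : R => h^-1 *: (((fun y : E => y 0 k) \o shift x) (h *: (delta_mx 0 j : E))
    - x 0 k)) @ 0^' --> ((k == j)%:R : R).
  apply: (@cvg_trans _ ((fun _ : R => ((k == j)%:R : R)) @ 0^')); last exact: cvg_cst.
  apply: near_eq_cvg; near=> h.
  have h0 : h != 0 by near: h; exact: nbhs_dnbhs_neq.
  by rewrite /= !mxE eqxx /= addrK [_ *: _]mulrA mulVf// mul1r.
apply: DeriveDef; first by apply/cvg_ex; exists ((k == j)%:R : R).
exact: cvg_lim cv.
Unshelve. all: by end_near. Qed.

Lemma smooth_coord k : smooth (fun y : E => y 0 k).
Proof.
have cc : continuous (fun y : E => y 0 k) by exact: coord_continuous.
(* [foldr] differentiates first in the direction listed last. *)
move=> s; case/lastP: s => [|s j].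
  by split => // j x; case: (is_derive_coord j k x).
rewrite foldr_rcons (_ : partial j _ = fun=> (k == j)%:R); first exact: smoothC.
by apply/funext => x; case: (is_derive_coord j k x).
Qed.

Lemma partial_coord j k x : partial j (fun y : E => y 0 k) x = (k == j)%:R.
Proof. by case: (is_derive_coord j k x). Qed.

Lemma enorm_sqr x : enorm x ^+ 2 = dotp x x.
Proof.
by rewrite sqr_sqrtr//; apply: sumr_ge0 => j _; rewrite -expr2 sqr_ge0.
Qed.

Lemma dotp_grad phi x : dotp (grad phi x) (grad phi x) = gdot phi phi x.
Proof. by apply: eq_bigr => j _; rewrite !mxE. Qed.

Lemma poisson_q2_q1 phi (tau : R) x xi : smooth phi ->
  poisson (q2 phi tau) (q1 phi tau) x xi =
  4 * tau * (hess phi (fun j => xi 0 j) (fun j => xi 0 j) x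
    + tau ^+ 2 * hess phi (fun j => partial j phi x) (fun j => partial j phi x) x).
Proof.
move=> sp.
have a1 j : partial j (q2 phi tau x) xi = 2 * xi 0 j.
  have -> : q2 phi tau x = fun z => \sum_k z 0 k * z 0 k
      + - (tau ^+ 2 * enorm (grad phi x) ^+ 2).
    by apply/funext => z; rewrite /q2 enorm_sqr.
  have sk k := smoothM (smooth_coord k) (smooth_coord k).
  rewrite (partialD j xi (smooth_sum (index_enum _) sk) (smoothC _)) partialC addr0.
  rewrite (partial_sum j (index_enum _) xi sk) (bigD1 j)//= big1 ?addr0.
    rewrite (partialM j xi (smooth_coord j) (smooth_coord j)) partial_coord eqxx.
    by rewrite mul1r mulr1 mulr_natl mulr2n.
  move=> k kj; rewrite (partialM j xi (smooth_coord k) (smooth_coord k)).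
  by rewrite partial_coord (negbTE kj) mul0r mulr0 addr0.
have a2 j : partial j (q1 phi tau x) xi = 2 * tau * partial j phi x.
  have -> : q1 phi tau x = fun z => 2 * tau * \sum_k z 0 k * partial k phi x.
    apply/funext => z; rewrite /q1 /dotp; congr (_ * _).
    by apply: eq_bigr => k _; rewrite mxE.
  have sk k := smoothM (smooth_coord k) (smoothC (d := d) (partial k phi x)).
  rewrite (partialM j xi (smoothC _) (smooth_sum (index_enum _) sk)) partialC mul0r add0r.
  congr (_ * _); rewrite (partial_sum j (index_enum _) xi sk) (bigD1 j)//= big1 ?addr0.
    rewrite (partialM j xi (smooth_coord j) (smoothC _)) partial_coord eqxx partialC.
    by rewrite mul1r mulr0 addr0.
  move=> k kj; rewrite (partialM j xi (smooth_coord k) (smoothC _)).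
  by rewrite partial_coord (negbTE kj) mul0r partialC mulr0 addr0.
have a3 j : partial j ((q1 phi tau)^~ xi) x =
    2 * tau * \sum_k xi 0 k * partial j (partial k phi) x.
  have -> : (q1 phi tau)^~ xi = fun z => 2 * tau * \sum_k xi 0 k * partial k phi z.
    apply/funext => z; rewrite /q1 /dotp; congr (_ * _).
    by apply: eq_bigr => k _; rewrite mxE.
  have sk k := smoothM (smoothC (d := d) (xi 0 k)) (smooth_partial k sp).
  rewrite (partialM j x (smoothC _) (smooth_sum (index_enum _) sk)) partialC mul0r add0r.
  congr (_ * _); rewrite (partial_sum j (index_enum _) x sk).
  apply: eq_bigr => k _; rewrite (partialM j x (smoothC _) (smooth_partial k sp)).
  by rewrite partialC mul0r add0r.
have a4 j : partial j ((q2 phi tau)^~ xi) x =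
    - (2 * tau ^+ 2) * \sum_k partial k phi x * partial j (partial k phi) x.
  have -> : (q2 phi tau)^~ xi = fun z => enorm xi ^+ 2
      + - tau ^+ 2 * \sum_k partial k phi z * partial k phi z.
    by apply/funext => z; rewrite /q2 (enorm_sqr (grad _ _)) dotp_grad mulNr.
  have sk k := smoothM (smooth_partial k sp) (smooth_partial k sp).
  have ss := smooth_sum (index_enum _) sk.
  rewrite (partialD j x (smoothC _) (smoothM (smoothC _) ss)) partialC add0r.
  rewrite (partialM j x (smoothC _) ss) partialC mul0r add0r.
  rewrite (partial_sum j (index_enum _) x sk) !mulr_sumr; apply: eq_bigr => k _.
  rewrite (partialM j x (smooth_partial k sp) (smooth_partial k sp)).
  move: (partial k phi x) (partial j (partial k phi) x) => s t; ring.
rewrite /poisson /hess mulrDr !mulr_sumr -big_split; apply: eq_bigr => j _ /=.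
rewrite a1 a2 a3 a4.
have r (c : R) (F G : 'I_d -> R) : \sum_k c * F k * G k = c * \sum_k F k * G k.
  by rewrite mulr_sumr; apply: eq_bigr => k _; rewrite mulrA.
rewrite (r (xi 0 j)) (r (partial j phi x)).
move: (\sum_k _) (\sum_k _) (xi 0 j) (partial j phi x) => S1 S2 s t; ring.
Qed.

End poisson_bracket.

Section quadratic_form.
Context (R : realType) (d : nat).
Local Notation E := 'rV[R]_d.
Implicit Types (phi f : E -> R) (x xi : E) (j k : 'I_d) (p q : 'I_d -> R).
Local Notation "'grad_ f x" := (fun j => partial j f x)
  (at level 10, f at level 8, x at level 8).

(** Sub-ellipticity on the characteristic set: q1 vanishes for p orthogonal to grad phi, and q2
    vanishes for tau = |p| / |grad phi|. *)
Lemma subelliptic_orthogonal (V : set E) phi : smooth phi -> subelliptic V phi ->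
  exists2 c : R, 0 < c & forall x p, closure V x -> \sum_j p j * partial j phi x = 0 ->
    (c - 4 * hess phi ('grad_ phi x) ('grad_ phi x) x) * (\sum_j p j ^+ 2)
      <= 4 * hess phi p p x * gdot phi phi x.
Proof.
move=> sp [gpos [c c0 H]]; exists c => // x p Vx pe.
set N := \sum_j _; set y := gdot _ _ _; set he := hess _ _ _ _.
have y0 : 0 < y by rewrite /y -dotp_grad -enorm_sqr exprn_gt0// gpos.
have N0 : 0 <= N by apply: sumr_ge0 => j _; rewrite sqr_ge0.
have := hess_sqr_le phi p p x; rewrite -/N.
(* For p = 0 the value of tau would be 0, which is not admissible; then H(p, p) = 0 directly. *)
have [->|Nn0] := eqVneq N 0.
  rewrite !mulr0 => h0; have /eqP := le_anti (introT andP (conj h0 (sqr_ge0 _))).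
  by rewrite sqrf_eq0 => /eqP ->; rewrite mulr0 mul0r.
move=> _; have {N0 Nn0} N0 : 0 < N by rewrite lt_def Nn0.
pose tau : R := Num.sqrt (N / y).
have tau0 : 0 < tau by rewrite sqrtr_gt0 divr_gt0.
have tauE : tau ^+ 2 * y = N.
  by rewrite sqr_sqrtr ?divfK ?gt_eqF// divr_ge0// ltW.
pose xi : E := \row_j p j.
have xiN : enorm xi ^+ 2 = N.
  by rewrite enorm_sqr; apply: eq_bigr => j _; rewrite !mxE expr2.
have q20 : q2 phi tau x xi = 0.
  by rewrite /q2 xiN (enorm_sqr (grad _ _)) dotp_grad -/y tauE subrr.
have q10 : q1 phi tau x xi = 0.
  rewrite /q1 /dotp (eq_bigr (fun j => p j * partial j phi x)) ?pe ?mulr0//.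
  by move=> j _; rewrite !mxE.
have := H x xi tau Vx tau0 q20 q10; rewrite poisson_q2_q1// xiN -/he.
have -> : hess phi (fun j => xi 0 j) (fun j => xi 0 j) x = hess phi p p x.
  by apply: eq_bigr => j _; apply: eq_bigr => k _; rewrite !mxE.
(* Keeping only tau^2 in the power 3/2 leaves c tau^3; after division by tau, multiplication by y
   and tau^2 y = N eliminate tau. *)
have t3 : tau ^+ 3 <= (N + tau ^+ 2) `^ (3 / 2).
  have -> : tau ^+ 3 = (tau ^+ 2) `^ (3 / 2).
    rewrite -!powR_mulrn ?(ltW tau0)// -powRrM; congr (_ `^ _).
    by rewrite mulrC divfK.
  apply: ge0_ler_powR; rewrite ?nnegrE ?divr_ge0// ?addr_ge0 ?sqr_ge0 ?(ltW N0)//.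
  by rewrite lerDr ltW.
have ct := ler_wpM2l (ltW c0) t3.
move=> /(le_trans ct).
rewrite (_ : c * tau ^+ 3 = tau * (c * tau ^+ 2)); last by ring.
rewrite (_ : 4 * tau * _ = tau * (4 * (hess phi p p x + tau ^+ 2 * he))); last by ring.
rewrite ler_pM2l// => /(ler_wpM2r (ltW y0)).
move: (hess phi p p x) tauE; clear => h tauE.
have -> : c * tau ^+ 2 * y = c * N by rewrite -mulrA tauE.
have -> : 4 * (h + tau ^+ 2 * he) * y = 4 * h * y + 4 * he * (tau ^+ 2 * y) by ring.
by rewrite tauE mulrBl lerBlDr.
Qed.

Lemma hess_line f p q (t : R) x :
  hess f (fun j => p j + t * q j) (fun j => p j + t * q j) x =
  hess f p p x + t * (hess f p q x + hess f q p x) + t ^+ 2 * hess f q q x.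
Proof.
rewrite (hessDl f p) (hessDr f p p) (hessDr f _ p) !hessZl !hessZr.
move: (hess f p p x) (hess f p q x) (hess f q p x) (hess f q q x) => *; ring.
Qed.

Lemma quadratic_form_bound phi x (c B Y k0 eps rho M : R) :
  0 < c -> 1 <= B -> 1 <= Y -> 0 < k0 -> 0 < eps -> smooth phi ->
  hess_norm2 phi x <= B ^+ 2 -> k0 <= gdot phi phi x -> gdot phi phi x <= Y ->
  (forall p, \sum_j p j * partial j phi x = 0 ->
    (c - 4 * hess phi ('grad_ phi x) ('grad_ phi x) x) * (\sum_j p j ^+ 2)
      <= 4 * hess phi p p x * gdot phi phi x) ->
  rho * (gdot phi phi x + eps) = c / 2 - 4 * hess phi ('grad_ phi x) ('grad_ phi x) x ->
  (c / 2 + 4 * (B * Y)) * eps <= c / 4 * k0 ->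
  8 * (B * Y) + c + 128 * B ^+ 2 * Y ^+ 2 / c <= M * k0 ^+ 2 ->
  forall p (t : R), c / (8 * Y) * (\sum_j p j ^+ 2 + t ^+ 2) <=
    4 * hess phi p p x + 4 * t ^+ 2 * hess phi ('grad_ phi x) ('grad_ phi x) x
    + M * (\sum_j partial j phi x * p j) ^+ 2
    - rho * (\sum_j p j ^+ 2 - t ^+ 2 * gdot phi phi x).
Proof.
move=> c0 B1 Y1 k00 eps0 sp HB ky yY ort rhoE epsB MB p t.
set y := gdot _ _ _ in ky yY ort rhoE *; set e := fun j => partial j phi x in ort rhoE *.
set he := hess phi e e x in ort rhoE *.
have y0 : 0 < y by exact: lt_le_trans ky.
have yn0 : y != 0 by rewrite gt_eqF.
have eE : \sum_j e j * e j = y by [].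
pose s := \sum_j e j * p j; pose th := s / y.
pose eta j := p j - th * e j.
have eta_e : \sum_j eta j * e j = 0.
  rewrite (eq_bigr (fun j => e j * p j - th * (e j * e j))); last first.
    by move=> j _; rewrite /eta; ring.
  by rewrite sumrB -mulr_sumr eE -/s /th divfK ?subrr.
pose N := \sum_j eta j ^+ 2.
have pE j : p j = eta j + th * e j by rewrite /eta subrK.
have pN : \sum_j p j ^+ 2 = N + th ^+ 2 * y.
  rewrite (eq_bigr (fun j => eta j ^+ 2 + 2 * th * (eta j * e j) + th ^+ 2 * (e j * e j))).
    by rewrite !big_split /= -!mulr_sumr eta_e eE mulr0 addr0.
  by move=> j _; rewrite pE; ring.
have hp : hess phi p p x = hess phi eta eta x
    + th * (hess phi eta e x + hess phi e eta x) + th ^+ 2 * he.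
  have -> : p = fun j => eta j + th * e j by apply/funext => j; rewrite pE.
  exact: hess_line.
have N0 : 0 <= N by apply: sumr_ge0 => j _; rewrite sqr_ge0.
have e2 : \sum_j e j ^+ 2 = y by rewrite -eE; apply: eq_bigr => j _; rewrite expr2.
have B0 : 0 < B by exact: lt_le_trans B1.
have Y0 : 0 < Y by exact: lt_le_trans Y1.
have heB : `|he| <= B * Y.
  have BY0 : 0 <= B * Y by rewrite mulr_ge0 ?(ltW B0) ?(ltW Y0).
  rewrite -ler_sqr ?nnegrE// real_normK ?num_real//.
  rewrite (le_trans (hess_sqr_le phi e e x))// e2 exprMn.
  apply: ler_pM => //.
  - by apply: sumr_ge0 => j _; apply: sumr_ge0 => k _; rewrite -expr2 sqr_ge0.
  - by rewrite mulr_ge0 ?(ltW y0).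
  by rewrite [leRHS]expr2 ler_pM ?(ltW y0).
have h1B : (hess phi eta e x + hess phi e eta x) ^+ 2 <= 4 * B ^+ 2 * (N * y).
  have Ny0 : 0 <= N * y by rewrite mulr_ge0 ?(ltW y0).
  have b1 := hess_sqr_le phi eta e x; have b2 := hess_sqr_le phi e eta x.
  rewrite e2 -/N in b1; rewrite e2 -/N (mulrC y) in b2.
  have b3 := ler_wpM2r Ny0 HB.
  move: b1 b2 b3; move: (hess phi eta e x) (hess phi e eta x) (hess_norm2 phi x) (N * y).
  move=> h1 h2 hh z b1 b2 b3; have := sqr_ge0 (h1 - h2); move: b1 b2 b3; clear.
  by move: (B ^+ 2) => B2; lra.
have := quadratic_form_lower_bound th t c0 k00 ky yY Y1 B1 N0 heB h1B
  (ort eta eta_e) eps0 rhoE epsB MB.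
by rewrite -pN -hp /th divfK.
Qed.

End quadratic_form.

(** * The Carleman estimate *)

Section carleman_divergences.
Context (R : realType) (d : nat).
Local Notation E := 'rV[R]_d.
Implicit Types (phi W G rho w : E -> R) (K : set E) (x : E).
Local Notation "'grad_ f x" := (fun j => partial j f x)
  (at level 10, f at level 8, x at level 8).

(** The Hessian of w occurs in - 4 div((grad phi . grad w) grad w) and in 2 div(|grad w|^2 grad phi)
    with opposite signs, so that only the Hessian of phi survives. The other two fields are lap phi
    w grad w and W w^2 grad phi. *)
Lemma null_on_commutator K phi W w : compact K -> smooth phi -> smooth W ->
  smooth w -> (forall x, ~ K x -> w x = 0) ->
  null_on K (fun x => div_commutator (lap phi x) (W x) (gdot W phi x)
    (gdot phi w x) (hess phi ('grad_ w x) ('grad_ w x) x) (gdot w w x) (lap w x)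
    (w x) (gdot (lap phi) w x)).
Proof.
move=> cK sp sW sw w0; have cK' := compact_closed_rV cK.
have [spw sww sl] := And3 (smooth_gdot sp sw) (smooth_gdot sw sw) (smooth_lap sp).
have sw2 := smoothM sw sw; have slw := smoothM sl sw; have sWw := smoothM sW sw2.
have n1 := null_on_green cK spw sw (gdot_off phi cK' w0).
have n2 := null_on_green cK sww sp (gdot_off w cK' w0).
have lw0 x : ~ K x -> lap phi x * w x = 0 by move=> /w0 ->; rewrite mulr0.
have n3 := null_on_green cK slw sw lw0.
have Ww0 x : ~ K x -> W x * (w x * w x) = 0 by move=> /w0 ->; rewrite !mulr0.
have n4 := null_on_green cK sWw sp Ww0.
have := null_onD cK (null_onD cK (null_onZ (-4) cK n1) (null_onZ 2 cK n2))
  (null_onD cK (null_onZ (-2) cK n3) (null_onZ (-2) cK n4)).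
congr null_on; apply/funext => x.
rewrite !gdot_gdotl// !gdotMl// (hessC ('grad_ w x) ('grad_ phi x) x sw) (gdotC w phi).
rewrite /div_commutator.
move: (hess phi _ _ x) (hess w _ _ x) (gdot phi w x) (gdot w w x) (gdot W phi x).
move: (lap phi x) (gdot (lap phi) w x) (lap w x) (W x) (w x) => *; ring.
Qed.

Lemma null_on_multiplier K rho w : compact K -> smooth rho -> smooth w ->
  (forall x, ~ K x -> w x = 0) ->
  null_on K (fun x =>
    div_multiplier (rho x) (gdot w w x) (lap w x) (w x) (gdot rho w x)).
Proof.
move=> cK sr sw w0; have srw := smoothM sr sw.
have rw0 x : ~ K x -> rho x * w x = 0 by move=> /w0 ->; rewrite mulr0.
have := null_on_green cK srw sw rw0; congr null_on; apply/funext => x.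
by rewrite gdotMl.
Qed.

(** The divergence of G (w2 grad w1 - w1 grad w2), in which grad w1 . grad w2 cancels. *)
Lemma null_on_coupling K G w1 w2 : compact K -> smooth G -> smooth w1 ->
  smooth w2 -> (forall x, ~ K x -> w1 x = 0) -> (forall x, ~ K x -> w2 x = 0) ->
  null_on K (fun x => (G x * w2 x * lap w1 x + w2 x * gdot G w1 x)
    - (G x * w1 x * lap w2 x + w1 x * gdot G w2 x)).
Proof.
move=> cK sG s1 s2 w10 w20; have sG1 := smoothM sG s1; have sG2 := smoothM sG s2.
have G10 x : ~ K x -> G x * w1 x = 0 by move=> /w10 ->; rewrite mulr0.
have G20 x : ~ K x -> G x * w2 x = 0 by move=> /w20 ->; rewrite mulr0.
have := null_onD cK (null_on_green cK sG2 s1 G20)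
  (null_onZ (-1) cK (null_on_green cK sG1 s2 G10)).
congr null_on; apply/funext => x; rewrite !gdotMl// (gdotC w1 w2).
move: (lap w1 x) (lap w2 x) (gdot w2 w1 x) (gdot G w1 x) (gdot G w2 x).
move: (G x) (w1 x) (w2 x) => *; ring.
Qed.

End carleman_divergences.

(** * Derivatives of W and G; only these bounds need lam^5 <= kappa^2 tau^4, that is the exponent
    5/4 *)

Section damping_bounds.
Context (R : realFieldType).
Variables (B kappa tau lam a A h : R).
Hypotheses (B1 : 1 <= B) (k0 : 0 <= kappa) (a0 : 0 <= a) (lam0 : 0 <= lam).
Hypotheses (hE : h * (1 + (lam * a) ^+ 2) = 1) (A0 : 0 <= A) (AB : A <= B / 2 * a).
Hypothesis (lam5 : lam ^+ 5 <= kappa ^+ 2 * tau ^+ 4).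

Let n0 : 0 < 1 + (lam * a) ^+ 2.
Proof. by rewrite ltr_wpDr ?sqr_ge0. Qed.

Let h0 : 0 <= h.
Proof. by rewrite -(pmulr_lge0 _ n0) hE. Qed.

Let h1 : h <= 1.
Proof. by rewrite -hE ler_peMr// lerDl sqr_ge0. Qed.

Let bh0 : 0 <= lam * a * h.
Proof. by rewrite !mulr_ge0. Qed.

Let bh1 : lam * a * h <= 1.
Proof.
rewrite mulrC -hE ler_wpM2l//; have := sqr_ge0 (lam * a - 1 / 2).
by move: (lam * a) => b; lra.
Qed.

Let B0 : 0 <= B. Proof. exact: le_trans B1. Qed.

Let hb : lam ^+ 2 * (a * a) * h = 1 - h.
Proof. by rewrite -hE; ring. Qed.

Let h2 : (2 * h - 1) ^+ 2 <= 1.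
Proof.
have h1' : 0 <= 1 - h by rewrite subr_ge0.
by have := mulr_ge0 h0 h1'; lra.
Qed.

(** With h = 1 / nu^2 and g = grad a . grad w, the left-hand side is the square of grad G . grad w.
    By lam^2 a^2 h = 1 - h, grad G = lam^3 h (2 h - 1) grad a, and |grad a|^2 <= B a / 2 gives |grad
    G|^2 <= (B / 2) lam^5 (lam a h) h, where lam a h <= 1. *)
Lemma damping_gradient_bound (g P : R) : 0 <= P -> g ^+ 2 <= A * P ->
  (lam ^+ 2 * (lam * (a * (- (h * h) * (lam ^+ 2 * (a * g + a * g))) + h * g))) ^+ 2
    <= B ^+ 2 * kappa ^+ 2 * tau ^+ 4 * P.
Proof.
move=> P0 gA.
have -> : lam ^+ 2 * (lam * (a * (- (h * h) * (lam ^+ 2 * (a * g + a * g))) + h * g)) =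
    lam ^+ 3 * h * (1 - 2 * (lam ^+ 2 * (a * a) * h)) * g by ring.
rewrite hb (_ : 1 - 2 * (1 - h) = 2 * h - 1); last by ring.
have g1 : (2 * h - 1) ^+ 2 * g ^+ 2 <= B / 2 * a * P.
  apply: le_trans (ler_piMl (sqr_ge0 g) h2) _.
  by apply: le_trans gA _; rewrite ler_wpM2r.
have l6 : 0 <= lam ^+ 6 * h ^+ 2 by rewrite mulr_ge0 ?exprn_ge0.
have := ler_wpM2l l6 g1.
have -> : lam ^+ 6 * h ^+ 2 * (B / 2 * a * P) = lam ^+ 5 * (lam * a * h * h) * (B / 2 * P).
  by ring.
have -> : lam ^+ 6 * h ^+ 2 * ((2 * h - 1) ^+ 2 * g ^+ 2) =
    (lam ^+ 3 * h * (2 * h - 1) * g) ^+ 2 by ring.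
move=> /le_trans; apply.
have l5 : lam ^+ 5 * (lam * a * h * h) <= kappa ^+ 2 * tau ^+ 4.
  apply: le_trans lam5; rewrite ler_piMr ?exprn_ge0// mulr_ile1//.
have BP0 : 0 <= B / 2 * P by rewrite !mulr_ge0 ?invr_ge0.
apply: le_trans (ler_wpM2r BP0 l5) _.
have kt0 : 0 <= kappa ^+ 2 * tau ^+ 4 * P.
  have t4 : 0 <= tau ^+ 4 by exact: exprn_even_ge0.
  exact: mulr_ge0 (mulr_ge0 (sqr_ge0 _) t4) P0.
have BB : B / 2 <= B ^+ 2 by move: (B) B1 => b b1; nra.
have := ler_wpM2l kt0 BB; congr (_ <= _); ring.
Qed.

(** Here g = grad a . grad phi and the expression is the derivative of lam^2 h along grad phi. Its
    square is at most B^2 lam^5 (lam a h)^3 h. *)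
Lemma damping_weight_bound (g Y : R) : g ^+ 2 <= Y * A -> Y <= B / 2 ->
  `|lam ^+ 2 * (- (h * h) * (lam ^+ 2 * (a * g + a * g)))| <= B * kappa * tau ^+ 2.
Proof.
move=> gA YB.
have kt0 : 0 <= B * kappa * tau ^+ 2 by rewrite mulr_ge0 ?sqr_ge0// mulr_ge0.
rewrite -ler_sqr ?nnegrE// real_normK ?num_real//.
have -> : (lam ^+ 2 * (- (h * h) * (lam ^+ 2 * (a * g + a * g)))) ^+ 2 =
    4 * lam ^+ 8 * a ^+ 2 * h ^+ 4 * g ^+ 2 by ring.
have c0 : 0 <= 4 * lam ^+ 8 * a ^+ 2 * h ^+ 4 by rewrite !mulr_ge0 ?exprn_ge0.
have g1 : g ^+ 2 <= B / 2 * (B / 2 * a).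
  apply: le_trans gA _; apply: le_trans (ler_wpM2r A0 YB) _.
  by rewrite ler_wpM2l ?divr_ge0.
apply: le_trans (ler_wpM2l c0 g1) _.
have -> : 4 * lam ^+ 8 * a ^+ 2 * h ^+ 4 * (B / 2 * (B / 2 * a)) =
    B ^+ 2 * (lam ^+ 5 * (lam * a * h * (lam * a * h) * (lam * a * h) * h)).
  by field.
have -> : (B * kappa * tau ^+ 2) ^+ 2 = B ^+ 2 * (kappa ^+ 2 * tau ^+ 4) by ring.
rewrite ler_wpM2l ?sqr_ge0//; apply: le_trans lam5.
have bb : 0 <= lam * a * h * (lam * a * h) by rewrite mulr_ge0.
have b3 : 0 <= lam * a * h * (lam * a * h) * (lam * a * h) by rewrite mulr_ge0.
rewrite ler_piMr ?exprn_ge0//; apply: mulr_ile1 => //.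
by apply: mulr_ile1 => //; exact: mulr_ile1.
Qed.

End damping_bounds.

Section carleman_estimate.
Context (R : realType) (d : nat).
Local Notation E := 'rV[R]_d.
Local Notation C := R[i].
Implicit Types (a phi rho f g : E -> R) (v : E -> C) (K : set E) (x : E).
Local Notation re u := (fun x => complex.Re (u x)).
Local Notation im u := (fun x => complex.Im (u x)).
Local Notation "'grad_ f x" := (fun j => partial j f x)
  (at level 10, f at level 8, x at level 8).

Definition inv_sqr_nu a (lam : R) x : R := (1 + lam ^+ 2 * (a x * a x))^-1.

(* Real and imaginary parts of w = (1 + i lam a) v, for v = f + i g. *)
Definition damped_re a (lam : R) f g x : R := f x + - lam * (a x * g x).

Definition damped_im a (lam : R) f g x : R := g x + lam * (a x * f x).

Definition carleman_weight a phi (lam tau : R) x : R :=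
  tau ^+ 2 * gdot phi phi x + lam ^+ 2 * inv_sqr_nu a lam x.

Definition damping_coupling a (lam : R) x : R :=
  lam ^+ 2 * (lam * a x * inv_sqr_nu a lam x).

Lemma smooth_inv_sqr_nu a (lam : R) : smooth a -> smooth (inv_sqr_nu a lam).
Proof.
move=> sa; apply: smoothV => [x|].
  by rewrite gt_eqF// ltr_wpDr// mulr_ge0 ?sqr_ge0// -expr2 sqr_ge0.
by smooth_auto.
Qed.

Lemma gdot_inv_sqr_nu a (lam : R) f x : smooth a ->
  gdot (inv_sqr_nu a lam) f x = - (inv_sqr_nu a lam x * inv_sqr_nu a lam x)
    * (lam ^+ 2 * (a x * gdot a f x + a x * gdot a f x)).
Proof.
move=> sa; have saa := smoothM sa sa.
have slaa := smoothM (smoothC (lam ^+ 2)) saa.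
have n0 (y : E) : 1 + lam ^+ 2 * (a y * a y) != 0.
  by rewrite gt_eqF// ltr_wpDr// mulr_ge0 ?sqr_ge0// -expr2 sqr_ge0.
rewrite (gdotVl f x n0 (smoothD (smoothC 1) slaa)).
rewrite (gdotDl _ _ (smoothC 1) slaa) (gdotZl _ _ _ saa) (gdotMl _ _ sa sa).
rewrite [gdot (fun=> 1) f x]big1 ?add0r// => j _.
by rewrite partialC mul0r.
Qed.

(** One coordinate of b grad v = grad w - v grad b. The slack of the inequality is exactly the
    square of the modulus of b grad v + 2 v grad b. *)
Lemma sqr_damped_le (lam a v1 v2 pa p1 p2 : R) :
  (1 + (lam * a) ^+ 2) * (p1 * p1 + p2 * p2) <=
    2 * ((p1 + - lam * (pa * v2 + a * p2)) * (p1 + - lam * (pa * v2 + a * p2))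
         + (p2 + lam * (pa * v1 + a * p1)) * (p2 + lam * (pa * v1 + a * p1)))
    + 2 * (lam ^+ 2 * (pa * pa)) * (v1 ^+ 2 + v2 ^+ 2).
Proof.
rewrite -subr_ge0; set r := (X in 0 <= X).
have -> : r = (p1 - lam * (a * p2 + 2 * pa * v2)) ^+ 2
    + (p2 + lam * (a * p1 + 2 * pa * v1)) ^+ 2 by rewrite /r; ring.
by rewrite addr_ge0 ?sqr_ge0.
Qed.

Lemma gdot_damped_le a (lam : R) f g x : smooth a -> smooth f -> smooth g ->
  (1 + (lam * a x) ^+ 2) * (gdot f f x + gdot g g x) <=
    2 * (gdot (damped_re a lam f g) (damped_re a lam f g) x
         + gdot (damped_im a lam f g) (damped_im a lam f g) x)
    + 2 * (lam ^+ 2 * gdot a a x) * (f x ^+ 2 + g x ^+ 2).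
Proof.
move=> sa sf sg; have [saf sag] := (smoothM sa sf, smoothM sa sg).
have pr j : partial j (damped_re a lam f g) x = partial j f x
    + - lam * (partial j a x * g x + a x * partial j g x).
  rewrite (partialD j x sf (smoothM (smoothC (- lam)) sag)).
  rewrite (partialM j x (smoothC (- lam)) sag) partialC mul0r add0r.
  by rewrite (partialM j x sa sg).
have pi j : partial j (damped_im a lam f g) x = partial j g x
    + lam * (partial j a x * f x + a x * partial j f x).
  rewrite (partialD j x sg (smoothM (smoothC lam) saf)).
  rewrite (partialM j x (smoothC lam) saf) partialC mul0r add0r.
  by rewrite (partialM j x sa sf).
rewrite /gdot -!big_split !mulr_sumr mulr_suml -big_split.
apply: ler_sum => j _ /=; rewrite pr pi.
exact: sqr_damped_le.
Qed.

(** The total divergence carried along by the pointwise estimate. *)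
Definition carleman_null a phi rho (lam tau : R) f g x : R :=
  let W := carleman_weight a phi lam tau in
  let G := damping_coupling a lam in
  let w1 := damped_re a lam f g in
  let w2 := damped_im a lam f g in
  let commutator w := div_commutator (lap phi x) (W x) (gdot W phi x)
    (gdot phi w x) (hess phi ('grad_ w x) ('grad_ w x) x) (gdot w w x) (lap w x)
    (w x) (gdot (lap phi) w x) in
  let multiplier w :=
    div_multiplier (rho x) (gdot w w x) (lap w x) (w x) (gdot rho w x) in
  tau * (commutator w1 + commutator w2)
  + 2 * ((G x * w2 x * lap w1 x + w2 x * gdot G w1 x)
         - (G x * w1 x * lap w2 x + w1 x * gdot G w2 x))
  + tau * (multiplier w1 + multiplier w2).

Lemma null_on_carleman K a phi rho (lam tau : R) f g : compact K ->
  smooth a -> smooth phi -> smooth rho -> smooth f -> smooth g ->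
  (forall x, ~ K x -> f x = 0) -> (forall x, ~ K x -> g x = 0) ->
  null_on K (carleman_null a phi rho lam tau f g).
Proof.
move=> cK sa sp sr sf sg f0 g0.
have sh := smooth_inv_sqr_nu lam sa.
have sW : smooth (carleman_weight a phi lam tau).
  by rewrite /carleman_weight; smooth_auto.
have sG : smooth (damping_coupling a lam) by rewrite /damping_coupling; smooth_auto.
have s1 : smooth (damped_re a lam f g) by rewrite /damped_re; smooth_auto.
have s2 : smooth (damped_im a lam f g) by rewrite /damped_im; smooth_auto.
have w10 x : ~ K x -> damped_re a lam f g x = 0.
  by move=> Kx; rewrite /damped_re f0// g0// !mulr0 addr0.
have w20 x : ~ K x -> damped_im a lam f g x = 0.
  by move=> Kx; rewrite /damped_im f0// g0// !mulr0 addr0.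
have n1 := null_onD cK (null_on_commutator cK sp sW s1 w10)
  (null_on_commutator cK sp sW s2 w20).
have n2 := null_on_coupling cK sG s1 s2 w10 w20.
have n3 := null_onD cK (null_on_multiplier cK sr s1 w10)
  (null_on_multiplier cK sr s2 w20).
exact: null_onD cK (null_onD cK (null_onZ tau cK n1) (null_onZ 2 cK n2))
  (null_onZ tau cK n3).
Qed.

Lemma carleman_at a phi rho v (B kappa tau c1 M lam : R) x :
  let m := 16 / c1 + 6 in
  smooth a -> smooth phi -> csmooth v ->
  1 <= B -> 0 < kappa -> kappa <= 1 -> 0 < c1 ->
  150 * B ^+ 3 * kappa <= c1 -> 170 * B ^+ 3 * kappa <= 1 ->
  1 <= kappa * tau -> 0 <= lam -> lam <= kappa * tau ->
  lam ^+ 5 <= kappa ^+ 2 * tau ^+ 4 ->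
  0 <= a x -> gdot a a x <= B / 2 * a x -> `|lap a x| <= B ->
  `|lap phi x| <= B -> gdot (lap phi) (lap phi) x <= B ^+ 2 ->
  gdot phi phi x <= B / 2 -> `|rho x| <= B -> gdot rho rho x <= B ^+ 2 ->
  0 <= M <= B ->
  (forall p (t : R), c1 * (\sum_j p j ^+ 2 + t ^+ 2) <=
    4 * hess phi p p x + 4 * t ^+ 2 * hess phi ('grad_ phi x) ('grad_ phi x) x
    + M * (\sum_j partial j phi x * p j) ^+ 2
    - rho x * (\sum_j p j ^+ 2 - t ^+ 2 * gdot phi phi x)) ->
  tau ^+ 3 * ((1 + (lam * a x) ^+ 2) * sqr_norm (v x))
  + tau * ((1 + (lam * a x) ^+ 2) * (gdot (re v) (re v) x + gdot (im v) (im v) x))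
  + sqr_norm (Pphi a phi lam tau v x) / 2
  + sqr_norm (Pphi a phi (- lam) (- tau) v x) / 2
  + m * carleman_null a phi rho lam tau (re v) (im v) x
  <= (2 * m + 1) * sqr_norm (Pphi a phi lam tau v x).
Proof.
move=> m sa sp sv B1 k0 k1 c10 kc kB kt l0 lk l5 a0 aB LaB LpB gpB yB rB grB MB QF.
have [s1 s2] := sv; have sh := smooth_inv_sqr_nu lam sa.
have B0 : 0 <= B by exact: le_trans B1.
have hE : inv_sqr_nu a lam x * (1 + (lam * a x) ^+ 2) = 1.
  rewrite exprMn (expr2 (a x)) mulVf// gt_eqF// ltr_wpDr// mulr_ge0 ?sqr_ge0//.
set w1 := damped_re a lam (re v) (im v); set w2 := damped_im a lam (re v) (im v).
have [sa1 sa2] := (smoothM sa s1, smoothM sa s2).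
have [sb1 sb2] := (smoothM (smoothC lam) sa1, smoothM (smoothC (- lam)) sa2).
have sw1 : smooth w1 by exact: smoothD s1 sb2.
have sw2 : smooth w2 by exact: smoothD s2 sb1.
have L1 : lap w1 x = lap (re v) x - lam * (a x * lap (im v) x + 2 * gdot a (im v) x
    + lap a x * complex.Im (v x)).
  apply: etrans (lapD x s1 sb2) _; congr (_ + _).
  apply: etrans (lapZ _ x sa2) _; rewrite mulNr; congr (- (_ * _)).
  by apply: etrans (lapM x sa s2) _; congr (_ + _); exact: mulrC.
have L2 : lap w2 x = lap (im v) x + lam * (a x * lap (re v) x + 2 * gdot a (re v) x
    + lap a x * complex.Re (v x)).
  apply: etrans (lapD x s2 sb1) _; congr (_ + _).
  apply: etrans (lapZ _ x sa1) _; congr (_ * _).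
  by apply: etrans (lapM x sa s1) _; congr (_ + _); exact: mulrC.
have S1 : gdot phi w1 x = gdot phi (re v) x
    - lam * (a x * gdot phi (im v) x + complex.Im (v x) * gdot phi a x).
  by rewrite (gdotDr phi x s1 sb2) (gdotZr _ phi x sa2) (gdotMr phi x sa s2) mulNr.
have S2 : gdot phi w2 x = gdot phi (im v) x
    + lam * (a x * gdot phi (re v) x + complex.Re (v x) * gdot phi a x).
  by rewrite (gdotDr phi x s2 sb1) (gdotZr _ phi x sa1) (gdotMr phi x sa s1).
have dW : gdot (carleman_weight a phi lam tau) phi x =
    2 * tau ^+ 2 * hess phi ('grad_ phi x) ('grad_ phi x) x
    + lam ^+ 2 * gdot (inv_sqr_nu a lam) phi x.
  have spp := smooth_gdot sp sp.
  rewrite (gdotDl phi x (smoothM (smoothC (tau ^+ 2)) spp) (smoothM (smoothC (lam ^+ 2)) sh)).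
  rewrite (gdotZl _ phi x spp) (gdotZl _ phi x sh) (gdot_gdotl phi x sp sp).
  by congr (_ + _); ring.
have A0 := gdot_ge0 a x.
have eh : `|lam ^+ 2 * gdot (inv_sqr_nu a lam) phi x| <= B * kappa * tau ^+ 2.
  rewrite (gdot_inv_sqr_nu lam phi x sa).
  apply: (damping_weight_bound B1 (ltW k0) a0 l0 hE A0 aB l5 _ yB).
  by rewrite gdotC; exact: gdot_sqr_le.
have dG w : gdot (damping_coupling a lam) w x ^+ 2 <=
    B ^+ 2 * kappa ^+ 2 * tau ^+ 4 * gdot w w x.
  have sla := smoothM (smoothC lam) sa.
  rewrite (gdotZl _ w x (smoothM sla sh)) (gdotMl w x sla sh) (gdotZl _ w x sa).
  rewrite (gdot_inv_sqr_nu lam w x sa).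
  have := damping_gradient_bound B1 a0 l0 hE aB l5 (gdot_ge0 w x) (gdot_sqr_le a w x).
  by congr (_ ^+ 2 <= _); ring.
(* The form in (xi, t) is evaluated at xi = grad w and t = tau w, for each real component w
   separately. *)
have QFw w : c1 * (gdot w w x + tau ^+ 2 * w x ^+ 2) <=
    4 * hess phi ('grad_ w x) ('grad_ w x) x
    + 4 * (tau ^+ 2 * w x ^+ 2) * hess phi ('grad_ phi x) ('grad_ phi x) x
    + M * gdot phi w x ^+ 2
    - rho x * (gdot w w x - tau ^+ 2 * w x ^+ 2 * gdot phi phi x).
  have := QF ('grad_ w x) (tau * w x); rewrite !exprMn.
  by rewrite (eq_bigr (fun j => partial j w x * partial j w x)).
have sqB (s : R) : `|s| <= B -> s ^+ 2 <= B ^+ 2.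
  by move=> sB; rewrite -[s ^+ 2]real_normK ?num_real// ler_sqr ?nnegrE.
have gB f w : gdot f f x <= B ^+ 2 -> gdot f w x ^+ 2 <= B ^+ 2 * gdot w w x.
  move=> fB; apply: le_trans (gdot_sqr_le f w x) _.
  by rewrite ler_wpM2r// gdot_ge0.
have half : B / 2 <= B by rewrite ler_pdivrMr// ler_peMr// ler1n.
have aB' : gdot a a x <= B * a x by apply: le_trans aB _; rewrite ler_wpM2r.
have daB : gdot phi a x ^+ 2 <= gdot a a x * B.
  rewrite gdotC; apply: le_trans (gdot_sqr_le a phi x) _.
  by apply: ler_wpM2l => //; exact: le_trans yB half.
have w1E : w1 x = complex.Re (v x) - lam * a x * complex.Im (v x).
  by rewrite /w1 /damped_re mulNr mulrA.
have w2E : w2 x = complex.Im (v x) + lam * a x * complex.Re (v x).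
  by rewrite /w2 /damped_im mulrA.
rewrite !Pphi_complex// /carleman_null -/w1 -/w2 dW /sqr_norm /=.
exact: (carleman_pointwise B1 k0 k1 c10 kc kB kt l0 lk (erefl (lam * a x)) a0
  hE w1E w2E L1 L2 S1 S2 MB (sqB _ LpB) rB eh
  (gdot_ge0 w1 x) (gB _ w1 gpB) (gB _ w1 grB) (dG w1) (QFw w1)
  (gdot_ge0 w2 x) (gB _ w2 gpB) (gB _ w2 grB) (dG w2) (QFw w2)
  A0 aB' (gdot_ge0 (re v) x) (gdot_ge0 (im v) x) (gdot_damped_le lam x sa s1 s2)
  (gdot_sqr_le a (re v) x) (gdot_sqr_le a (im v) x) daB (sqB _ LaB)).
Qed.

End carleman_estimate.

(** * Choice of the constants and of rho *)

Section constants.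
Context (R : realType) (d : nat).
Local Notation E := 'rV[R]_d.
Implicit Types (a phi rho f g : E -> R) (K V : set E) (x : E).
Local Notation "'grad_ f x" := (fun j => partial j f x)
  (at level 10, f at level 8, x at level 8).

Lemma compact_supp_bounded K f : compact K -> smooth f ->
  (forall x, ~ K x -> f x = 0) -> exists2 M : R, 0 < M & forall x, `|f x| <= M.
Proof.
move=> /compact_sub_cube[N KN] sf f0.
have [M M0 fM] := cube_bounded N (smooth_continuous sf); exists M => // x.
have [Nx|Nx] := pselect (cube N x); first exact: fM.
by rewrite f0 ?normr0 ?ltW// => /KN.
Qed.

Lemma gdot_damping_le K a : compact K -> smooth a -> (forall x, 0 <= a x) ->
  (forall x, ~ K x -> a x = 0) ->
  exists2 c : R, 0 <= c & forall x, gdot a a x <= c * a x.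
Proof.
move=> cK sa a0 aK; have cK' := compact_closed_rV cK.
have /choice[M HM] (j : 'I_d) : exists M : R,
    0 < M /\ forall x, `|partial j (partial j a) x| <= M.
  have sj := smooth_partial j (smooth_partial j sa).
  have [M M0 MB] := compact_supp_bounded cK sj
    (partial_off_closed j cK' (partial_off_closed j cK' aK)).
  by exists M.
exists (\sum_j 4 * M j).
  by apply: sumr_ge0 => j _; rewrite mulr_ge0// ltW//; case: (HM j).
move=> x; rewrite mulr_suml; apply: ler_sum => j _; have [M0 MB] := HM j.
by rewrite -expr2; exact: sqr_partial_le sa a0 M0 MB.
Qed.

Lemma smooth_hess_norm2 f : smooth f -> smooth (hess_norm2 f).
Proof.
move=> sf; apply: smooth_sum => j; apply: smooth_sum => k.
by apply: smoothM; exact/smooth_partial/smooth_partial.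
Qed.

Lemma closure_bounded_compact V : bounded_set V -> compact (closure V).
Proof.
move=> /bounded_sub_cube[M VM]; apply: (subclosed_compact _ (cube_compact (n := d) (M := M))).
  exact: closed_closure.
have /closure_id -> := @closed_cube R d M.
exact: closure_subset.
Qed.

Lemma gdot_lower_bound V phi : bounded_set V -> smooth phi -> subelliptic V phi ->
  exists2 k0 : R, 0 < k0 & forall x, V x -> k0 <= gdot phi phi x.
Proof.
move=> bV sp [gpos _]; have cV := closure_bounded_compact bV.
have [V0|/nonemptyPn V0] := pselect (closure V !=set0); last first.
  by exists 1 => // x /subset_closure; rewrite V0.
have cg : {within closure V, continuous (gdot phi phi)}.
  exact/continuous_subspaceT/smooth_continuous/smooth_gdot.
have [x0 Vx0 min] := compact_EVT_min V0 cV cg.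
exists (gdot phi phi x0); first by rewrite -dotp_grad -enorm_sqr exprn_gt0// gpos// -inE.
by move=> x /subset_closure Vx; apply: min; rewrite inE.
Qed.

(** The order of choice matters: bounds [H] and [Y] for the Hessian and the gradient of phi
    determine [eps], [M], [rho] and c1 = c / (8 Y), and only then is [B] taken, which must dominate
    [M], rho and grad rho. *)
Lemma carleman_constants a phi V : bounded_set V -> smooth a -> smooth phi ->
  subelliptic V phi -> (forall x, 0 <= a x) ->
  (exists2 c : R, 0 <= c & forall x, gdot a a x <= c * a x) ->
  exists (rho : E -> R) (B c1 M : R), [/\ smooth rho, 1 <= B, 0 < c1, 0 <= M <= B &
    forall x, V x -> [/\ gdot a a x <= B / 2 * a x, `|lap a x| <= B,
      `|lap phi x| <= B, gdot (lap phi) (lap phi) x <= B ^+ 2 & gdot phi phi x <= B / 2]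
    /\ [/\ `|rho x| <= B, gdot rho rho x <= B ^+ 2 &
      forall p (t : R), c1 * (\sum_j p j ^+ 2 + t ^+ 2) <=
        4 * hess phi p p x + 4 * t ^+ 2 * hess phi ('grad_ phi x) ('grad_ phi x) x
        + M * (\sum_j partial j phi x * p j) ^+ 2
        - rho x * (\sum_j p j ^+ 2 - t ^+ 2 * gdot phi phi x)]].
Proof.
move=> bV sa sp sub a0 [ca ca0 aca]; have [k0 k00 kV] := gdot_lower_bound bV sp sub.
have [c c0 ort] := subelliptic_orthogonal sp sub.
have [N VN] := bounded_sub_cube bV.
have bnd f : smooth f -> exists2 M : R, 0 < M & forall x, V x -> `|f x| <= M.
  move=> /smooth_continuous /(cube_bounded N)[M M0 fM]; exists M => // x /VN.
  exact: fM.
have [spp sl sla] := And3 (smooth_gdot sp sp) (smooth_lap sp) (smooth_lap sa).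
have [y1 y10 yb] := bnd _ spp; have [h1 h10 hb] := bnd _ (smooth_hess_norm2 sp).
pose Y := 1 + y1; pose H := 1 + h1.
have Y1 : 1 <= Y by rewrite lerDl ltW.
have H1 : 1 <= H by rewrite lerDl ltW.
have [Y0 H0] : 0 < Y /\ 0 < H by split; exact: lt_le_trans ltr01 _.
have HY0 : 0 < H * Y by exact: mulr_gt0.
pose q := c / 2 + 4 * (H * Y); pose eps := c / 4 * k0 / q.
have q0 : 0 < q by rewrite addr_gt0 ?divr_gt0 ?mulr_gt0.
have eps0 : 0 < eps by rewrite !divr_gt0 ?mulr_gt0 ?divr_gt0.
have epsE : q * eps <= c / 4 * k0 by rewrite mulrC divfK ?gt_eqF.
pose M := (8 * (H * Y) + c + 128 * H ^+ 2 * Y ^+ 2 / c) / k0 ^+ 2.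
have ME : 8 * (H * Y) + c + 128 * H ^+ 2 * Y ^+ 2 / c <= M * k0 ^+ 2.
  by rewrite divfK// sqrf_eq0 gt_eqF.
have M0 : 0 <= M.
  have e1 : 0 <= 8 * (H * Y) by rewrite mulr_ge0// ltW.
  have e2 : 0 <= 128 * H ^+ 2 * Y ^+ 2 / c.
    exact: divr_ge0 (mulr_ge0 (mulr_ge0 (ler0n _ 128) (sqr_ge0 _)) (sqr_ge0 _)) (ltW c0).
  exact: divr_ge0 (addr_ge0 (addr_ge0 e1 (ltW c0)) e2) (sqr_ge0 _).
have ye0 x : gdot phi phi x + eps != 0 by rewrite gt_eqF// ltr_wpDl ?gdot_ge0.
(* rho = (c/2 - 4 H(e,e)) / |e|^2, with eps added to be smooth where e = grad phi
   vanishes. *)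
pose rho x := (c / 2 + - (2 * gdot (gdot phi phi) phi x)) * (gdot phi phi x + eps)^-1.
have srho : smooth rho.
  have si : smooth (fun x => (gdot phi phi x + eps)^-1).
    by apply: (smoothV ye0); smooth_auto.
  by rewrite /rho; smooth_auto.
have rhoE x : rho x * (gdot phi phi x + eps) =
    c / 2 - 4 * hess phi ('grad_ phi x) ('grad_ phi x) x.
  (* grad |grad phi|^2 . grad phi = 2 H(grad phi, grad phi). *)
  rewrite /rho divfK// (gdot_gdotl phi x sp sp).
  by move: (hess _ _ _ _) => h; ring.
have [b1 b10 B1] := bnd _ sla; have [b2 b20 B2] := bnd _ sl.
have [b3 b30 B3] := bnd _ (smooth_gdot sl sl); have [b4 b40 B4] := bnd _ srho.
have [b5 b50 B5] := bnd _ (smooth_gdot srho srho).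
pose B := 1 + M + 2 * ca + 2 * Y + b1 + b2 + b3 + b4 + b5.
have BB : 1 <= B /\ [/\ M <= B, ca <= B / 2, Y <= B / 2, b1 <= B & b2 <= B] /\
    [/\ b3 <= B, b4 <= B & b5 <= B].
  rewrite /B; move: (Y) (Y0) => y y0.
  by clear -M0 ca0 y0 b10 b20 b30 b40 b50; repeat split; lra.
move: BB => [B1' [[MB caB YB b1B b2B] [b3B b4B b5B]]].
have BB2 : B <= B ^+ 2 by rewrite expr2 ler_peMl// (le_trans _ B1').
exists rho, B, (c / (8 * Y)), M; split => //.
- by rewrite divr_gt0// mulr_gt0.
- by rewrite M0.
move=> x Vx; have yB := le_trans (ler_norm _) (yb x Vx).
have yY : gdot phi phi x <= Y by apply: le_trans yB _; rewrite lerDr.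
split; split.
- by apply: le_trans (aca x) _; rewrite ler_wpM2r.
- exact: le_trans (B1 x Vx) b1B.
- exact: le_trans (B2 x Vx) b2B.
- exact: le_trans (ler_norm _) (le_trans (B3 x Vx) (le_trans b3B BB2)).
- exact: le_trans yY YB.
- exact: le_trans (B4 x Vx) b4B.
- exact: le_trans (ler_norm _) (le_trans (B5 x Vx) (le_trans b5B BB2)).
apply: (quadratic_form_bound c0 H1 Y1 k00 eps0 sp _ (kV x Vx) yY _ (rhoE x) epsE ME).
  apply: le_trans (ler_norm _) (le_trans (hb x Vx) _).
  by rewrite /H; move: (h1) h10; clear => h h0; have := sqr_ge0 h; lra.
by move=> p; apply: ort; exact: subset_closure.
Qed.

(** The hypothesis reads lam^(5/4) <= kappa tau. Its fourth power is the last bound, as kappa <= 1,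
    and lam >= 1 gives the other two. *)
Lemma carleman_parameters (K kappa lam tau : R) : 1 <= K -> kappa * K = 1 ->
  1 <= lam -> K * lam `^ (5 / 4) <= tau ->
  [/\ 1 <= kappa * tau, lam <= kappa * tau & lam ^+ 5 <= kappa ^+ 2 * tau ^+ 4].
Proof.
move=> K1 kK l1 lt; have K0 : 0 < K by exact: lt_le_trans K1.
have k0 : 0 < kappa by rewrite -(pmulr_lgt0 _ K0) kK.
have k1 : kappa <= 1 by rewrite -kK ler_peMr// ltW.
have l0 : 0 <= lam by exact: le_trans l1.
have lk : lam `^ (5 / 4) <= kappa * tau.
  by have := ler_wpM2l (ltW k0) lt; rewrite mulrA kK mul1r.
have ll : lam <= kappa * tau.
  apply: le_trans lk; rewrite -[leLHS]powRr1//; apply: ler_powR => //.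
  by rewrite ler_pdivlMr// mul1r ler_nat.
split => //; first exact: le_trans ll.
have -> : lam ^+ 5 = (lam `^ (5 / 4)) ^+ 4.
  by rewrite -(powR_mulrn 4 (powR_ge0 _ _)) -powRrM divfK// powR_mulrn.
have p0 := powR_ge0 lam (5 / 4).
apply: (@le_trans _ _ ((kappa * tau) ^+ 4)).
  by rewrite lerXn2r// nnegrE// (le_trans _ lk).
rewrite exprMn ler_wpM2r ?exprn_even_ge0//.
by rewrite (exprD kappa 2 2) ler_piMl ?sqr_ge0// expr_le1// ltW.
Qed.

End constants.

(** * Integration of the pointwise estimate *)

Section integral_estimate.
Context (R : realType) (d : nat).
Local Notation E := 'rV[R]_d.
Local Notation C := R[i].
Implicit Types (a phi rho f g : E -> R) (u v : E -> C) (K V : set E) (x : E).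
Local Notation re u := (fun x => complex.Re (u x)).
Local Notation im u := (fun x => complex.Im (u x)).
Local Notation I f := (\int[lebesgue_rV d]_x (f x))%R.

Definition smooth_supp K f := smooth f /\ forall x, ~ K x -> f x = 0.

Lemma smooth_supp_integrable K f : compact K -> smooth_supp K f ->
  (lebesgue_rV d).-integrable setT (EFin \o f).
Proof. by move=> cK [sf f0]; exact: compact_supp_integrable cK (smooth_continuous sf) f0. Qed.

Lemma smooth_suppD K f g : smooth_supp K f -> smooth_supp K g ->
  smooth_supp K (fun x => f x + g x).
Proof.
move=> [sf f0] [sg g0]; split; first exact: smoothD.
by move=> x Kx; rewrite f0// g0// addr0.
Qed.

Lemma smooth_suppMl K f g : smooth f -> smooth_supp K g ->
  smooth_supp K (fun x => f x * g x).
Proof.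
move=> sf [sg g0]; split; first exact: smoothM.
by move=> x Kx; rewrite g0// mulr0.
Qed.

Lemma smooth_supp_sum K (s : seq 'I_d) (F : 'I_d -> E -> R) :
  (forall j, smooth_supp K (F j)) -> smooth_supp K (fun x => \sum_(j <- s) F j x).
Proof.
move=> KF; split; first by apply: smooth_sum => j; case: (KF j).
by move=> x Kx; apply: big1 => j _; case: (KF j) => _ ->.
Qed.

Lemma Rintegral_suppD K f g : compact K -> smooth_supp K f -> smooth_supp K g ->
  I (fun x => f x + g x) = I f + I g.
Proof.
move=> cK Kf Kg.
by rewrite (RintegralD measurableT (smooth_supp_integrable cK Kf) (smooth_supp_integrable cK Kg)).
Qed.

Lemma Rintegral_suppZ K (c : R) f : compact K -> smooth_supp K f ->
  I (fun x => c * f x) = c * I f.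
Proof.
by move=> cK Kf; rewrite (RintegralZl _ measurableT (smooth_supp_integrable cK Kf)).
Qed.

Lemma Rintegral_supp_sum K (s : seq 'I_d) (F : 'I_d -> E -> R) : compact K ->
  (forall j, smooth_supp K (F j)) ->
  I (fun x => \sum_(j <- s) F j x) = \sum_(j <- s) I (F j).
Proof.
move=> cK KF; elim: s => [|j s IHs].
  rewrite big_nil (_ : (fun x => _) = fun=> 0); first by rewrite /Rintegral integral0.
  by apply/funext => x; rewrite big_nil.
rewrite big_cons -IHs -(Rintegral_suppD cK (KF j) (smooth_supp_sum s KF)).
by congr (Rintegral _ _ _); apply/funext => x; rewrite big_cons.
Qed.

(** The comparison is asked on K only, because the bounds on the derivatives of phi and rho hold
    only in V. *)
Lemma le_Rintegral_supp K f g : compact K -> smooth_supp K f -> smooth_supp K g ->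
  (forall x, K x -> f x <= g x) -> I f <= I g.
Proof.
move=> cK Kf Kg fg; have [[_ f0] [_ g0]] := (Kf, Kg).
apply: (le_Rintegral measurableT (smooth_supp_integrable cK Kf) (smooth_supp_integrable cK Kg)).
move=> x _; have [Kx|Kx] := pselect (K x); first exact: fg.
by rewrite f0// g0.
Qed.

Lemma smooth_supp_sqr_norm K u : csmooth u -> (forall x, ~ K x -> u x = 0) ->
  smooth_supp K (fun x => sqr_norm (u x)).
Proof.
move=> [s1 s2] u0; split; first by rewrite /sqr_norm; smooth_auto.
by move=> x /u0 ->; rewrite /sqr_norm /= expr0n addr0.
Qed.

Lemma L2norm_sqr_smooth K V u f : compact K -> K `<=` V -> smooth_supp K f ->
  (forall x, sqr_norm (u x) = f x) -> (L2norm V u ^+ 2 = (I f)%:E)%E.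
Proof. by move=> cK KV [sf f0] uf; exact: L2norm_sqr_supp cK KV sf uf f0. Qed.

Lemma sqr_norm_nu a (lam : R) (z : C) x :
  sqr_norm ((nu a lam x)%:C * z) = (1 + (lam * a x) ^+ 2) * sqr_norm z.
Proof.
have n : nu a lam x ^+ 2 = 1 + (lam * a x) ^+ 2.
  by rewrite exprMn sqr_sqrtr// addr_ge0// mulr_ge0 ?sqr_ge0.
rewrite /sqr_norm -n; case: z => z1 z2 /=.
move: (nu a lam x) => {}n; ring.
Qed.

Lemma sqr_norm_Dop j v x :
  sqr_norm (Dop j v x) = partial j (re v) x * partial j (re v) x
    + partial j (im v) x * partial j (im v) x.
Proof. by rewrite Dop_complex /sqr_norm /= sqrrN addrC !expr2. Qed.

Lemma L2norm_nu_Dop K V a v (lam : R) : compact K -> K `<=` V -> smooth a ->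
  csmooth v -> (forall x, ~ K x -> v x = 0) ->
  (\sum_(j < d) L2norm V (fun x => (nu a lam x)%:C * Dop j v x)%R ^+ 2 =
   (I (fun x => (1 + (lam * a x) ^+ 2) *
     (gdot (re v) (re v) x + gdot (im v) (im v) x))%R)%:E)%E.
Proof.
move=> cK KV sa [s1 s2] v0; have cK' := compact_closed_rV cK.
have r0 y : ~ K y -> complex.Re (v y) = 0 by move=> /v0 ->.
have i0 y : ~ K y -> complex.Im (v y) = 0 by move=> /v0 ->.
pose F j x := (1 + (lam * a x) ^+ 2) *
  (partial j (re v) x * partial j (re v) x + partial j (im v) x * partial j (im v) x).
have KF j : smooth_supp K (F j).
  split; first by rewrite /F; smooth_auto.
  move=> x Kx; rewrite /F (partial_off_closed j cK' r0 Kx).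
  by rewrite (partial_off_closed j cK' i0 Kx) mulr0 addr0 mulr0.
transitivity (\sum_(j < d) (I (F j))%:E)%E.
  apply: eq_bigr => j _; apply: (L2norm_sqr_smooth cK KV (KF j)) => x.
  by rewrite sqr_norm_nu sqr_norm_Dop.
rewrite sumEFin -(Rintegral_supp_sum _ cK KF); congr (Rintegral _ _ _)%:E; apply/funext => x.
by rewrite /F -mulr_sumr big_split.
Qed.

Lemma sqr_norm_Q1 a phi (lam tau : R) v x :
  let g := formal_adjoint (Pphi a phi lam tau) v in
  let p := Pphi a phi lam tau v in
  sqr_norm (Q1 a phi lam tau v x) =
    4^-1 * ((complex.Re (p x) - complex.Re (g x)) ^+ 2
            + (complex.Im (p x) - complex.Im (g x)) ^+ 2).
Proof.
move=> g p; rewrite /Q1 -/g -/p.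
have -> : (2 * 'i : C)^-1 = 0 +i* - 2^-1.
  apply: (mulfI (x := 2 * 'i)); first by rewrite mulf_neq0 ?neq0Ci ?pnatr_eq0.
  rewrite mulfV ?mulf_neq0 ?neq0Ci ?pnatr_eq0//.
  by apply/eqP; rewrite eq_complex; simpc => /=; rewrite mulfV ?eqxx ?pnatr_eq0.
rewrite /sqr_norm; case: (p x) => p1 p2; case: (g x) => g1 g2 /=.
by field.
Qed.

Lemma sqr_norm_Q2 a phi (lam tau : R) v x :
  let g := formal_adjoint (Pphi a phi lam tau) v in
  let p := Pphi a phi lam tau v in
  sqr_norm (Q2 a phi lam tau v x) =
    4^-1 * ((complex.Re (p x) + complex.Re (g x)) ^+ 2
            + (complex.Im (p x) + complex.Im (g x)) ^+ 2).
Proof.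
move=> g p; rewrite /Q2 -/g -/p.
have -> : (2 : C)^-1 = 2^-1 +i* 0.
  apply: (mulfI (x := 2)); first by rewrite pnatr_eq0.
  rewrite mulfV ?pnatr_eq0//.
  by apply/eqP; rewrite eq_complex; simpc => /=; rewrite mulfV ?eqxx ?pnatr_eq0.
rewrite /sqr_norm; case: (p x) => p1 p2; case: (g x) => g1 g2 /=.
by field.
Qed.

Lemma L2norm_Q_le K V a phi (lam tau : R) v : compact K -> open V -> smooth a ->
  smooth phi -> csmooth v -> (forall x, ~ K x -> v x = 0) ->
  (L2norm V (Q1 a phi lam tau v) ^+ 2 + L2norm V (Q2 a phi lam tau v) ^+ 2 <=
   (2^-1 * I (fun x => sqr_norm (Pphi a phi lam tau v x))
    + 2^-1 * I (fun x => sqr_norm (Pphi a phi (- lam) (- tau) v x)))%:E)%E.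
Proof.
move=> cK oV sa sp sv v0; have cK' := compact_closed_rV cK.
have [sg [[Kg [cKg g0]] gle]] := Rintegral_sqr_adjoint_le lam tau cK sa sp sv v0.
have sP := csmooth_Pphi lam tau sa sp sv.
have P0 := Pphi_off lam tau cK' sa sp sv v0.
move: sg g0 gle; set g := formal_adjoint _ _ => sg g0 gle.
have cU : compact (K `|` Kg) by exact: compactU.
have P0' x : ~ (K `|` Kg) x -> Pphi a phi lam tau v x = 0.
  by move=> KUx; apply: P0 => Kx; apply: KUx; left.
have g0' x : ~ (K `|` Kg) x -> g x = 0.
  by move=> KUx; apply: g0 => Kx; apply: KUx; right.
have KP := smooth_supp_sqr_norm sP P0'; have Kg2 := smooth_supp_sqr_norm sg g0'.
have [sP1 sP2] := sP; have [sg1 sg2] := sg.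
have K1 : smooth_supp (K `|` Kg) (fun x => sqr_norm (Q1 a phi lam tau v x)).
  rewrite (funext (sqr_norm_Q1 a phi lam tau v)).
  rewrite -/g; split; first by smooth_auto.
  by move=> x KUx; rewrite P0'// g0'//= subrr expr0n addr0 mulr0.
have K2 : smooth_supp (K `|` Kg) (fun x => sqr_norm (Q2 a phi lam tau v x)).
  rewrite (funext (sqr_norm_Q2 a phi lam tau v)).
  rewrite -/g; split; first by smooth_auto.
  by move=> x KUx; rewrite P0'// g0'//= addr0 expr0n addr0 mulr0.
have b1 := L2norm_sqr_le cU oV K1.1 (fun=> erefl) K1.2.
have b2 := L2norm_sqr_le cU oV K2.1 (fun=> erefl) K2.2.
apply: le_trans (leeD b1 b2) _; rewrite -EFinD lee_fin.
rewrite -(Rintegral_suppD cU K1 K2).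
have -> : (fun x => sqr_norm (Q1 a phi lam tau v x) + sqr_norm (Q2 a phi lam tau v x))
    = fun x => 2^-1 * (sqr_norm (Pphi a phi lam tau v x) + sqr_norm (g x)).
  apply/funext => x; rewrite sqr_norm_Q1 sqr_norm_Q2 /sqr_norm -/g.
  case: (Pphi a phi lam tau v x) => p1 p2; case: (g x) => g1 g2 /=; by field.
rewrite (Rintegral_suppZ _ cU (smooth_suppD KP Kg2)) (Rintegral_suppD cU KP Kg2).
by rewrite mulrDr lerD2l ler_wpM2l.
Qed.

Lemma carleman_integral K a phi rho v (lam tau m : R) : compact K -> smooth a ->
  smooth phi -> smooth rho -> csmooth v -> (forall x, ~ K x -> v x = 0) ->
  (forall x, K x ->
    tau ^+ 3 * ((1 + (lam * a x) ^+ 2) * sqr_norm (v x))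
    + tau * ((1 + (lam * a x) ^+ 2) * (gdot (re v) (re v) x + gdot (im v) (im v) x))
    + sqr_norm (Pphi a phi lam tau v x) / 2
    + sqr_norm (Pphi a phi (- lam) (- tau) v x) / 2
    + m * carleman_null a phi rho lam tau (re v) (im v) x
    <= (2 * m + 1) * sqr_norm (Pphi a phi lam tau v x)) ->
  tau ^+ 3 * I (fun x => (1 + (lam * a x) ^+ 2) * sqr_norm (v x))
  + tau * I (fun x => (1 + (lam * a x) ^+ 2) *
      (gdot (re v) (re v) x + gdot (im v) (im v) x))
  + (2^-1 * I (fun x => sqr_norm (Pphi a phi lam tau v x))
     + 2^-1 * I (fun x => sqr_norm (Pphi a phi (- lam) (- tau) v x)))
  <= (2 * m + 1) * I (fun x => sqr_norm (Pphi a phi lam tau v x)).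
Proof.
move=> cK sa sp sr sv v0 le; have cK' := compact_closed_rV cK; have [s1 s2] := sv.
have r0 y : ~ K y -> complex.Re (v y) = 0 by move=> /v0 ->.
have i0 y : ~ K y -> complex.Im (v y) = 0 by move=> /v0 ->.
have sn : smooth (fun x => 1 + (lam * a x) ^+ 2) by smooth_auto.
have k1 := smooth_suppMl sn (smooth_supp_sqr_norm sv v0).
have kg : smooth_supp K (fun x => gdot (re v) (re v) x + gdot (im v) (im v) x).
  split; first by smooth_auto.
  by move=> x Kx; rewrite (gdot_off _ cK' r0 Kx) (gdot_off _ cK' i0 Kx) addr0.
have k2 := smooth_suppMl sn kg.
have k3 := smooth_supp_sqr_norm (csmooth_Pphi lam tau sa sp sv)
  (Pphi_off lam tau cK' sa sp sv v0).
have k4 := smooth_supp_sqr_norm (csmooth_Pphi (- lam) (- tau) sa sp sv)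
  (Pphi_off (- lam) (- tau) cK' sa sp sv v0).
have [sN N0 IN] := null_on_carleman lam tau cK sa sp sr s1 s2 r0 i0.
have k5 : smooth_supp K (carleman_null a phi rho lam tau (re v) (im v)) by [].
have kZ (c : R) f : smooth_supp K f -> smooth_supp K (fun x => c * f x).
  by apply: smooth_suppMl; exact: smoothC.
have I5 : I (carleman_null a phi rho lam tau (re v) (im v)) = 0.
  by rewrite /Rintegral IN.
have k12 := smooth_suppD (kZ (tau ^+ 3) _ k1) (kZ tau _ k2).
have k34 := smooth_suppD (kZ 2^-1 _ k3) (kZ 2^-1 _ k4).
have k14 := smooth_suppD k12 k34; have k15 := smooth_suppD k14 (kZ m _ k5).
have := le_Rintegral_supp cK k15 (kZ (2 * m + 1) _ k3).
rewrite (Rintegral_suppD cK k14 (kZ m _ k5)) (Rintegral_suppD cK k12 k34).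
rewrite (Rintegral_suppD cK (kZ (tau ^+ 3) _ k1) (kZ tau _ k2)).
rewrite (Rintegral_suppD cK (kZ 2^-1 _ k3) (kZ 2^-1 _ k4)).
rewrite (Rintegral_suppZ _ cK k1) (Rintegral_suppZ _ cK k2).
rewrite !(Rintegral_suppZ _ cK k3) (Rintegral_suppZ _ cK k4) (Rintegral_suppZ _ cK k5).
rewrite I5 mulr0 addr0; apply=> x Kx.
by have := le x Kx; rewrite (mulrC _ 2^-1) [X in _ + X + _]mulrC !addrA.
Qed.

End integral_estimate.

Theorem theorem3p1 (R : realType) (d : nat) (hd : (0 < d)%N)
  (Om : set 'rV[R]_d) (hOm : smooth_bounded_domain Om)
  (a : 'rV[R]_d -> R) (ha : real_test_function Om a)
  (ha_ge0 : forall x, 0 <= a x) (ha_neq0 : exists x, a x != 0)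
  (V : set 'rV[R]_d) (hVopen : open V) (hVOm : V `<=` Om)
  (phi : 'rV[R]_d -> R) (hphi : smooth phi) (hsub : subelliptic V phi) :
  exists C K lam0 : R, [/\ 0 < C, 0 < K, 0 < lam0 &
    forall (v : 'rV[R]_d -> R[i]) (lam tau : R),
      test_function V v -> lam0 <= lam ->
      Num.max (K * `|lam| `^ (5 / 4)) 1 <= tau ->
      ((tau ^+ 3)%:E * L2norm V (fun x => (nu a lam x)%:C * v x)%R ^+ 2
       + tau%:E * \sum_(j < d)
           L2norm V (fun x => (nu a lam x)%:C * Dop j v x)%R ^+ 2
       + L2norm V (Q1 a phi lam tau v) ^+ 2
       + L2norm V (Q2 a phi lam tau v) ^+ 2
       <= C%:E * L2norm V (Pphi a phi lam tau v) ^+ 2)%E].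
Proof.
have [_ _ _ bOm _] := hOm; have bV : bounded_set V.
  by have [N [Nr OmN]] := bOm; exists N; split=> // y /OmN yN x /hVOm /yN.
have [sa [cKa KaOm]] := ha.
have aKa x : ~ closure [set x | a x != 0] x -> a x = 0.
  by move=> Kx; apply/eqP; apply: contra_notT Kx => ax; exact: subset_closure.
have [rho [B [c1 [M [sr B1 c10 MB bd]]]]] := carleman_constants bV sa hphi hsub ha_ge0
  (gdot_damping_le cKa sa ha_ge0 aKa).
have B3 : 1 <= B ^+ 3 by rewrite exprn_ege1.
(* With kappa = 1 / K, the two summands give 170 B^3 kappa <= 1 and 150 B^3 kappa <= c1. *)
pose K := 170 * B ^+ 3 + 150 * B ^+ 3 / c1; pose m := 16 / c1 + 6.
have K2 : 0 <= 150 * B ^+ 3 / c1.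
  by apply: divr_ge0 (ltW c10); rewrite mulr_ge0// (le_trans _ B3).
have K1 : 1 <= K.
  by rewrite -[leLHS]addr0; apply: lerD K2; rewrite mulr_ege1// ler1n.
have K0 : 0 < K by exact: lt_le_trans K1.
pose kappa := K^-1; have k0 : 0 < kappa by rewrite invr_gt0.
have kK : kappa * K = 1 by rewrite mulVf// gt_eqF.
have k1 : kappa <= 1 by rewrite invf_le1.
have kB : 170 * B ^+ 3 * kappa <= 1 by rewrite ler_pdivrMr// mul1r lerDl.
have kc : 150 * B ^+ 3 * kappa <= c1.
  rewrite ler_pdivrMr// [leRHS]mulrC -ler_pdivrMr// lerDr mulr_ge0//.
  exact: le_trans B3.
have m0 : 0 <= m by rewrite addr_ge0 ?divr_ge0 ?(ltW c10).
(* lam0 = 1 suffices: largeness of lam is used only to compare lam with lam^(5/4) and with 1. *)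
exists (2 * m + 1), K, 1; split => //; first by rewrite ltr_wpDl// mulr_ge0.
move=> v lam tau tv l1; have l0 : 0 <= lam by exact: le_trans l1.
rewrite ger0_norm// ge_max => /andP[lt t1].
have [kt lk l5] := carleman_parameters K1 kK l1 lt.
have [sv [S [cS SV v0]]] := test_function_supp tv.
have cS' := compact_closed_rV cS.
have pw x (Sx : S x) := let: conj (And5 aB LaB LpB gpB yB) (And3 rB grB QF) := bd x (SV x Sx)
  in carleman_at sa hphi sv B1 k0 k1 c10 kc kB kt l0 lk l5 (ha_ge0 x) aB LaB LpB gpB yB
       rB grB MB QF.
have main := carleman_integral cS sa hphi sr sv v0 pw.
have [sv1 sv2] := sv; have sn : smooth (fun x => 1 + (lam * a x) ^+ 2) by smooth_auto.
rewrite (L2norm_sqr_smooth cS SV (smooth_suppMl sn (smooth_supp_sqr_norm sv v0)));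
  last by move=> x; rewrite sqr_norm_nu.
rewrite (L2norm_nu_Dop lam cS SV sa sv v0).
rewrite (L2norm_sqr_smooth cS SV (smooth_supp_sqr_norm
  (csmooth_Pphi lam tau sa hphi sv) (Pphi_off lam tau cS' sa hphi sv v0)) (fun=> erefl)).
rewrite -addeA -!EFinM -EFinD.
apply: le_trans (leeD2l _ (L2norm_Q_le lam tau cS hVopen sa hphi sv v0)) _.
by rewrite -EFinD lee_fin.
Qed.
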